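(* Let $b<0$ and $\psi\in C([-1,0];\mathbb{R})$. Let $X$ be the unique continuous adapted process satisfying (the case $a=0$) $$dX(t)=\frac{b}{1+t}\int_{-1}^t X(s)\,ds\,dt+\sigma\,dB(t),\quad t\ge 0;\qquad X(t)=\psi(t),\quad t\in[-1,0].$$ Then $$\limsup_{t\to\infty}\frac{X(t)}{\sqrt{2t\log\log t}}=\frac{1}{\sqrt3}\sigma,\qquad\liminf_{t\to\infty}\frac{X(t)}{\sqrt{2t\log\log t}}=-\frac{1}{\sqrt3}\sigma,\quad\text{a.s.}$$
   Context: $\sigma>0$, $\psi$ is deterministic, and $B$ is a standard one-dimensional Brownian motion on a complete probability space with a filtration satisfying the usual conditions, to which $B$ is adapted. ''a.s.'' means almost surely. *)

(* Defs.v *)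
From HB Require Import structures.
From mathcomp Require Import all_boot all_order all_algebra.
From mathcomp Require Import all_classical all_reals all_analysis.

Set Implicit Arguments.
Unset Strict Implicit.
Unset Printing Implicit Defensive.

Import Order.TTheory GRing.Theory Num.Theory.
Import numFieldNormedType.Exports.

Local Open Scope classical_set_scope.
Local Open Scope ring_scope.

(* Processes and filtrations are indexed by the whole of R; their values at
   irrelevant times (t < 0 for filtrations and Brownian motion, t < -1 for
   solutions) are never constrained. *)

Record usual_filtration (d : measure_display) (T : measurableType d)
    (R : realType) (P : probability T R) (F : R -> set (set T)) : Prop := {
  filtration_sigma_algebra : forall t : R, 0 <= t -> sigma_algebra setT (F t) ;
  filtration_measurable : forall t : R, 0 <= t -> F t `<=` measurable ;
  filtration_nondecreasing : forall s t : R, 0 <= s -> s <= t -> F s `<=` F t ;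
  filtration_right_continuous : forall t : R, 0 <= t ->
    F t = \bigcap_(s in [set s | t < s]) F s ;
  filtration_complete : P.-negligible `<=` F 0 }.

Definition adapted (d : measure_display) (T : measurableType d)
    (R : realType) (F : R -> set (set T)) (Y : R -> T -> R) : Prop :=
  forall t : R, 0 <= t -> forall A : set R, measurable A -> F t (Y t @^-1` A).

(* The product rule for subfamilies is the case where the other A i are setT. *)
Definition mutually_independent (d : measure_display) (T : measurableType d)
    (R : realType) (P : probability T R) (n : nat) (Y : 'I_n -> T -> R) : Prop :=
  forall A : 'I_n -> set R, (forall i, measurable (A i)) ->
    P (\bigcap_i (Y i @^-1` A i)) = (\prod_(i < n) P (Y i @^-1` A i))%E.

Record brownian_motion (d : measure_display) (T : measurableType d)
    (R : realType) (P : probability T R) (B : R -> T -> R) : Prop := {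
  brownian_measurable : forall t : R, 0 <= t -> measurable_fun setT (B t) ;
  brownian_start : {ae P, forall w, B 0 w = 0} ;
  brownian_continuous :
    {ae P, forall w, {within `[0, +oo[, continuous (fun t => B t w)}} ;
  brownian_independent_increments : forall (n : nat) (t : nat -> R),
    0 <= t 0%N -> (forall i, t i <= t i.+1) ->
    mutually_independent P
      (fun (i : 'I_n) (w : T) => B (t i.+1) w - B (t i) w) ;
  (* the second parameter of normal_prob is the standard deviation *)
  brownian_normal_increments : forall s t : R, 0 <= s -> s < t ->
    forall A : set R, measurable A ->
    P ((fun w => B t w - B s w) @^-1` A) = normal_prob 0 (Num.sqrt (t - s)) A }.

(* Since the noise is additive, the stochastic integral of the constant sigma
   over [0, t] is sigma * B t. *)
Record averaged_delay_solution (d : measure_display) (T : measurableType d)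
    (R : realType) (P : probability T R) (F : R -> set (set T))
    (B : R -> T -> R) (b sigma : R) (psi : R -> R) (X : R -> T -> R) : Prop := {
  solution_adapted : adapted F X ;
  solution_continuous :
    {ae P, forall w, {within `[-1, +oo[, continuous (fun t => X t w)}} ;
  solution_initial :
    {ae P, forall w, forall t : R, -1 <= t <= 0 -> X t w = psi t} ;
  solution_equation : {ae P, forall w, forall t : R, 0 <= t ->
    X t w = psi 0
      + \int[lebesgue_measure]_(s in `[0, t])
          (b / (1 + s) * \int[lebesgue_measure]_(u in `[-1, s]) X u w)
      + sigma * B t w} }.

(* Main.v *)
Require Import Defs.
From HB Require Import structures.
From mathcomp Require Import all_boot all_order all_algebra.
From mathcomp Require Import all_classical all_reals all_analysis.
From mathcomp Require Import measurable_realfun normal_distribution.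
From mathcomp Require Import ring lra zify.

(** Write tau = 1 + t, Y(t) for the integral of X over [-1, t] and
    Z = X - sigma B.  The equation says Y' = Z + sigma B and
    Z' = (b / tau) Y: the integral Y is a slowly varying oscillator
    Y'' + (-b / tau) Y = 0 forced by white noise.  Its free solutions are known
    up to a negligible error by the WKB method: with m = 2 sqrt (-b) and
    y = tau^(1/4), the functions
      p_uv = y (u cos (m y^2) + v sin (m y^2))
    satisfy p'' = - (-b / tau + 3 / (16 tau^2)) p.  Hence the pairing
    W_uv = p_uv X - p_uv' Y has differential sigma p_uv dB, up to a drift
    (3/16) p_uv Y / tau^2.

    Instead of a stochastic integral, the noise is read off the grid
    0, 1, sqrt 2, sqrt 3, ...: almost surely B oscillates by at most 1 on every
    late cell ([brownian_grid_oscillation]), so that W_uv differs from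
    sigma S_uv, where S_uv is the sum of the p_uv (sqrt i) times the Brownian
    increments, by an error O(y^3) ([adjoint_close]).  The variance of S_uv is
    (u^2 + v^2) y^6 / 3 + O(y^4) ([wkb_variance]), because the square of the
    trigonometric factor averages to (u^2 + v^2) / 2 and y^2 = tau^(1/2)
    integrates to (2/3) y^6.  Sums of independent Gaussian variables obey the
    law of the iterated logarithm: the upper half is an exponential maximal
    inequality along geometric blocks ([noise_lil_upper]), the lower half a
    Gaussian lower tail for the increments over blocks ([noise_lil_lower]).

    The solution is recovered from W by
      y X = cos (m y^2) W_10 + sin (m y^2) W_01 + Y / (4 y^3),
    that is, y X is essentially W_uv in the moving unit direction
    (cos (m y^2), sin (m y^2)).  Every fixed unit direction contributes at most
    sigma sqrt (2 (y^6 / 3) ln ln y^6), and finitely many directions are almost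
    as good as all of them, whence the upper bound
    X <= (sigma / sqrt 3 + o(1)) sqrt (2 t ln ln t) ([path_upper]).  For the
    lower bound, at the resonant times m y^2 = 2 pi N^k the moving direction is
    (1, 0) and, for N large, the block ending at such a time carries almost all
    of the variance of S_10; the blocks being independent, infinitely many of
    them are large ([path_lower]).  The lower limit follows from the upper limit
    for the pair (-X, -B). *)

Set Implicit Arguments.
Unset Strict Implicit.
Unset Printing Implicit Defensive.

Import Order.TTheory GRing.Theory Num.Theory.
Import numFieldNormedType.Exports.

Local Open Scope classical_set_scope.
Local Open Scope ring_scope.

(** * Independence of a noise variable from its past *)

Section independence.
Context (d : measure_display) (T : measurableType d) (R : realType)
  (P : probability T R).

(** The joint law of (U, V) and the product of the two laws agree on rectangles,
    hence everywhere, and Tonelli's theorem splits the integral. *)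
Lemma independent_integralM d1 d2 (T1 : measurableType d1)
    (T2 : measurableType d2) (U : T -> T1) (V : T -> T2)
    (mU : measurable_fun setT U) (mV : measurable_fun setT V)
    (f : T1 -> R) (g : T2 -> R) :
  (forall A B, measurable A -> measurable B ->
    P (U @^-1` A `&` V @^-1` B) = (P (U @^-1` A) * P (V @^-1` B))%E) ->
  measurable_fun setT f -> measurable_fun setT g ->
  (forall x, 0 <= f x) -> (forall x, 0 <= g x) ->
  (\int[P]_w (f (U w) * g (V w))%:E =
   \int[P]_w (f (U w))%:E * \int[P]_w (g (V w))%:E)%E.
Proof.
move=> indUV mf mg f0 g0.
pose U' : {mfun T >-> T1} := HB.pack U (isMeasurableFun.Build _ _ _ _ _ mU).
pose V' : {mfun T >-> T2} := HB.pack V (isMeasurableFun.Build _ _ _ _ _ mV).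
have mUV : measurable_fun setT (fun w => (U w, V w)).
  exact: measurable_fun_pair.
pose UV' : {mfun T >-> (T1 * T2)%type} :=
  HB.pack (fun w => (U w, V w)) (isMeasurableFun.Build _ _ _ _ _ mUV).
have joint X : measurable X ->
    (distribution P U' \x distribution P V')%E X = distribution P UV' X.
  by move=> mX; apply: product_measure_unique.
have mfg : measurable_fun setT (fun z : T1 * T2 => (f z.1 * g z.2)%:E).
  apply/measurable_EFinP; apply: measurable_funM;
    exact: measurableT_comp.
transitivity (\int[distribution P UV']_z (f z.1 * g z.2)%:E)%E.
  rewrite ge0_integral_distribution// => z; rewrite lee_fin; exact: mulr_ge0.
rewrite (eq_measure_integral (distribution P U' \x distribution P V')%E); last first.
  by move=> A mA _; exact: (esym (joint A mA)).
rewrite fubini_tonelli1//; last by move=> z; rewrite lee_fin mulr_ge0.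
rewrite /fubini_F /=.
transitivity (\int[distribution P U']_x ((f x)%:E * \int[P]_w (g (V w))%:E))%E.
  apply: eq_integral => x _; under eq_integral do rewrite EFinM.
  rewrite ge0_integralZl//; last by rewrite lee_fin.
  - rewrite ge0_integral_distribution//; exact/measurable_EFinP.
  - exact/measurable_EFinP.
  - by move=> y _; rewrite lee_fin.
rewrite ge0_integralZr//=.
- rewrite ge0_integral_distribution//; exact/measurable_EFinP.
- exact/measurable_EFinP.
- by move=> y _; rewrite lee_fin.
- by apply: integral_ge0 => w _; rewrite lee_fin.
Qed.

(** The pi-system generating the past of the noise, the sigma-algebra of
    xi_0, ..., xi_(k-1). *)
Definition prefix_boxes (xi : nat -> T -> R) (k : nat) : set (set T) :=
  [set A | exists2 D : nat -> set R, (forall i, measurable (D i)) &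
    A = \bigcap_(i in `I_k) (xi i @^-1` D i)].

Variable xi : nat -> T -> R.
Hypothesis mxi : forall i, measurable_fun setT (xi i).
Hypothesis ixi : forall n, mutually_independent P (fun i : 'I_n => xi i).

Let bigcap_ord n (D : nat -> set R) :
  \bigcap_(i in `I_n) (xi i @^-1` D i) = \bigcap_(i : 'I_n) (xi i @^-1` D i).
Proof.
apply/seteqP; split=> w h i.
  by move=> _; apply: (h i) => /=.
by move=> /= ilt; exact: (h (Ordinal ilt)).
Qed.

Lemma prefix_boxes_measurable k : prefix_boxes xi k `<=` measurable.
Proof.
move=> _ [D mD ->]; apply: bigcap_measurableType => i _.
by rewrite -[X in measurable X]setTI; exact: mxi.
Qed.

(** Finite independence is given on boxes only; both sides are finite measures in
    [A], so uniqueness on the pi-system of boxes extends it to the whole past. *)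
Lemma prefix_independent k A B : <<s prefix_boxes xi k>> A -> measurable B ->
  P (A `&` xi k @^-1` B) = (P A * P (xi k @^-1` B))%E.
Proof.
move=> sA mB.
have mE : measurable (xi k @^-1` B).
  by rewrite -[X in measurable X]setTI; exact: mxi.
have bT : prefix_boxes xi k setT.
  exists (fun=> setT) => //; apply/seteqP; split => // w _ i _ //.
have p0 : 0 <= fine (P (xi k @^-1` B)) by exact: fine_ge0.
pose m2 : {measure set T -> \bar R} := mscale (NngNum p0) P.
have m2E X : m2 X = (P (xi k @^-1` B) * P X)%E.
  by rewrite /m2 /= /mscale /= fineK ?fin_num_measure.
pose m1 : {measure set T -> \bar R} := mrestr P mE.
suff m12 : m1 A = m2 A.
  transitivity (m1 A); first by [].
  by rewrite m12 m2E muleC.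
apply: (g_sigma_algebra_measure_unique (prefix_boxes xi k) _ (fun=> setT)) => //.
- exact: prefix_boxes_measurable.
- by apply/seteqP; split => // w _; exists 0%N.
- move=> _ _ [D1 mD1 ->] [D2 mD2 ->].
  exists (fun i => D1 i `&` D2 i); first by move=> i; exact: measurableI.
  apply/seteqP; split=> w.
    by move=> [h1 h2] i ik; split; [exact: h1|exact: h2].
  by move=> h; split => i ik; have [] := h i ik.
- move=> _ [D mD ->]; rewrite m2E; rewrite /m1 /= /mrestr.
  pose D' i := if (i < k)%N then D i else B.
  have -> : \bigcap_(i in `I_k) (xi i @^-1` D i) `&` xi k @^-1` B =
            \bigcap_(i : 'I_k.+1) (xi i @^-1` D' i).
    rewrite -(bigcap_ord k.+1 D'); apply/seteqP; split=> w.
      move=> [h hk] i /=; rewrite ltnS leq_eqVlt => /predU1P[->|ik].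
        by rewrite /D' ltnn.
      by rewrite /D' ik; exact: (h i ik).
    move=> h; split => [i /= ik|].
      by have := h i (ltnW ik); rewrite /D' ik.
    by have := h k (ltnSn k); rewrite /D' ltnn.
  rewrite (ixi (A := fun i => D' i)); last first.
    by move=> i; rewrite /D'; case: ifP.
  rewrite big_ord_recr /= muleC; congr (_ * _)%E; first by rewrite /D' ltnn.
  rewrite bigcap_ord (ixi (A := fun i => D i))//.
  by apply: eq_bigr => i _; rewrite /D' ltn_ord.
- by move=> n; rewrite /m1 /= /mrestr setTI ltey_eq fin_num_measure.
Qed.

End independence.

(** * Weighted sums of Gaussian noise and their maximal inequality *)

Section gaussian_sums.
Context (d : measure_display) (T : measurableType d) (R : realType)
  (P : probability T R).

(** Independent centred Gaussian variables of variances v_i, characterised by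
    their Laplace transforms; this form lets v_i vanish and is the only way in
    which the Gaussian law enters. *)
Record gaussian_noise (xi : nat -> T -> R) (v : nat -> R) : Prop := {
  noise_measurable : forall i, measurable_fun setT (xi i) ;
  noise_independent : forall n, mutually_independent P (fun i : 'I_n => xi i) ;
  noise_mgf : forall i (l : R),
    (\int[P]_w (expR (l * xi i w))%:E = (expR (l ^+ 2 * v i / 2))%:E)%E }.

Definition wsum (xi : nat -> T -> R) (f : nat -> R) (n : nat) (w : T) : R :=
  \sum_(i < n) f i * xi i w.

Definition wvar (v : nat -> R) (f : nat -> R) (n : nat) : R :=
  \sum_(i < n) f i ^+ 2 * v i.

Variables (xi : nat -> T -> R) (v : nat -> R).
Hypothesis noise : gaussian_noise xi v.

Local Notation prefixType k := (g_sigma_algebraType (prefix_boxes xi k)).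

Lemma prefix_measurable k (A : set T) :
  measurable (A : set (prefixType k)) -> measurable A.
Proof.
apply: smallest_sub; first exact: sigma_algebra_measurable.
exact: prefix_boxes_measurable (noise_measurable noise) k.
Qed.

Lemma prefix_measurable_fun k d' (T' : measurableType d') (g : T -> T') :
  measurable_fun setT (g : prefixType k -> T') -> measurable_fun setT g.
Proof. by move=> mg _ A mA; apply: (@prefix_measurable k); exact: mg. Qed.

Lemma prefix_measurable_noise k i : (i < k)%N ->
  measurable_fun setT (xi i : prefixType k -> R).
Proof.
move=> ik _ A mA; rewrite setTI; apply: sub_sigma_algebra.
exists (fun j => if j == i then A else setT).
  by move=> j; case: ifP.
apply/seteqP; split=> w.
  by move=> Aw j _ /=; case: eqP => [->|].
by move=> /(_ i ik) /=; rewrite eqxx.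
Qed.

Lemma prefix_measurable_wsum f k n : (n <= k)%N ->
  measurable_fun setT (wsum xi f n : prefixType k -> R).
Proof.
move=> nk; apply: measurable_sum => i; apply: measurable_funM => //.
apply: prefix_measurable_noise; exact: leq_trans nk.
Qed.

Lemma measurable_wsum f n : measurable_fun setT (wsum xi f n).
Proof. exact: (@prefix_measurable_fun n _ _ _ (prefix_measurable_wsum f (leqnn n))). Qed.

(** Conditioning on the past in integrated form: the k-th variable factors out of
    any nonnegative function of the previous ones. *)
Lemma prefix_mgf k l (g : T -> R) :
  measurable_fun setT (g : prefixType k -> R) -> (forall w, 0 <= g w) ->
  (\int[P]_w (g w * expR (l * xi k w))%:E =
   \int[P]_w (g w)%:E * (expR (l ^+ 2 * v k / 2))%:E)%E.
Proof.
move=> mg g0; rewrite -(noise_mgf noise).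
pose idp : T -> prefixType k := fun w => w.
have midp : measurable_fun setT idp.
  by move=> _ A mA; rewrite setTI; exact: (prefix_measurable mA).
have := @independent_integralM _ _ _ P _ _ (prefixType k) R idp
   (xi k) midp (noise_measurable noise k) g (fun x => expR (l * x)).
apply => //.
- move=> A B sA mB; apply: prefix_independent => //.
  + exact: noise_measurable noise.
  + exact: noise_independent noise.
- by apply: measurableT_comp => //; exact: measurable_funM.
Qed.

Lemma measurable_expR_wsum f n l c :
  measurable_fun setT (fun w => expR (l * wsum xi f n w - c)).
Proof.
apply: measurableT_comp => //; apply: measurable_funB => //.
by apply: measurable_funM => //; exact: measurable_wsum.
Qed.

Let below f a k := [set w | forall j, (j <= k)%N -> wsum xi f j w < a].

Let prefix_measurable_below f a k :
  measurable (below f a k : set (prefixType k)).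
Proof.
have -> : below f a k =
    \bigcap_(j in `I_k.+1) (wsum xi f j @^-1` [set x | x < a]).
  by apply/seteqP; split=> w h j; exact: h.
apply: bigcap_measurableType => j jk.
rewrite -[X in measurable X]setTI.
apply: (@prefix_measurable_wsum f k j) => //.
by rewrite -set_itvNyo; exact: measurable_itv.
Qed.

Let measurable_below f a k : measurable (below f a k).
Proof. exact: (@prefix_measurable k _ (@prefix_measurable_below f a k)). Qed.

Lemma wvar_recr f n : wvar v f n.+1 = wvar v f n + f n ^+ 2 * v n.
Proof. by rewrite /wvar big_ord_recr. Qed.

Lemma wsum_recr f n w : wsum xi f n.+1 w = wsum xi f n w + f n * xi n w.
Proof. by rewrite /wsum big_ord_recr. Qed.

Hypothesis v0 : forall i, 0 <= v i.

Lemma wvar_nd f m n : (m <= n)%N -> wvar v f m <= wvar v f n.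
Proof.
move/subnK <-; elim: (n - m)%N => // p IH; rewrite addSn wvar_recr.
by rewrite (le_trans IH)// lerDl mulr_ge0// sqr_ge0.
Qed.

Let mgale f l k w := expR (l * wsum xi f k w - l ^+ 2 * wvar v f k / 2).

Let mgale_step f l k (A : set T) : measurable (A : set (prefixType k)) ->
  (\int[P]_w (\1_A w * mgale f l k.+1 w)%:E =
   \int[P]_w (\1_A w * mgale f l k w)%:E)%E.
Proof.
move=> mA.
have mg : measurable_fun setT
    ((fun w => \1_A w * mgale f l k w) : prefixType k -> R).
  apply: measurable_funM; first exact: measurable_indic.
  apply: measurableT_comp => //; apply: measurable_funB => //.
  apply: measurable_funM => //; exact: prefix_measurable_wsum.
have g0 w : 0 <= \1_A w * mgale f l k w by rewrite mulr_ge0// expR_ge0.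
pose c := expR (- ((l * f k) ^+ 2 * v k / 2)).
transitivity (\int[P]_w (c%:E * (\1_A w * mgale f l k w *
    expR ((l * f k) * xi k w))%:E))%E.
  apply: eq_integral => w _; rewrite -EFinM; congr EFin.
  rewrite /mgale wsum_recr wvar_recr mulrCA -!mulrA; congr (_ * _).
  rewrite /c mulrC -!expRD; congr expR; ring.
have mfun : measurable_fun setT (fun w => \1_A w * mgale f l k w : R).
  exact: (@prefix_measurable_fun k _ _ _ mg).
rewrite ge0_integralZl//.
- rewrite (prefix_mgf _ mg g0) muleA muleC muleA -EFinM /c -expRD.
  by rewrite subrr expR0 mul1e.
- apply/measurable_EFinP; apply: measurable_funM => //.
  apply: measurableT_comp => //; apply: measurable_funM => //.
  exact: noise_measurable noise k.
- by move=> w _; rewrite lee_fin mulr_ge0// expR_ge0.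
- by rewrite lee_fin expR_ge0.
Qed.

(** Doob's argument for the exponential martingale
    exp (l S_k - l^2 V_k / 2): at the first passage of S over a the martingale is
    at least exp (l a - l^2 V_n / 2), and its mean stays equal to 1. *)
Lemma maximal_inequality f n a l : 0 < a -> 0 <= l ->
  (P [set w | exists2 k, (k <= n)%N & (a <= wsum xi f k w)%R]
   <= (expR (- (l * a) + l ^+ 2 * wvar v f n / 2))%:E)%E.
Proof.
move=> a0 l0.
have mb := measurable_below f a.
pose c := expR (l * a - l ^+ 2 * wvar v f n / 2).
pose J k := (\int[P]_w (\1_(below f a k) w * mgale f l k w)%:E)%E.
have J0 k : (0 <= J k)%E.
  by apply: integral_ge0 => w _; rewrite lee_fin mulr_ge0// expR_ge0.
have mm k : measurable_fun setT (mgale f l k) by exact: measurable_expR_wsum.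
suff H k : (k <= n)%N -> (J k + c%:E * P (~` below f a k) <= 1)%E.
  have -> : [set w | exists2 k, (k <= n)%N & a <= wsum xi f k w] =
      ~` below f a n.
    apply/seteqP; split => w.
      by move=> [k kn ak] /(_ k kn); rewrite ltNge ak.
    move=> h; apply: contrapT => h'; apply: h => j jn.
    by rewrite ltNge; apply/negP => aj; apply: h'; exists j.
  have cP : (c%:E * P (~` below f a n) <= 1)%E.
    by apply: le_trans (H n (leqnn n)); rewrite leeDr.
  have cc : c^-1 = expR (- (l * a) + l ^+ 2 * wvar v f n / 2).
    by rewrite -expRN; congr expR; ring.
  by rewrite -cc -[leRHS]mule1 -lee_pdivrMl ?invr_gt0 ?expR_gt0 ?invrK.
elim: k => [_|k IH kn]; rewrite /J.
  have -> : below f a 0%N = setT.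
    apply/seteqP; split => // w _ j; rewrite leqn0 => /eqP ->.
    by rewrite /wsum big_ord0.
  rewrite setCT measure0 mule0 adde0.
  under eq_integral => w _.
    rewrite indicT mul1r /mgale /wsum /wvar !big_ord0 !mulr0 mul0r subrr expR0.
    over.
  by rewrite integral_cst// mul1e; exact: probability_le1.
apply: le_trans (IH (ltnW kn)); rewrite /J.
(* D is the event of a first passage over a at step k + 1. *)
pose D := below f a k `\` below f a k.+1.
have mD : measurable D by exact: measurableD.
have bS : below f a k.+1 `<=` below f a k.
  by move=> w h j jk; apply: h; exact: leqW.
have -> : ~` below f a k.+1 = ~` below f a k `|` D.
  apply/seteqP; split => w.
    by move=> h; have [hk|hk] := pselect (below f a k w); [right|left].
  by move=> [h /bS//|[_ h]].
rewrite measureU//; [|exact: measurableC|]; last first.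
  by apply/seteqP; split => // w [h [/h]].
rewrite ge0_muleDr// addeCA addeC leeD2r//.
rewrite -(mgale_step f l (@prefix_measurable_below f a k)).
have PD : P D = (\int[P]_w (\1_D w)%:E)%E by rewrite integral_indic// setIT.
rewrite [X in (_ + c%:E * X <= _)%E](_ : _ = (\int[P]_w (\1_D w)%:E)%E)//.
rewrite -ge0_integralZl//; last 2 first.
- by apply/measurable_EFinP; exact: measurable_indic.
- by rewrite lee_fin expR_ge0.
have m1 : measurable_fun setT (fun w => (c%:E * (\1_D w)%:E)%E).
  by apply/measurable_EFinP; exact: measurable_funM.
have m2 j : measurable_fun setT
    (fun w => (\1_(below f a j) w * mgale f l k.+1 w)%:E).
  by apply/measurable_EFinP; exact: measurable_funM.
have p1 w : (0 <= c%:E * (\1_D w)%:E)%E.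
  by rewrite -EFinM lee_fin mulr_ge0// expR_ge0.
have p2 j w : (0 <= (\1_(below f a j) w * mgale f l k.+1 w)%:E)%E.
  by rewrite lee_fin mulr_ge0// expR_ge0.
rewrite addeC -ge0_integralD//; apply: ge0_le_integral => //.
- by move=> w _; rewrite adde_ge0.
- exact: emeasurable_funD.
move=> w _; rewrite -EFinM -EFinD lee_fin /D !indicE.
have [inS|ninS] := boolP (w \in below f a k.+1).
  have inB : w \in below f a k by move: inS; rewrite !inE; exact: bS.
  by rewrite inB in_setD inB inS mulr0 add0r.
rewrite in_setD ninS andbT mul0r addr0.
have [inB|ninB] := boolP (w \in below f a k); last by rewrite mulr0 mul0r.
rewrite mulr1 mul1r ler_expR lerB//; last first.
  by rewrite ler_wpM2r// ler_wpM2l ?sqr_ge0//; exact: wvar_nd.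
rewrite ler_wpM2l// leNgt; apply/negP => aS; move/negP: ninS; apply.
move: inB; rewrite !inE => h j; rewrite leq_eqVlt => /predU1P[->//|].
by rewrite ltnS; exact: h.
Qed.

End gaussian_sums.

(** * A Gaussian lower tail and a Borel-Cantelli criterion *)

Section lower_tail.
Context (d : measure_display) (T : measurableType d) (R : realType)
  (P : probability T R).

(** Exponential tilting.  Under the weight exp (l W) with l = (1 + e) a / v the
    variable W concentrates in [a, (1 + 2 e) a]: the mass outside is controlled
    by the weights with l - h and l + h, h = e a / v, and is at most half of the
    total when [small] holds.  On this interval the weight is at most
    exp (l (1 + 2 e) a), which converts weighted mass into probability.  The
    event [A] carries the past, on which W does not depend. *)
Lemma gaussian_tail_ge (A : set T) (W : T -> R) (v a e : R) :
  measurable A -> measurable_fun setT W -> 0 < v -> 0 < a -> 0 < e ->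
  (forall l, (\int[P]_w (\1_A w * expR (l * W w))%:E =
     P A * (expR (l ^+ 2 * v / 2))%:E)%E) ->
  expR (- (e ^+ 2 * (a ^+ 2 / v) / 2)) <= 1 / 4 ->
  (P A * (2^-1 * expR (- ((1 + e) * (1 + 3 * e) * (a ^+ 2 / v) / 2)))%:E <=
   P (A `&` [set w | (a <= W w)%R]))%E.
Proof.
move=> mA mW v0 a0 e0 mgf small.
have mE : measurable [set w | a <= W w].
  have -> : [set w | a <= W w] = W @^-1` `[a, +oo[.
    by apply/seteqP; split => w /=; rewrite in_itv/= andbT.
  by rewrite -[X in measurable X]setTI; exact: mW.
(* The tilted mean l v = (1 + e) a is the midpoint of [a, b], and h v is half
   of the length of this interval. *)
pose l := (1 + e) * a / v; pose b := (1 + 2 * e) * a; pose h := e * a / v.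
have h0 : 0 < h by rewrite divr_gt0// mulr_gt0.
have mexp k : measurable_fun setT (fun w => \1_A w * expR (k * W w)).
  apply: measurable_funM => //.
  by apply: measurableT_comp => //; exact: measurable_funM.
have l0 : 0 < l by rewrite divr_gt0// mulr_gt0//; lra.
have mAE : measurable (A `&` [set w | a <= W w]) by exact: measurableI.
have mI : measurable_fun setT
    (fun w => (\1_(A `&` [set w | a <= W w]) w : R)%:E).
  by apply/measurable_EFinP; exact: measurable_indic.
have mX k : measurable_fun setT (fun w => (\1_A w * expR (k * W w))%:E).
  exact/measurable_EFinP.
have pX k w : (0 <= (\1_A w * expR (k * W w))%:E)%E.
  by rewrite lee_fin mulr_ge0// expR_ge0.
have p0 x : (0 <= (expR x)%:E :> \bar R)%E by rewrite lee_fin expR_ge0.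
(* Pointwise: below a the second term dominates, above b the third one, and
   between them the first one. *)
have le1 : (\int[P]_w (\1_A w * expR (l * W w))%:E <=
    \int[P]_w ((expR (l * b))%:E * (\1_(A `&` [set w | a <= W w]) w)%:E +
      ((expR (h * a))%:E * (\1_A w * expR ((l - h) * W w))%:E +
       (expR (- (h * b)))%:E * (\1_A w * expR ((l + h) * W w))%:E)))%E.
  apply: ge0_le_integral => //.
    by apply: emeasurable_funD; [|apply: emeasurable_funD];
      exact: measurable_funeM.
  move=> w _; rewrite -!EFinM -!EFinD lee_fin indicI /=.
  have [wA|wA] := boolP (w \in A); last first.
    by rewrite !indicE (negbTE wA) !mul0r !mulr0 !addr0.
  rewrite !indicE wA !mul1r -!expRD.
  have pos1 x : 0 <= expR x :> R := expR_ge0 x.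
  have [aw|wa] := leP a (W w); last first.
    rewrite -[leLHS]add0r lerD ?mulr_ge0//.
    rewrite -[leLHS]addr0 lerD// ler_expR.
    by rewrite mulrBl addrC -addrA lerDl addrC subr_ge0 ler_pM2l// ltW.
  rewrite mem_set// mulr1.
  have [wb|bw] := leP (W w) b.
    by rewrite -[leLHS]addr0 lerD ?addr_ge0// ler_expR ler_wpM2l// ltW.
  rewrite -[leLHS]add0r lerD// -[leLHS]add0r lerD// ler_expR.
  by rewrite mulrDl addrCA lerDl addrC -mulrBr mulr_ge0 ?ltW// subr_gt0.
have m2 : measurable_fun setT (fun w =>
    ((expR (h * a))%:E * (\1_A w * expR ((l - h) * W w))%:E +
       (expR (- (h * b)))%:E * (\1_A w * expR ((l + h) * W w))%:E)%E).
  by apply: emeasurable_funD; exact: measurable_funeM.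
have m1 k x : measurable_fun setT
    (fun w => (x%:E * (\1_A w * expR (k * W w))%:E)%E).
  exact: measurable_funeM.
have p1 k x w : (0 <= (expR x)%:E * (\1_A w * expR (k * W w))%:E)%E.
  exact: mule_ge0.
have mI' : measurable_fun setT (fun w =>
    ((expR (l * b))%:E * (\1_(A `&` [set w | a <= W w]) w)%:E)%E).
  exact: measurable_funeM.
have p2 w : (0 <= (expR (h * a))%:E * (\1_A w * expR ((l - h) * W w))%:E +
    (expR (- (h * b)))%:E * (\1_A w * expR ((l + h) * W w))%:E)%E.
  exact: adde_ge0.
move: le1; rewrite mgf !ge0_integralD//.
have fA := fin_num_measure P _ mA; have fAE := fin_num_measure P _ mAE.
have IE : (\int[P]_w (\1_(A `&` [set w | (a <= W w)%R]) w)%:E)%E =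
    (fine (P (A `&` [set w | (a <= W w)%R])))%:E.
  by rewrite integral_indic// setIT fineK.
rewrite !ge0_integralZl// !mgf IE -(fineK fA) -(fineK fAE).
rewrite -!EFinM -!EFinD !lee_fin.
have pA : 0 <= fine (P A) by exact: fine_ge0.
move: (fine (P A)) (fine (P (A `&` _))) pA => p q pA.
pose q0 := a ^+ 2 / v.
have v1 : v != 0 by rewrite gt_eqF.
have -> : l ^+ 2 * v / 2 = (1 + e) ^+ 2 * q0 / 2.
  by rewrite /l /q0; field.
have e2 : expR (h * a) * (p * expR ((l - h) ^+ 2 * v / 2)) =
    p * (expR ((1 + e) ^+ 2 * q0 / 2) * expR (- (e ^+ 2 * q0 / 2))).
  rewrite mulrCA -!expRD; congr (_ * expR _).
  by rewrite /l /h /q0; field.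
have e3 : expR (- (h * b)) * (p * expR ((l + h) ^+ 2 * v / 2)) =
    p * (expR ((1 + e) ^+ 2 * q0 / 2) * expR (- (e ^+ 2 * q0 / 2))).
  rewrite mulrCA -!expRD; congr (_ * expR _).
  by rewrite /l /h /b /q0; field.
rewrite e2 e3 -/q0 => le1.
have -> : - ((1 + e) * (1 + 3 * e) * q0 / 2) =
    (1 + e) ^+ 2 * q0 / 2 - l * b by rewrite /l /b /q0; field.
rewrite expRD expRN -(ler_pM2l (expR_gt0 (l * b))).
have -> : expR (l * b) * (p * (2^-1 * (expR ((1 + e) ^+ 2 * q0 / 2) /
    expR (l * b)))) = p * expR ((1 + e) ^+ 2 * q0 / 2) / 2.
  by field; rewrite gt_eqF// expR_gt0.
move: le1 small; rewrite -/q0.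
have := expR_gt0 ((1 + e) ^+ 2 * q0 / 2).
move: (expR _) (expR (- _)) (expR (l * b)) => x y z x0 le1 y4.
have : p * (x * y) <= p * (x * (1 / 4)) by rewrite ler_wpM2l// ler_wpM2l// ltW.
by move: le1 => /= le1; lra.
Qed.

End lower_tail.

Section borel_cantelli.
Context (d : measure_display) (T : measurableType d) (R : realType)
  (P : probability T R).

(** Bounds by the increments of a function with arbitrarily small values can be
    summed over a tail without any evaluation of series. *)
Lemma borel_cantelli (E : nat -> set T) (g : nat -> R) (k0 : nat) :
  (forall k, measurable (E k)) ->
  (forall k, (k0 <= k)%N -> (P (E k) <= (g k - g k.+1)%:E)%E) ->
  (forall k, 0 <= g k) -> (forall e, 0 < e -> exists k, (k0 <= k)%N /\ g k <= e) ->
  {ae P, forall w, exists n, forall k, (n <= k)%N -> ~ E k w}.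
Proof.
move=> mE PE g0 gsmall.
pose L := \bigcap_n \bigcup_(k in ~` `I_n) E k.
have mU n : measurable (\bigcup_(k in ~` `I_n) E k) by exact: bigcup_measurable.
have mL : measurable L by exact: bigcap_measurableType.
exists L; split => //; last first.
  move=> w /= nw n _; apply: contrapT => h; apply: nw; exists n => k nk Ek.
  by apply: h; exists k => //=; apply/negP; rewrite -leqNgt.
apply/eqP; rewrite eq_le measure_ge0 andbT.
apply/lee_addgt0Pr => e e0; rewrite add0e.
have [n [kn ge]] := gsmall e e0.
have Ltail : L `<=` \bigcup_(k in ~` `I_n) E k by move=> w; exact.
have h := @measure_sigma_subadditive_tail _ _ _ P _ _ n mE mL Ltail.
apply: (le_trans h).
apply: lime_le; first by apply: is_cvg_nneseries.
apply: nearW => m.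
apply: (@le_trans _ _ (\sum_(n <= i < m) (g i - g i.+1)%:E)%E).
  rewrite big_nat_cond [leRHS]big_nat_cond; apply: lee_sum => i.
  by rewrite andbT => /andP[ni _]; exact: PE (leq_trans kn ni).
rewrite sumEFin lee_fin; have [mn|nm] := leqP m n.
  by rewrite big_geq// ltW.
rewrite (@telescope_sumr_eq _ n m (fun i => - g i)) 1?ltnW//; last first.
  by move=> k _; rewrite opprK addrC.
by rewrite opprK addrC lerBlDr ler_wpDr.
Qed.

End borel_cantelli.

(** * Upper half of the law of the iterated logarithm *)

Section asymptotics.
Context (R : realType).

Lemma ln_natr_ge (C : R) : exists n, forall k, (n <= k)%N -> C <= ln k%:R.
Proof.
exists (Num.truncn (expR C)).+1 => k nk.
have kC : expR C <= k%:R.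
  by rewrite ltW// (lt_le_trans (truncnS_gt _))// ler_nat.
by rewrite -(expRK C) ler_ln// posrE ?expR_gt0// (lt_le_trans (expR_gt0 C)).
Qed.

(** The comparison of k^-(1 + b) with the integral of x^-(1 + b), in the
    telescoping form that [borel_cantelli] takes. *)
Lemma power_telescope (b : R) k : 0 < b -> (0 < k)%N ->
  expR (- ((1 + b) * ln k.+1%:R)) <=
  b^-1 * expR (- (b * ln k%:R)) - b^-1 * expR (- (b * ln k.+1%:R)).
Proof.
move=> b0 k0; rewrite -mulrBr -ler_pdivrMl ?invr_gt0// invrK.
have kk : 0 < k%:R :> R by rewrite ltr0n.
have k1 : 0 < k.+1%:R :> R by rewrite ltr0n.
have h : k.+1%:R^-1 <= ln k.+1%:R - ln k%:R :> R.
  have := @le_ln1Dx R (- k.+1%:R^-1); rewrite ltrN2 invf_lt1// ltr1n ltnS k0.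
  move=> /(_ isT); have -> : 1 - k.+1%:R^-1 = k%:R / k.+1%:R :> R.
    by rewrite -natr1; field; rewrite natr1 gt_eqF.
  by rewrite ln_div ?posrE// => hh; rewrite -lerN2 opprB.
have -> : - (b * ln k%:R) = - (b * ln k.+1%:R) + b * (ln k.+1%:R - ln k%:R) :> R.
  ring.
rewrite mulrDl mul1r opprD addrC !expRD [expR (- ln _)]expRN lnK ?posrE//.
rewrite mulrCA -[X in _ <= _ - X]mulr1 -mulrBr ler_wpM2l ?expR_ge0//.
rewrite lerBrDl (le_trans _ (expR_ge1Dx _))// lerD2l ler_wpM2l// ltW//.
Qed.

End asymptotics.

Section lil.
Context (d : measure_display) (T : measurableType d) (R : realType)
  (P : probability T R).
Variables (xi : nat -> T -> R) (v : nat -> R).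
Hypothesis noise : gaussian_noise P xi v.
Hypothesis v0 : forall i, 0 <= v i.

(** Cut the indices into blocks on which s grows by a factor exp q, where q is
    chosen so that C exp (4 q) = r^2.  The maximal inequality bounds the
    probability that the level of block k is exceeded by a constant times
    k^-(exp (2 q)), which is summable. *)
Lemma noise_lil_upper (f s : nat -> R) (C C' r : R) :
  0 < C -> 0 <= C' -> 0 < r -> C < r ^+ 2 ->
  (forall n, 1 <= s n) -> (forall m n, (m <= n)%N -> s m <= s n) ->
  (forall y, exists n, y <= s n) ->
  (forall n, wvar v f n <= C * s n + C') ->
  {ae P, forall w, exists n0, forall n, (n0 <= n)%N ->
    wsum xi f n w <= r * Num.sqrt (2 * s n * ln (ln (s n)))}.
Proof.
move=> C0 C'0 r0 Cr s1 snd sinf Vs.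
pose q := ln (r ^+ 2 / C) / 4.
have x1 : 1 < r ^+ 2 / C by rewrite ltr_pdivlMr// mul1r.
have x0 : 0 < r ^+ 2 / C by exact: lt_trans x1.
have q0 : 0 < q by rewrite divr_gt0// ln_gt0.
have xE : expR (4 * q) = r ^+ 2 / C.
  by rewrite /q mulrC divfK ?lnK ?posrE//.
(* th is what remains of r^2 / C = exp (4 q) after division by exp (2 q), the
   ratio between the variance bound V of a block and C times the scale of its
   level; it is the exponent of the tail bound. *)
pose th := expR (2 * q).
have th1 : 1 < th by rewrite expR_gt1 mulr_gt0.
pose lev k := r * Num.sqrt (2 * expR (q * k%:R) * ln (q * k%:R)).
(* N is the last index before the end of the k-th block, or 0 if there is no
   index before that end. *)
have lastex k : exists N, (forall n, s n < expR (q * k.+1%:R) -> (n <= N)%N) /\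
    wvar v f N <= C * expR (q * k.+1%:R) + C'.
  have [N0 sN0] := sinf (expR (q * k.+1%:R)).
  have bd n : s n < expR (q * k.+1%:R) -> (n <= N0)%N.
    move=> sn; rewrite leqNgt; apply/negP => /ltnW /snd.
    by rewrite leNgt (lt_le_trans sn).
  have [ex|nex] := pselect (exists n, s n < expR (q * k.+1%:R)).
    have [N PN maxN] := ex_maxnP ex bd; exists N; split => //.
    by rewrite (le_trans (Vs N))// lerD2r ler_wpM2l// ltW.
  exists 0%N; split => [n sn|]; first by exfalso; apply: nex; exists n.
  by rewrite /wvar big_ord0 addr_ge0// mulr_ge0 ?expR_ge0// ltW.
have [N hN] := choice lastex.
pose E k := [set w | exists2 j, (j <= N k.+1)%N & lev k.+1 <= wsum xi f j w].
have mS n : measurable_fun setT (wsum xi f n) by exact: (measurable_wsum noise).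
have mE k : measurable (E k).
  have -> : E k = \bigcup_(j in `I_(N k.+1).+1) [set w | lev k.+1 <= wsum xi f j w].
    by apply/seteqP; split => w [j jN h]; exists j.
  apply: bigcup_measurable => j _.
  have -> : [set w | lev k.+1 <= wsum xi f j w] =
      wsum xi f j @^-1` `[lev k.+1, +oo[.
    by apply/seteqP; split => w /=; rewrite in_itv/= andbT.
  by rewrite -[X in measurable X]setTI; exact: mS.
pose b := th - 1.
have b0 : 0 < b by rewrite subr_gt0.
pose D := expR (- (th * ln q)).
pose g k := D * b^-1 * expR (- (b * ln k%:R)).
have [k1 hk1] := ln_natr_ge (Num.max 1 (1 - ln q)).
have eq1 : 0 < expR q - 1 by rewrite subr_gt0 expR_gt1.
pose k2 := (Num.truncn (C' / (C * (expR q - 1)) / q)).+1.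
have [k0 [k01 k02 k03]] : exists k0, [/\ (k1 <= k0)%N, (k2 <= k0)%N & (1 <= k0)%N].
  exists (maxn (maxn k1 k2) 1); rewrite !leq_max !leqnn !orbT; split => //.
have PE k : (k0 <= k)%N -> (P (E k) <= (g k - g k.+1)%:E)%E.
  move=> kk; have k11 : (k1 <= k.+1)%N by rewrite (leq_trans k01)// leqW.
  have K0 : 0 < k.+1%:R :> R by rewrite ltr0n.
  have lnlev : 1 <= ln (q * k.+1%:R).
    rewrite lnM ?posrE//; have := hk1 _ k11; rewrite ge_max => /andP[_].
    lra.
  have lev0 : 0 < lev k.+1.
    rewrite mulr_gt0// sqrtr_gt0 mulr_gt0 ?mulr_gt0 ?expR_gt0//.
    exact: lt_le_trans lnlev.
  pose V := C * expR (q * k.+1%:R + 2 * q).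
  have V0 : 0 < V by rewrite mulr_gt0// expR_gt0.
  have VN : wvar v f (N k.+1) <= V.
    apply: le_trans (proj2 (hN k.+1)) _.
    have -> : V = C * expR (q * k.+2%:R) * expR q.
      by rewrite /V -mulrA -expRD -[k.+2%:R]natr1; congr (_ * expR _); ring.
    rewrite -lerBrDl -[X in _ - X]mulr1 -mulrBr.
    have kY : C' / (C * (expR q - 1)) / q <= k.+2%:R.
      rewrite ltW// (lt_le_trans (truncnS_gt _))// ler_nat.
      by rewrite (leq_trans k02)// (leq_trans kk)// -addn2 leq_addr.
    rewrite mulrAC -ler_pdivrMl ?mulr_gt0// mulrC.
    move: kY; rewrite ler_pdivrMr// => kY; apply: (le_trans kY).
    by rewrite mulrC (le_trans _ (expR_ge1Dx _))// lerDr.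
  have l0 : 0 <= lev k.+1 / V by rewrite divr_ge0// ltW.
  apply: (le_trans (maximal_inequality noise v0 f (N k.+1) lev0 l0)).
  rewrite lee_fin.
  have -> : g k - g k.+1 = D * (b^-1 * expR (- (b * ln k%:R)) -
      b^-1 * expR (- (b * ln k.+1%:R))) by rewrite /g; ring.
  apply: (@le_trans _ _ (D * expR (- ((1 + b) * ln k.+1%:R)))); last first.
    rewrite ler_wpM2l ?expR_ge0//; apply: power_telescope => //.
    exact: leq_trans kk.
  rewrite /D -expRD ler_expR.
  have -> : - (th * ln q) - (1 + b) * ln k.+1%:R = - (th * ln (q * k.+1%:R)).
    by rewrite /b lnM ?posrE//; ring.
  apply: (@le_trans _ _ (- (lev k.+1 ^+ 2 / V / 2))).
    have : (lev k.+1 / V) ^+ 2 * wvar v f (N k.+1) / 2 <=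
        (lev k.+1 / V) ^+ 2 * V / 2.
      by rewrite ler_pM2r ?invr_gt0// ler_wpM2l ?sqr_ge0.
    have -> : (lev k.+1 / V) ^+ 2 * V / 2 = lev k.+1 ^+ 2 / V / 2.
      by field; rewrite gt_eqF.
    have -> : lev k.+1 / V * lev k.+1 = lev k.+1 ^+ 2 / V.
      by rewrite mulrAC expr2.
    lra.
  rewrite lerN2 /lev exprMn sqr_sqrtr; last first.
    by rewrite mulr_ge0 ?mulr_ge0 ?expR_ge0//; apply: le_trans lnlev.
  have rE : r ^+ 2 = C * th ^+ 2.
    rewrite [th ^+ 2]expr2 /th -expRD (_ : 2 * q + 2 * q = 4 * q); last by ring.
    by rewrite xE; field; rewrite gt_eqF.
  have -> : V = C * expR (q * k.+1%:R) * th by rewrite /V expRD mulrA.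
  rewrite rE le_eqVlt; apply/orP; left; apply/eqP.
  by field; rewrite !gt_eqF ?expR_gt0.
have gE k : 0 <= g k by rewrite !mulr_ge0 ?expR_ge0// invr_ge0 ltW.
have gsmall e : 0 < e -> exists k, (k0 <= k)%N /\ g k <= e.
  move=> e0; have Db : 0 < D / b by rewrite divr_gt0// expR_gt0.
  have [k3 hk3] := ln_natr_ge (- ln (e / (D / b)) / b).
  exists (maxn k0 k3); rewrite leq_maxl; split => //.
  rewrite /g -ler_pdivlMl// [X in _ <= X]mulrC.
  have z0 : 0 < e / (D / b) by rewrite divr_gt0.
  rewrite -[leRHS]lnK ?posrE// ler_expR lerNl -ler_pdivrMl// [b^-1 * _]mulrC.
  by apply: hk3; rewrite leq_maxr.
apply: filterS (borel_cantelli mE PE gE gsmall) => w [n1 hn1].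
have [n0 hn0] := sinf (expR (q * (maxn n1 k0).+1%:R)).
exists n0 => n nn0.
have sn0 := le_trans hn0 (snd _ _ nn0).
have sn_gt0 : 0 < s n by exact: lt_le_trans (s1 n).
pose y := ln (s n) / q.
have ym : (maxn n1 k0).+1%:R <= y.
  by rewrite ler_pdivlMr// mulrC -ler_expR lnK ?posrE.
have y0 : 0 <= y by rewrite (le_trans _ ym).
pose k := (Num.truncn y).-1.
have kS : Num.truncn y = k.+1.
  by rewrite prednK// (leq_trans _ (_ : ((maxn n1 k0).+1 <= _)%N))// truncn_ge_nat.
have /andP[ky yk] := truncn_itv y0; rewrite kS in ky yk.
have mk : (maxn n1 k0 <= k)%N by rewrite -ltnS -kS truncn_ge_nat.
have [nk kk] : (n1 <= k)%N /\ (k0 <= k)%N.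
  by apply/andP; rewrite -geq_max.
have lnE : ln (s n) = q * y by rewrite /y mulrC divfK// gt_eqF.
have nN : (n <= N k.+1)%N.
  apply: (proj1 (hN k.+1)); rewrite -[ltLHS]lnK ?posrE// ltr_expR lnE.
  by rewrite ltr_pM2l.
have lt : wsum xi f n w < lev k.+1.
  by rewrite ltNge; apply/negP => h; apply: (hn1 k nk); exists n.
apply: (le_trans (ltW lt)); rewrite /lev ler_wpM2l ?(ltW r0)// ler_wsqrtr//.
have k11 : (k1 <= k.+1)%N by rewrite (leq_trans k01)// leqW.
have K0 : 0 < k.+1%:R :> R by rewrite ltr0n.
have lnlev : 1 <= ln (q * k.+1%:R).
  rewrite lnM ?posrE//; have := hk1 _ k11; rewrite ge_max => /andP[_].
  lra.
have qk : q * k.+1%:R <= ln (s n) by rewrite lnE ler_pM2l.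
rewrite -[leLHS]mulrA -[leRHS]mulrA ler_pM2l// ler_pM ?expR_ge0//.
  exact: (le_trans ler01 lnlev).
  by rewrite -[leRHS]lnK ?posrE// ler_expR.
have qk0 : 0 < q * k.+1%:R by rewrite mulr_gt0.
by rewrite ler_ln ?posrE//; exact: lt_le_trans qk.
Qed.

End lil.

(** * Lower half of the law of the iterated logarithm *)

Section lil_lower.
Context (d : measure_display) (T : measurableType d) (R : realType)
  (P : probability T R).
Variables (xi : nat -> T -> R) (v : nat -> R).
Hypothesis noise : gaussian_noise P xi v.

Local Notation prefixType k := (g_sigma_algebraType (prefix_boxes xi k)).

Lemma prefix_measurable_le k n (A : set T) : (k <= n)%N ->
  measurable (A : set (prefixType k)) -> measurable (A : set (prefixType n)).
Proof.
move=> kn; apply: sub_smallest2r; first exact: smallest_sigma_algebra.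
move=> _ [D mD ->]; exists (fun i => if (i < k)%N then D i else setT).
  by move=> i; case: ifP.
apply/seteqP; split => w h i /= ik.
  by case: ifP => // ik'; exact: h.
by have := h i (leq_trans ik kn); rewrite /= ik.
Qed.

(** The increment over a block of noise variables is Gaussian and independent of
    the past at the start of the block. *)
Lemma block_mgf f l k n (A : set T) : (k <= n)%N ->
  measurable (A : set (prefixType k)) ->
  (\int[P]_w (\1_A w * expR (l * (wsum xi f n w - wsum xi f k w)))%:E =
   P A * (expR (l ^+ 2 * (wvar v f n - wvar v f k) / 2))%:E)%E.
Proof.
move=> /subnKC <- mA; elim: (n - k)%N => [|p IH].
  rewrite addn0 subrr mulr0 mul0r expR0 mule1.
  transitivity (\int[P]_w (\1_A w)%:E)%E.
    by apply: eq_integral => w _; rewrite subrr mulr0 expR0 mulr1.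
  by rewrite integral_indic ?setIT//; exact: (prefix_measurable noise mA).
set m := (k + p)%N in IH *; rewrite addnS -/m.
have km : (k <= m)%N by rewrite leq_addr.
have mg : measurable_fun setT ((fun w => \1_A w *
    expR (l * (wsum xi f m w - wsum xi f k w))) : prefixType m -> R).
  apply: measurable_funM.
    by apply: measurable_indic; exact: prefix_measurable_le mA.
  apply: measurableT_comp => //; apply: measurable_funM => //.
  by apply: measurable_funB; exact: prefix_measurable_wsum.
have g0 w : 0 <= \1_A w * expR (l * (wsum xi f m w - wsum xi f k w)).
  by rewrite mulr_ge0// expR_ge0.
transitivity (\int[P]_w (\1_A w * expR (l * (wsum xi f m w - wsum xi f k w)) *
    expR (l * f m * xi m w))%:E)%E.
  apply: eq_integral => w _; congr EFin; rewrite -mulrA -expRD wsum_recr.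
  by congr (_ * expR _); ring.
rewrite (prefix_mgf noise _ mg g0) IH -muleA -EFinM -expRD wvar_recr.
by congr (_ * (expR _)%:E)%E; ring.
Qed.

(** Given the past, the increment over block k exceeds its level with probability
    at least 1 / (k + 1): the level r sqrt (2 V_k ln k) costs k^-(r^2) up to
    small factors in the exponent, and r < 1.  The probability that all the
    blocks k0, ..., n - 1 fail is then at most the telescoping product k0 / n. *)
Lemma noise_lil_lower (f : nat -> R) (t : nat -> nat) (r : R) :
  (forall k, (t k <= t k.+1)%N) -> 0 < r < 1 ->
  (forall k, 0 < wvar v f (t k.+1) - wvar v f (t k)) ->
  {ae P, forall w, forall k0, exists2 k, (k0 <= k)%N &
    r * Num.sqrt (2 * (wvar v f (t k.+1) - wvar v f (t k)) * ln k%:R) <=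
    wsum xi f (t k.+1) w - wsum xi f (t k) w}.
Proof.
move=> tS /andP[r0 r1] V0.
have tnd k n : (k <= n)%N -> (t k <= t n)%N.
  move/subnKC <-; elim: (n - k)%N => [|p IH]; first by rewrite addn0.
  by rewrite addnS (leq_trans IH).
pose V k := wvar v f (t k.+1) - wvar v f (t k).
pose lev k := r * Num.sqrt (2 * V k * ln k%:R).
pose E k := [set w | lev k <= wsum xi f (t k.+1) w - wsum xi f (t k) w].
pose s := r ^+ 2; have s0 : 0 < s by rewrite exprn_gt0.
have s1 : s < 1 by rewrite exprn_ilt1// ltW.
(* e is so small that the exponent c of [gaussian_tail_ge] stays below 1. *)
pose e := (1 - s) / 8; have e0 : 0 < e by rewrite divr_gt0// subr_gt0.
pose c := s * ((1 + e) * (1 + 3 * e)).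
have c1 : c < 1.
  have e1 : e <= 1 by rewrite /e; lra.
  have : e * e <= e by rewrite ler_piMl// ltW.
  rewrite /c.
  have -> : (1 + e) * (1 + 3 * e) = 1 + 4 * e + 3 * (e * e) by ring.
  move=> ee; have : s * (1 + 4 * e + 3 * (e * e)) <= s * (1 + 7 * e).
    by rewrite ler_pM2l//; lra.
  have : s * e <= e by rewrite ler_piMl// ltW// ltW.
  rewrite /e; lra.
have [k1 hk1] := ln_natr_ge (Num.max 1 (Num.max (3 / (e ^+ 2 * s)) ((1 - c)^-1))).
have PE k (A : set T) : (k1 <= k)%N -> (1 <= k)%N ->
    measurable (A : set (prefixType (t k))) ->
    (P A * (k.+1%:R^-1)%:E <= P (A `&` E k))%E.
  move=> kk k_gt0 mA; have := hk1 _ kk; rewrite !ge_max => /and3P[L1 L2 L3].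
  have L0 : 0 < ln k%:R :> R by exact: lt_le_trans L1.
  have lev0 : 0 < lev k by rewrite mulr_gt0// sqrtr_gt0 !mulr_gt0// V0.
  have q0 : lev k ^+ 2 / V k = 2 * s * ln k%:R.
    rewrite /lev exprMn sqr_sqrtr; last by rewrite !mulr_ge0// ltW// V0.
    by rewrite /s; field; rewrite gt_eqF// V0.
  have mA' := prefix_measurable noise mA.
  have mW : measurable_fun setT
      (fun w => wsum xi f (t k.+1) w - wsum xi f (t k) w).
    by apply: measurable_funB; exact: (measurable_wsum noise).
  have small : expR (- (e ^+ 2 * (lev k ^+ 2 / V k) / 2)) <= 1 / 4.
    rewrite q0 expRN div1r lef_pV2 ?posrE ?expR_gt0//.
    apply: le_trans (expR_ge1Dx _).
    move: L2; rewrite ler_pdivrMr ?mulr_gt0 ?exprn_gt0//; lra.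
  apply: le_trans (gaussian_tail_ge mA' mW (V0 k) lev0 e0
    (fun l => block_mgf f l (tS k) mA) small).
  rewrite lee_wpmul2l ?measure_ge0// lee_fin q0.
  have -> : - ((1 + e) * (1 + 3 * e) * (2 * s * ln k%:R) / 2) =
      (1 - c) * ln k%:R - ln k%:R by rewrite /c; field.
  have kp : 0 < k%:R :> R by rewrite ltr0n.
  rewrite expRD expRN lnK ?posrE//.
  apply: (@le_trans _ _ k%:R^-1).
    by rewrite lef_pV2 ?posrE ?ltr0n// ler_nat.
  rewrite mulrA ler_peMl ?invr_ge0 ?(ltW kp)//.
  rewrite ler_pdivlMl// mulr1.
  apply: le_trans (expR_ge1Dx _).
  by move: L3; rewrite -[_^-1]div1r ler_pdivrMr ?subr_gt0// mulrC; lra.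
pose k0 m := maxn (maxn k1 1) m.
pose Q m n := \bigcap_(j in [set j | (k0 m <= j < n)%N]) ~` E j.
have mE k : measurable (E k : set (prefixType (t k.+1))).
  have -> : E k = (fun w => wsum xi f (t k.+1) w - wsum xi f (t k) w)
      @^-1` `[lev k, +oo[.
    by apply/seteqP; split => w /=; rewrite in_itv/= andbT.
  have mW : measurable_fun setT ((fun w => wsum xi f (t k.+1) w -
      wsum xi f (t k) w) : prefixType (t k.+1) -> R).
    by apply: measurable_funB; exact: prefix_measurable_wsum.
  by rewrite -[X in measurable X]setTI; exact: mW.
have mQ m n : measurable (Q m n : set (prefixType (t n))).
  apply: bigcap_measurableType => j /= /andP[_ jn].
  apply: measurableC; apply: prefix_measurable_le (mE j); exact: tnd.
have mQT m n : measurable (Q m n) := prefix_measurable noise (mQ m n).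
have mET k : measurable (E k) := prefix_measurable noise (mE k).
have PQ m n : (k0 m <= n)%N -> (P (Q m n) <= ((k0 m)%:R / n%:R)%:E)%E.
  move/subnKC <-; elim: (n - k0 m)%N => [|p IH].
    rewrite addn0 divff; first exact: probability_le1.
    by rewrite pnatr_eq0 -lt0n /k0 !leq_max orbT.
  set j := (k0 m + p)%N in IH *; rewrite addnS -/j.
  have mj : (k0 m <= j)%N by rewrite leq_addr.
  have [j1 j_gt0] : (k1 <= j)%N /\ (1 <= j)%N.
    by apply/andP; move: mj; rewrite /k0 !geq_max => /andP[].
  have fQ := fin_num_measure P _ (mQT m j).
  have QS : Q m j.+1 = Q m j `\` E j.
    apply/seteqP; split => w.
      move=> h; split; last by apply: h => /=; rewrite mj ltnSn.
      by move=> i /= /andP[mi ij]; apply: h => /=; rewrite mi ltnW.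
    move=> [h nE] i /= /andP[mi]; rewrite ltnS leq_eqVlt => /predU1P[->//|ij].
    by apply: h => /=; rewrite mi.
  have PD : P (Q m j `\` E j) = (P (Q m j) - P (Q m j `&` E j))%E.
    by rewrite measureD// ltey_eq fQ.
  rewrite QS PD.
  have h := PE j (Q m j) j1 j_gt0 (mQ m j).
  have fQE : P (Q m j `&` E j) \is a fin_num.
    by apply: fin_num_measure; exact: measurableI.
  move: h IH; rewrite -(fineK fQ) -(fineK fQE) -EFinM -EFinB !lee_fin.
  move: (fine _) (fine _) => y x.
  have J0 : 0 < j%:R :> R by rewrite ltr0n.
  have J1 : 0 < j.+1%:R :> R by rewrite ltr0n.
  have Jn : j%:R / j.+1%:R = 1 - j.+1%:R^-1 :> R.
    by rewrite -natr1; field; rewrite natr1 gt_eqF.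
  move=> xy xj; apply: (@le_trans _ _ (x * (j%:R / j.+1%:R))).
    by rewrite Jn mulrBr mulr1 lerD2l lerN2.
  apply: (@le_trans _ _ ((k0 m)%:R / j%:R * (j%:R / j.+1%:R))).
    by rewrite ler_wpM2r// divr_ge0// ltW.
  by rewrite mulrA divfK// gt_eqF.
pose Q' m := \bigcap_(j in [set j | (k0 m <= j)%N]) ~` E j.
have mQ' m : measurable (Q' m).
  by apply: bigcap_measurableType => j _; exact: measurableC.
have PQ' m : P (Q' m) = 0%E.
  apply/eqP; rewrite eq_le measure_ge0 andbT; apply/lee_addgt0Pr => x x0.
  rewrite add0e; pose n := maxn (k0 m) (Num.truncn ((k0 m)%:R / x)).+1.
  have n0 : 0 < n%:R :> R by rewrite ltr0n /n leq_max orbT.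
  apply: (@le_trans _ _ (P (Q m n))).
    apply: le_measure; rewrite ?inE// => w h j /= /andP[mj _]; exact: h.
  apply: le_trans (PQ m n _) _; first by rewrite leq_maxl.
  rewrite lee_fin ler_pdivrMr// mulrC -ler_pdivrMr//.
  by rewrite ltW// (lt_le_trans (truncnS_gt _))// ler_nat leq_maxr.
exists (\bigcup_m Q' m); split.
- exact: bigcup_measurable.
- apply/negligibleP; first exact: bigcup_measurable.
  apply: negligible_bigcup => m; exists (Q' m).
  by split; [exact: mQ'|exact: PQ'|].
- move=> w /= nw; apply: contrapT => h; apply: nw => m.
  apply: contrapT => nk; apply: h; exists m => // j /= mj Ej.
  by apply: nk; exists j => //; apply: leq_trans mj; rewrite leq_maxr.
Qed.

End lil_lower.

(** * Brownian increments as Gaussian noise *)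

Section density.
Context (d : measure_display) (T : measurableType d) (R : realType).
Variables (mu nu : {measure set T -> \bar R}) (g : T -> R).
Hypotheses (mg : measurable_fun setT g) (g0 : forall x, 0 <= g x).
Hypothesis nuE : forall A, measurable A -> (nu A = \int[mu]_(x in A) (g x)%:E)%E.

Import HBNNSimple.

Let integral_density_nnsfun (h : {nnsfun T >-> R}) :
  (\int[nu]_x (h x)%:E = \int[mu]_x ((h x)%:E * (g x)%:E))%E.
Proof.
have mgE : measurable_fun setT (EFin \o g) by exact/measurable_EFinP.
rewrite integralT_nnsfun sintegralE.
under [RHS]eq_integral.
  move=> x _; rewrite fimfunE -fsumEFin// ge0_mule_fsuml; last first.
    by move=> r; rewrite EFinM nnfun_muleindic_ge0.
  over.
rewrite [RHS]ge0_integral_fsum//; last 2 first.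
- move=> r; apply: emeasurable_funM => //.
  by apply/measurable_EFinP; exact: measurable_funM.
- by move=> r x _; rewrite EFinM mule_ge0// ?nnfun_muleindic_ge0// lee_fin.
apply: eq_fsbigr => r; rewrite inE => -[x _ <-].
rewrite nuE; last exact: measurable_sfunP.
under [RHS]eq_integral do rewrite EFinM -muleA.
rewrite ge0_integralZl//; last 3 first.
- apply: emeasurable_funM => //.
  exact/measurable_EFinP/measurable_indic.
- by move=> z _; rewrite mule_ge0// lee_fin.
- by rewrite lee_fin.
congr (_ * _)%E; rewrite integral_mkcond; apply: eq_integral => z _.
by rewrite patchE indicE; case: ifPn => _; rewrite ?mul1e ?mul0e.
Qed.

(** Integration against a measure with density: the case of simple functions
    passes to the limit by monotone convergence. *)
Lemma ge0_integral_density (f : T -> \bar R) :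
  measurable_fun setT f -> (forall x, 0 <= f x)%E ->
  (\int[nu]_x f x = \int[mu]_x (f x * (g x)%:E))%E.
Proof.
move=> mf f0.
have mgE : measurable_fun setT (EFin \o g) by exact/measurable_EFinP.
pose f_ := nnsfun_approx measurableT mf.
transitivity (lim (\int[nu]_x (f_ n x)%:E @[n --> \oo])%E).
  rewrite -monotone_convergence//=.
  - apply: eq_integral => ? /[!inE] xD; apply/esym/cvg_lim => //=.
    exact: cvg_nnsfun_approx.
  - by move=> n; exact/measurable_EFinP/measurable_funTS.
  - by move=> n ? _; rewrite lee_fin.
  - by move=> ? _ ? ? mn; rewrite lee_fin; exact/lefP/nd_nnsfun_approx.
under eq_fun do rewrite integral_density_nnsfun.
rewrite -monotone_convergence//=.
- apply: eq_integral => x /[!inE] xD; apply/cvg_lim => //=.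
  apply: cvgeZr => //; exact: cvg_nnsfun_approx.
- move=> n; apply: emeasurable_funM => //.
  exact/measurable_EFinP/measurable_funTS.
- by move=> n ? _; rewrite mule_ge0// lee_fin.
- move=> ? _ ? ? mn; rewrite lee_wpmul2r ?lee_fin//.
  exact/lefP/nd_nnsfun_approx.
Qed.

End density.

Lemma normal_mgf (R : realType) (s l : R) : 0 < s ->
  (\int[normal_prob 0 s]_x (expR (l * x))%:E = (expR (l ^+ 2 * s ^+ 2 / 2))%:E)%E.
Proof.
move=> s0; have s1 : s != 0 by rewrite gt_eqF.
rewrite (@ge0_integral_density _ _ _ lebesgue_measure _ (normal_pdf 0 s))//.
- transitivity (\int[lebesgue_measure]_x
     ((expR (l ^+ 2 * s ^+ 2 / 2))%:E * (normal_pdf (l * s ^+ 2) s x)%:E))%E.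
    apply: eq_integral => x _; rewrite -!EFinM; congr EFin.
    rewrite !normal_pdfE// mulrCA [RHS]mulrCA; congr (_ * _).
    rewrite /normal_fun -!expRD; congr expR.
    by field.
  rewrite ge0_integralZl//; first by rewrite integral_normal_pdf mule1.
  + by apply/measurable_EFinP; exact: measurable_normal_pdf.
  + by move=> x _; rewrite lee_fin normal_pdf_ge0.
- exact: measurable_normal_pdf.
- by move=> x; exact: normal_pdf_ge0.
- by apply/measurable_EFinP; apply: measurableT_comp => //; exact: measurable_funM.
Qed.

Section brownian.
Context (d : measure_display) (T : measurableType d) (R : realType)
  (P : probability T R) (B : R -> T -> R).
Hypothesis hB : brownian_motion P B.

(** Coinciding times are admitted; the corresponding variables vanish almost
    surely and have variance 0. *)
Lemma brownian_noise (t : nat -> R) :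
  0 <= t 0%N -> (forall i, t i <= t i.+1) ->
  gaussian_noise P (fun i w => B (t i.+1) w - B (t i) w)
    (fun i => t i.+1 - t i).
Proof.
move=> t0 tS.
have tp i : 0 <= t i by elim: i => // i IH; rewrite (le_trans IH).
have mB i : measurable_fun setT (fun w => B (t i.+1) w - B (t i) w).
  by apply: measurable_funB; exact: (brownian_measurable hB).
split => // [n|i l].
  exact: (brownian_independent_increments hB).
have [tt|tt] := eqVneq (t i) (t i.+1).
  rewrite tt; under eq_integral do rewrite subrr mulr0 expR0.
  by rewrite subrr mulr0 mul0r expR0 integral_cst// mul1e; exact: probability_setT.
have ltt : t i < t i.+1 by rewrite lt_neqAle tt tS.
have s0 : 0 < Num.sqrt (t i.+1 - t i) by rewrite sqrtr_gt0 subr_gt0.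
have mU : measurable_fun setT
    ((fun w => B (t i.+1) w - B (t i) w) : T -> measurableTypeR R).
  by move=> mT A mA; exact: mB.
pose U : {mfun T >-> measurableTypeR R} :=
  HB.pack (fun w => B (t i.+1) w - B (t i) w)
  (isMeasurableFun.Build _ _ _ _ _ mU).
transitivity (\int[distribution P U]_x (expR (l * x))%:E)%E.
  rewrite ge0_integral_distribution//.
  by apply/measurable_EFinP; apply: measurableT_comp => //; exact: measurable_funM.
transitivity (\int[normal_prob 0 (Num.sqrt (t i.+1 - t i))]_x
    (expR (l * x))%:E)%E; last first.
  by rewrite normal_mgf// sqr_sqrtr// subr_ge0 ltW.
apply: eq_measure_integral => A mA _.
exact: (brownian_normal_increments hB).
Qed.

End brownian.

(** * Oscillation of Brownian paths on the square-root grid *)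

Lemma within_continuous_dist (R : realType) (f : R -> R) (a s e : R) :
  {within `[a, +oo[, continuous f} -> a <= s -> 0 < e ->
  exists2 r, 0 < r & forall u, a <= u -> `|u - s| < r -> `|f u - f s| < e.
Proof.
move=> /subspace_continuousP cf as_ e0.
have /cvgrPdist_lt /(_ e e0) : f x @[x --> within `[a, +oo[ (nbhs s)] --> f s.
  by apply: cf; rewrite /= in_itv/= as_.
rewrite near_withinE near_nbhs => /nbhs_ballP[r /= r0 h].
exists r => // u au us; rewrite distrC; apply: h; last by rewrite /= in_itv/= au.
by rewrite /ball /= distrC.
Qed.

Section oscillation.
Context (d : measure_display) (T : measurableType d) (R : realType)
  (P : probability T R) (B : R -> T -> R).
Hypothesis hB : brownian_motion P B.

(** The maximal inequality holds along each dyadic subdivision of [a, b] with a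
    bound that does not depend on its level; the exceptional sets increase, and
    by continuity a path that leaves the strip between two dyadic times also
    leaves it at some dyadic time. *)
Lemma brownian_oscillation (a b K : R) : 0 <= a -> a < b -> 0 < K ->
  exists O : set T, [/\ measurable O,
    (P O <= (2 * expR (- (K ^+ 2 / (2 * (b - a)))))%:E)%E &
    forall w, ~ O w -> {within `[0, +oo[, continuous (fun t => B t w)} ->
      forall s, a <= s <= b -> `|B s w - B a w| <= K].
Proof.
move=> a0 ab K0; pose D := b - a; have D0 : 0 < D by rewrite subr_gt0.
pose t m i := a + (minn i (2 ^ m))%:R / (2 ^ m)%:R * D.
have pow m : 0 < (2 ^ m)%:R :> R by rewrite ltr0n expn_gt0.
have t0 m : t m 0%N = a by rewrite /t min0n mul0r mul0r addr0.
have tS m i : t m i <= t m i.+1.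
  rewrite lerD2l ler_wpM2r ?(ltW D0)// ler_wpM2r ?invr_ge0 ?(ltW (pow m))//.
  by rewrite ler_nat leq_min !geq_min leqnSn leqnn !orbT.
have noise m : gaussian_noise P (fun i w => B (t m i.+1) w - B (t m i) w)
    (fun i => t m i.+1 - t m i).
  by apply: (brownian_noise hB) => //; rewrite t0.
have sumE m f n w : wsum (fun i w => B (t m i.+1) w - B (t m i) w)
    (fun=> f) n w = f * (B (t m n) w - B a w).
  rewrite /wsum -mulr_sumr -(big_mkord xpredT (fun i => B (t m i.+1) w - B (t m i) w)).
  by rewrite telescope_sumr// t0.
have tN m : t m (2 ^ m)%N = b.
  by rewrite /t minnn divff ?gt_eqF// mul1r /D addrC subrK.
have varE m f : wvar (fun i => t m i.+1 - t m i) (fun=> f) (2 ^ m) = f ^+ 2 * D.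
  rewrite /wvar -mulr_sumr -(big_mkord xpredT (fun i => t m i.+1 - t m i)).
  by rewrite telescope_sumr// t0 tN.
pose S m f := [set w | exists2 k, (k <= 2 ^ m)%N & K <= f * (B (t m k) w - B a w)].
have PS m f : f ^+ 2 = 1 -> (P (S m f) <= (expR (- (K ^+ 2 / (2 * D))))%:E)%E.
  move=> f1; have l0 : 0 <= K / D by rewrite divr_ge0 ?ltW.
  have v0 i : 0 <= t m i.+1 - t m i by rewrite subr_ge0.
  have := maximal_inequality (noise m) v0 (fun=> f) (2 ^ m) K0 l0.
  rewrite varE f1 mul1r.
  have -> : - (K / D * K) + (K / D) ^+ 2 * D / 2 = - (K ^+ 2 / (2 * D)).
    by field; rewrite gt_eqF.
  have -> // : S m f = [set w | exists2 k, (k <= 2 ^ m)%N &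
      K <= wsum (fun i w => B (t m i.+1) w - B (t m i) w) (fun=> f) k w].
  by apply/seteqP; split => w [k km h]; exists k => //; move: h; rewrite sumE.
have mB s : 0 <= s -> measurable_fun setT (B s) := brownian_measurable hB (t := s).
have tp m i : 0 <= t m i.
  by elim: i => [|i IH]; [rewrite t0|exact: le_trans (tS m i)].
have mS m f : measurable (S m f).
  have -> : S m f = \bigcup_(k in `I_(2 ^ m).+1)
      ((fun w => f * (B (t m k) w - B a w)) @^-1` `[K, +oo[).
    by apply/seteqP; split => w [k km h]; exists k => //; move: h;
      rewrite /= in_itv/= andbT.
  apply: bigcup_measurable => k _; rewrite -[X in measurable X]setTI.
  have mf : measurable_fun setT (fun w => f * (B (t m k) w - B a w)).
    by apply: measurable_funM => //; apply: measurable_funB; exact: mB.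
  exact: mf.
pose O m := S m 1 `|` S m (-1).
have mO m : measurable (O m) by exact: measurableU.
have PO m : (P (O m) <= (2 * expR (- (K ^+ 2 / (2 * D))))%:E)%E.
  apply: (le_trans (measureU2 _ (mS m 1) (mS m (-1)))).
  have -> : (2 * expR (- (K ^+ 2 / (2 * D))))%:E = ((expR (- (K ^+ 2 / (2 * D))))%:E
     + (expR (- (K ^+ 2 / (2 * D))))%:E)%E by rewrite -EFinD; congr EFin; ring.
  by apply: leeD; apply: PS; rewrite ?expr1n ?sqrrN ?expr1n.
have tdouble m k : t m.+1 (2 * k)%N = t m k.
  rewrite /t expnS -minnMr; congr (_ + _ * _); rewrite !natrM.
  by field; rewrite gt_eqF.
have Ond : nondecreasing_seq O.
  have step m : O m `<=` O m.+1.
    by move=> w [] [k km h]; [left|right]; exists (2 * k)%N;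
      rewrite ?tdouble// expnS leq_mul2l.
  by apply/nondecreasing_seqP => m; apply/subsetPset; exact: step.
exists (\bigcup_m O m); split; first exact: bigcup_measurable.
  have cv := nondecreasing_cvg_mu (mu := P) mO (bigcup_measurable (fun k _ => mO k)) Ond.
  rewrite -(cvg_lim _ cv)//; apply: lime_le; first by apply/cvg_ex; exists (P (\bigcup_m O m)).
  by apply: nearW => m; exact: PO.
move=> w nO cB s /andP[as_ sb]; rewrite leNgt; apply/negP => Ks.
have e0 : 0 < `|B s w - B a w| - K by rewrite subr_gt0.
have [r r0 hr] := within_continuous_dist cB (le_trans a0 as_) e0.
pose m := (Num.truncn (D / r)).+1.
pose k := Num.truncn ((s - a) / D * (2 ^ m)%:R).
have x0 : 0 <= (s - a) / D * (2 ^ m)%:R.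
  by rewrite mulr_ge0 ?(ltW (pow m))// divr_ge0 ?subr_ge0// ltW.
have /andP[kx xk] := truncn_itv x0; rewrite -/k in kx xk.
have km : (k <= 2 ^ m)%N.
  rewrite -(ler_nat R) (le_trans kx)// ler_piMl ?(ltW (pow m))//.
  by rewrite ler_pdivrMr// mul1r lerD2r.
have tk : t m k = a + k%:R / (2 ^ m)%:R * D by rewrite /t (minn_idPl km).
have mr : D / (2 ^ m)%:R < r.
  rewrite ltr_pdivrMr// mulrC -ltr_pdivrMr// (lt_trans (truncnS_gt _))//.
  by rewrite ltr_nat ltn_expl.
have ts : `|t m k - s| < r.
  have -> : t m k - s = - (((s - a) / D * (2 ^ m)%:R - k%:R) * (D / (2 ^ m)%:R)).
    by rewrite tk; field; rewrite !gt_eqF.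
  rewrite normrN normrM (le_lt_trans _ mr)// [X in _ * X]ger0_norm; last first.
    by rewrite divr_ge0// ltW.
  rewrite ler_piMl ?divr_ge0 ?(ltW D0) ?(ltW (pow m))//.
  by rewrite ger0_norm ?subr_ge0// lerBlDl (le_trans (ltW xk))// -natr1 addrC.
have hs := hr _ (tp m k) ts.
have hk : `|B (t m k) w - B a w| < K.
  rewrite ltNge; apply/negP; rewrite ler_normr => /orP[h|h]; apply: nO;
    exists m => //; [left|right]; exists k => //.
    by rewrite mul1r.
  by rewrite mulN1r.
have := ler_distD (B (t m k) w) (B s w) (B a w).
rewrite [`|B s w - B (t m k) w|]distrC; lra.
Qed.

(** The cells [sqrt n, sqrt (n + 1)] have length about 1 / (2 sqrt n), so an
    oscillation above 1 has probability at most 2 exp (- sqrt n), which is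
    summable. *)
Lemma brownian_grid_oscillation :
  {ae P, forall w, exists n0 : nat, forall n, (n0 <= n)%N ->
    forall s, Num.sqrt n%:R <= s <= Num.sqrt n.+1%:R ->
    `|B s w - B (Num.sqrt n%:R) w| <= 1}.
Proof.
pose t n : R := Num.sqrt n%:R.
have tlt n : t n < t n.+1 by rewrite ltr_sqrt ?ltr0n// ltr_nat.
have t0 n : 0 <= t n by exact: sqrtr_ge0.
have [Ex hEx] := choice (fun n => brownian_oscillation (t0 n) (tlt n) ltr01).
pose g n : R := 96 / n%:R.
have PO n : (1 <= n)%N -> (P (Ex n) <= (g n - g n.+1)%:E)%E.
  move=> n0; have [_ h _] := hEx n; apply: (le_trans h); rewrite lee_fin.
  have n1 : 0 < n%:R :> R by rewrite ltr0n.
  have n2 : 0 < n.+1%:R :> R by rewrite ltr0n.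
  have tn : 0 < t n by rewrite sqrtr_gt0.
  have tn2 : t n ^+ 2 = n%:R by rewrite sqr_sqrtr// ltW.
  have e1 : t n <= 1 ^+ 2 / (2 * (t n.+1 - t n)).
    have d0 : 0 < t n.+1 - t n by rewrite subr_gt0.
    rewrite expr1n ler_pdivlMr ?mulr_gt0//.
    have : t n.+1 ^+ 2 = n.+1%:R by rewrite sqr_sqrtr// ltW.
    rewrite -natr1 -tn2.
    have : 0 <= (t n.+1 - t n) ^+ 2 by rewrite sqr_ge0.
    move: (t n.+1) (t n) d0 tn => x y; nra.
  have e2 : n%:R ^+ 2 / 24 <= expR (t n).
    apply: le_trans (expR_ge1Dxn 3 (ltW tn)).
    rewrite -tn2 -exprM; have -> : (4`!)%:R = 24 :> R by [].
    by rewrite lerDr.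
  apply: (@le_trans _ _ (2 * (24 / n%:R ^+ 2))).
    rewrite ler_pM2l// expRN -[leRHS]invrK lef_pV2 ?posrE ?expR_gt0//; last first.
      by rewrite invr_gt0 divr_gt0// exprn_gt0.
    rewrite invf_div; apply: (le_trans e2); by rewrite ler_expR.
  rewrite /g.
  have -> : 96 / n%:R - 96 / n.+1%:R = 96 / (n%:R * n.+1%:R) :> R.
    have n3 : n%:R + 1 != 0 :> R by rewrite natr1 gt_eqF.
    by rewrite -[n.+1%:R]natr1; field; rewrite n3 gt_eqF.
  rewrite mulrA ler_pdivrMr ?exprn_gt0// mulrAC ler_pdivlMr ?mulr_gt0//.
  have : n.+1%:R <= n%:R * 2 :> R.
    by rewrite -natrM ler_nat muln2 -addnn -addn1 leq_add2l.
  nra.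
have mO n : measurable (Ex n) by have [] := hEx n.
have g0 n : 0 <= g n by rewrite divr_ge0.
have gs e : 0 < e -> exists k, (1 <= k)%N /\ g k <= e.
  move=> e0; exists (Num.truncn (96 / e)).+1; split => //.
  rewrite /g ler_pdivrMr ?ltr0n// mulrC -ler_pdivrMr//.
  exact/ltW/truncnS_gt.
have h1 := borel_cantelli mO PO g0 gs.
have h2 := brownian_continuous hB.
near=> w.
have [n0 hn0] : exists n, forall k, (n <= k)%N -> ~ Ex k w by near: w.
have cw : {within `[0, +oo[, continuous (fun t => B t w)} by near: w.
exists n0 => n nn s hs; have [_ _] := hEx n; apply => //; exact: hn0.
Unshelve. all: by end_near. Qed.

End oscillation.

(** * Pointwise derivatives and the WKB functions *)

Section pointwise_derivatives.
Context (R : realType).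
Implicit Types (f g : R -> R) (x a b : R).

Lemma is_derive_add f g x a b : is_derive x 1 f a -> is_derive x 1 g b ->
  is_derive x 1 (fun t => f t + g t) (a + b).
Proof. by move=> hf hg; exact: is_deriveD. Qed.

Lemma is_derive_sub f g x a b : is_derive x 1 f a -> is_derive x 1 g b ->
  is_derive x 1 (fun t => f t - g t) (a - b).
Proof. by move=> hf hg; exact: is_deriveB. Qed.

Lemma is_derive_mul f g x a b : is_derive x 1 f a -> is_derive x 1 g b ->
  is_derive x 1 (fun t => f t * g t) (a * g x + f x * b).
Proof.
move=> hf hg; apply: is_derive_eq.
by rewrite addrC; congr (_ + _); rewrite mulrC.
Qed.

Lemma is_derive_scal f x a k : is_derive x 1 f a ->
  is_derive x 1 (fun t => k * f t) (k * a).
Proof. by move=> hf; exact: is_deriveZ. Qed.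

Lemma is_derive_inv f x a : f x != 0 -> is_derive x 1 f a ->
  is_derive x 1 (fun t => (f t)^-1) (- a / f x ^+ 2).
Proof.
move=> fx0 hf; apply: is_derive_eq.
by rewrite /GRing.scale /= mulrC mulrN mulNr.
Qed.

Lemma is_derive_pow f x a n : is_derive x 1 f a ->
  is_derive x 1 (fun t => f t ^+ n.+1) (n.+1%:R * f x ^+ n * a).
Proof.
move=> hf; rewrite (_ : (fun t => f t ^+ n.+1) = f ^+ n.+1).
  by apply: is_derive_eq.
by apply/funext => t; rewrite exprfctE.
Qed.

Lemma is_derive_cos_comp f x a : is_derive x 1 f a ->
  is_derive x 1 (fun t => cos (f t)) (- sin (f x) * a).
Proof.
move=> hf; have := @is_derive1_comp _ cos f x (- sin (f x)) a.
by apply => //; exact: is_derive_cos.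
Qed.

Lemma is_derive_sin_comp f x a : is_derive x 1 f a ->
  is_derive x 1 (fun t => sin (f t)) (cos (f x) * a).
Proof.
move=> hf; have := @is_derive1_comp _ sin f x (cos (f x)) a.
by apply => //; exact: is_derive_sin.
Qed.

(** The mean value theorem applied to g - f and g + f. *)
Lemma derive_comparison f g (f' g' : R -> R) (a b : R) : a <= b ->
  (forall t, a <= t <= b -> is_derive t 1 f (f' t)) ->
  (forall t, a <= t <= b -> is_derive t 1 g (g' t)) ->
  (forall t, a <= t <= b -> `|f' t| <= g' t) ->
  `|f b - f a| <= g b - g a.
Proof.
move=> ab df dg fg.
have key (e : R) : `|e| = 1 -> e * (f b - f a) <= g b - g a.
  move=> e1; pose h t := g t - e * f t.
  have dh t : a <= t <= b -> is_derive t 1 h (g' t - e * f' t).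
    by move=> tab; apply: is_derive_sub; [exact: dg|apply: is_derive_scal; exact: df].
  have ch : {within `[a, b], continuous h}.
    apply: derivable_within_continuous => t; rewrite in_itv/= => tab.
    by have [] := dh t tab.
  have dh' t : t \in `]a, b[ -> is_derive t 1 h (g' t - e * f' t).
    by rewrite in_itv/= => /andP[ta tb]; apply: dh; rewrite !ltW.
  have [c] := MVT_segment ab dh' ch; rewrite in_itv/= => cab hE.
  have : 0 <= h b - h a.
    rewrite hE mulr_ge0 ?subr_ge0// (le_trans _ (fg c cab))//.
    by rewrite (le_trans (ler_norm _))// normrM e1 mul1r.
  by rewrite /h; lra.
rewrite ler_norml lerNl; apply/andP; split.
  by have := key (-1); rewrite normrN normr1 mulN1r; apply.
by have := key 1; rewrite normr1 mul1r; apply.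
Qed.

End pointwise_derivatives.

Section wkb.
Context (R : realType).
Implicit Types (t u v m : R).

(** The fourth root of 1 + t, the amplitude y of the WKB functions. *)
Definition root4 t : R := Num.sqrt (Num.sqrt (1 + t)).

Lemma root4_ge1 t : 0 <= t -> 1 <= root4 t.
Proof.
move=> t0; rewrite /root4 -[leLHS]sqrtr1 ler_wsqrtr// -[leLHS]sqrtr1.
by rewrite ler_wsqrtr// lerDl.
Qed.

Lemma root4_gt0 t : -1 < t -> 0 < root4 t.
Proof. by move=> t1; rewrite !sqrtr_gt0 -ltrBlDl sub0r. Qed.

Lemma root4X2 t : root4 t ^+ 2 = Num.sqrt (1 + t).
Proof. by rewrite sqr_sqrtr ?sqrtr_ge0. Qed.

Lemma root4X4 t : -1 <= t -> root4 t ^+ 4 = 1 + t.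
Proof.
by move=> t1; rewrite (exprM _ 2 2) root4X2 sqr_sqrtr// -lerBlDl sub0r.
Qed.

Lemma root4_le s t : s <= t -> root4 s <= root4 t.
Proof. by move=> st; rewrite !ler_wsqrtr// lerD2l. Qed.

Lemma is_derive_root4 t : -1 < t ->
  is_derive t 1 root4 (4 * root4 t ^+ 3)^-1.
Proof.
move=> t1; have y0 := root4_gt0 t1.
have d1 : is_derive t 1 (fun t => 1 + t) 1.
  have h := is_derive_add (is_derive_cst (1 : R) t 1) (is_derive_id t (1 : R)).
  by rewrite add0r in h.
have t2 : 0 < 1 + t by rewrite -ltrBlDl sub0r.
have d2 := @is_derive1_comp _ Num.sqrt (fun s => 1 + s) t _ _
  (is_derive1_sqrt t2) d1.
have st : 0 < Num.sqrt (1 + t) by rewrite sqrtr_gt0.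
have d3 := @is_derive1_comp _ Num.sqrt (fun s => Num.sqrt (1 + s)) t _ _
  (is_derive1_sqrt st) d2.
apply: (is_derive_eq d3); rewrite /= -/(root4 t) -root4X2 mulr1 -invfM; congr (_^-1); ring.
Qed.

(** In the phase m y^2, the derivative of [osc m u v] is [osc m v (- u)]. *)
Definition osc m u v t : R :=
  u * cos (m * root4 t ^+ 2) + v * sin (m * root4 t ^+ 2).

Lemma is_derive_osc m u v t : -1 < t ->
  is_derive t 1 (osc m u v) (m / (2 * root4 t ^+ 2) * osc m v (- u) t).
Proof.
move=> t1; have y0 := root4_gt0 t1.
have d1 : is_derive t 1 (fun t => m * root4 t ^+ 2) (m / (2 * root4 t ^+ 2)).
  apply: (is_derive_eq (is_derive_scal m (is_derive_pow 1 (is_derive_root4 t1)))).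
  by field; rewrite gt_eqF.
apply: (is_derive_eq (is_derive_add (is_derive_scal u (is_derive_cos_comp d1))
  (is_derive_scal v (is_derive_sin_comp d1)))).
by rewrite /osc; ring.
Qed.

Definition wkb m u v t : R := root4 t * osc m u v t.

Definition dwkb m u v t : R :=
  osc m u v t / (4 * root4 t ^+ 3) + m / (2 * root4 t) * osc m v (- u) t.

Lemma is_derive_wkb m u v t : -1 < t ->
  is_derive t 1 (wkb m u v) (dwkb m u v t).
Proof.
move=> t1; have y0 := root4_gt0 t1.
apply: (is_derive_eq (is_derive_mul (is_derive_root4 t1) (is_derive_osc m u v t1))).
by rewrite /dwkb; field; rewrite gt_eqF.
Qed.

(** The amplitude y is chosen so that the first-order terms cancel: what remains
    is the frequency m^2 / (4 tau) of the oscillator and an error of order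
    tau^-2. *)
Lemma is_derive_dwkb m u v t : -1 < t ->
  is_derive t 1 (dwkb m u v)
    (- (m ^+ 2 / (4 * root4 t ^+ 4) + 3 / (16 * root4 t ^+ 8)) * wkb m u v t).
Proof.
move=> t1; have y0 := root4_gt0 t1.
have y1 : root4 t != 0 by rewrite gt_eqF.
have n3 : 4 * root4 t ^+ 3 != 0 by rewrite mulf_neq0// expf_neq0.
have n1 : 2 * root4 t != 0 by rewrite mulf_neq0.
have d3 := @is_derive_inv _ (fun s => 4 * root4 s ^+ 3) t _ n3
  (is_derive_scal 4 (is_derive_pow 2 (is_derive_root4 t1))).
have d1 := is_derive_scal m (@is_derive_inv _ (fun s => 2 * root4 s) t _ n1
  (is_derive_scal 2 (is_derive_root4 t1))).
apply: (is_derive_eq (is_derive_add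
  (is_derive_mul (is_derive_osc m u v t1) d3)
  (is_derive_mul d1 (is_derive_osc m v (- u) t1)))).
rewrite /wkb /osc; field; exact: y1.
Qed.

Lemma osc_le m u v t : `|osc m u v t| <= `|u| + `|v|.
Proof.
rewrite (le_trans (ler_normD _ _))// lerD// normrM ler_piMr//.
  by rewrite ler_norml cos_geN1 cos_le1.
by rewrite ler_norml sin_geN1 sin_le1.
Qed.

Lemma wkb_le m u v t : 0 <= t -> `|wkb m u v t| <= (`|u| + `|v|) * root4 t.
Proof.
move=> t0; have y0 : 0 <= root4 t by exact: sqrtr_ge0.
by rewrite normrM mulrC (ger0_norm y0) ler_wpM2r// osc_le.
Qed.

Lemma dwkb_le m u v t : 0 <= m -> 0 <= t ->
  `|dwkb m u v t| <= (`|u| + `|v|) * (1 / 4 + m / 2) / root4 t.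
Proof.
move=> m0 t0; have y1 := root4_ge1 t0.
have y0 : 0 < root4 t by exact: lt_le_trans y1.
set N := `|u| + `|v|.
have -> : N * (1 / 4 + m / 2) / root4 t =
    N * (1 / 4 / root4 t) + m / (2 * root4 t) * N by field; rewrite gt_eqF.
rewrite /dwkb (le_trans (ler_normD _ _))// lerD// normrM.
  have h : `|(4 * root4 t ^+ 3)^-1| <= 1 / 4 / root4 t.
    rewrite ger0_norm ?invr_ge0 ?mulr_ge0 ?exprn_ge0 ?(ltW y0)//.
    rewrite div1r -invfM lef_pV2 ?posrE ?mulr_gt0 ?exprn_gt0//.
    by rewrite ler_pM2l// exprS ler_peMr ?(ltW y0)// exprn_ege1.
  by rewrite ler_pM// osc_le.
rewrite [X in X * _]ger0_norm ?divr_ge0 ?mulr_ge0 ?(ltW y0)//.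
rewrite ler_wpM2l ?divr_ge0 ?mulr_ge0 ?(ltW y0)//.
by rewrite (le_trans (osc_le _ _ _ _))// normrN addrC.
Qed.

End wkb.

(** * Pairing a path with the WKB functions *)

Section pathwise.
Context (R : realType).
Implicit Types (t u v a s : R).
Variables (m sigma : R) (Y Z beta : R -> R).
Hypotheses (m0 : 0 < m) (s0 : 0 < sigma).
Hypothesis dY : forall t, 0 < t -> is_derive t 1 Y (Z t + sigma * beta t).
Hypothesis dZ : forall t, 0 < t ->
  is_derive t 1 Z (- (m ^+ 2 / 4 / (1 + t) * Y t)).
Hypothesis cb : {within `[0, +oo[, continuous beta}.

(** The Wronskian of the solution and a WKB function: X = Z + sigma beta is
    paired with p_uv, its integral Y with the derivative of p_uv. *)
Definition adjoint u v t : R :=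
  wkb m u v t * (Z t + sigma * beta t) - dwkb m u v t * Y t.

(** In the direction (cos, sin) of the current phase the pairing sees the
    solution itself, up to the derivative of the amplitude. *)
Lemma adjoint_cos t : -1 < t ->
  cos (m * root4 t ^+ 2) * adjoint 1 0 t + sin (m * root4 t ^+ 2) * adjoint 0 1 t =
  root4 t * (Z t + sigma * beta t) - Y t / (4 * root4 t ^+ 3).
Proof.
move=> t1; have y0 := root4_gt0 t1.
have := cos2Dsin2 (m * root4 t ^+ 2).
rewrite /adjoint /wkb /dwkb /osc; set C := cos _; set S := sin _ => CS.
transitivity ((C ^+ 2 + S ^+ 2) *
    (root4 t * (Z t + sigma * beta t) - Y t / (4 * root4 t ^+ 3))).
  by field; rewrite gt_eqF.
by rewrite CS mul1r.
Qed.

(** In the orthogonal direction the pairing sees the integral Y. *)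
Lemma adjoint_sin t : -1 < t ->
  sin (m * root4 t ^+ 2) * adjoint 1 0 t - cos (m * root4 t ^+ 2) * adjoint 0 1 t =
  m / (2 * root4 t) * Y t.
Proof.
move=> t1; have y0 := root4_gt0 t1.
have := cos2Dsin2 (m * root4 t ^+ 2).
rewrite /adjoint /wkb /dwkb /osc; set C := cos _; set S := sin _ => CS.
transitivity ((C ^+ 2 + S ^+ 2) * (m / (2 * root4 t) * Y t)).
  by field; rewrite gt_eqF.
by rewrite CS mul1r.
Qed.

Lemma integral_le_adjoint t : -1 < t ->
  `|Y t| <= 2 * root4 t / m * (`|adjoint 1 0 t| + `|adjoint 0 1 t|).
Proof.
move=> t1; have y0 := root4_gt0 t1.
rewrite -[2 * root4 t / m]invrK invf_div ler_pdivlMl ?divr_gt0 ?mulr_gt0//.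
rewrite -[X in X * _]ger0_norm ?divr_ge0 ?mulr_ge0 ?(ltW m0) ?(ltW y0)// -normrM.
rewrite -adjoint_sin// (le_trans (ler_normB _ _))// lerD// normrM ler_piMl//.
  by rewrite ler_norml sin_geN1 sin_le1.
by rewrite ler_norml cos_geN1 cos_le1.
Qed.

Lemma adjointE u v t : adjoint u v t = u * adjoint 1 0 t + v * adjoint 0 1 t.
Proof. rewrite /adjoint /wkb /dwkb /osc; ring. Qed.

(** Replacing beta t by its terminal value beta s inside the pairing makes it
    differentiable; the forcing terms cancel except for the variation of beta
    on the cell and for the WKB error. *)
Lemma adjoint_cell u v (a s : R) (psi psi' : R -> R) : 0 < a -> a <= s ->
  (forall t, a <= t <= s -> is_derive t 1 psi (psi' t)) ->
  (forall t, a <= t <= s -> sigma * `|beta s - beta t| * `|dwkb m u v t| +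
     3 / 16 * `|wkb m u v t| * `|Y t| / root4 t ^+ 8 <= psi' t) ->
  `|adjoint u v s - adjoint u v a - sigma * (wkb m u v a * (beta s - beta a))|
    <= psi s - psi a.
Proof.
move=> a0 as_ dpsi hpsi.
(* The noise is frozen at its terminal value, since beta has no derivative. *)
pose Phi t := wkb m u v t * (Z t + sigma * beta s) - dwkb m u v t * Y t.
pose Phi' t := sigma * (beta s - beta t) * dwkb m u v t +
  3 / 16 * wkb m u v t * Y t / root4 t ^+ 8.
have -> : adjoint u v s - adjoint u v a - sigma * (wkb m u v a * (beta s - beta a))
    = Phi s - Phi a by rewrite /Phi /adjoint; ring.
apply: (derive_comparison (f' := Phi') (g' := psi')) => // t tab.
  have t0 : 0 < t by case/andP: tab => ta _; exact: lt_le_trans ta.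
  have t1 : -1 < t by rewrite (lt_trans _ t0).
  have y0 : root4 t != 0 by rewrite gt_eqF// root4_gt0.
  have dZs : is_derive t 1 (fun t => Z t + sigma * beta s)
      (- (m ^+ 2 / 4 / (1 + t) * Y t)).
    have := is_derive_add (dZ t0) (is_derive_cst (sigma * beta s) t (1 : R)).
    by rewrite addr0.
  have := is_derive_sub (is_derive_mul (is_derive_wkb m u v t1) dZs)
    (is_derive_mul (is_derive_dwkb m u v t1) (dY t0)).
  move/is_derive_eq; apply.
  by rewrite /Phi' -(root4X4 (ltW t1)); field.
apply: le_trans (hpsi t tab); rewrite /Phi' (le_trans (ler_normD _ _))//.
have y0 : 0 <= root4 t by exact: sqrtr_ge0.
rewrite lerD// !normrM; first by rewrite (ger0_norm (ltW s0)).
rewrite (ger0_norm (_ : 0 <= (root4 t ^+ 8)^-1)) ?invr_ge0 ?exprn_ge0//.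
by rewrite (ger0_norm (_ : 0 <= (16)^-1))// ger0_norm.
Qed.

Lemma continuous_adjoint u v t : 0 < t -> {for t, continuous (adjoint u v)}.
Proof.
move=> t0; have t1 : -1 < t by rewrite (lt_trans _ t0).
have cvd f a : is_derive t 1 f a -> {for t, continuous f}.
  by move=> [df _]; apply/differentiable_continuous/derivable1_diffP.
have cbt : {for t, continuous beta}.
  apply/cvgrPdist_lt => e e0.
  have [r r0 hr] := within_continuous_dist cb (ltW t0) e0.
  apply/nbhs_ballP; exists (Num.min r t) => /=; first by rewrite lt_min r0.
  move=> w; rewrite /ball /= lt_min => /andP[wr wt]; rewrite distrC.
  apply: hr; last by rewrite distrC.
  by move: wt; rewrite ltr_norml; lra.
apply: cvgB; last first.
  by apply: cvgM; [exact: cvd (is_derive_dwkb m u v t1)|exact: cvd (dY t0)].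
apply: cvgM; first exact: cvd (is_derive_wkb m u v t1).
by apply: cvgD; [exact: cvd (dZ t0)|apply: cvgM => //; exact: cvg_cst].
Qed.

Local Notation grid n := (Num.sqrt n%:R : R).

Lemma grid_cell t : 0 <= t -> exists n, grid n <= t < grid n.+1.
Proof.
move=> t0; exists (Num.truncn (t ^+ 2)).
have /andP[h1 h2] := truncn_itv (sqr_ge0 t).
have tE : t = Num.sqrt (t ^+ 2) by rewrite sqrtr_sqr ger0_norm.
by rewrite [X in _ <= X < _]tE ler_sqrt ?sqr_ge0// ltr_sqrt ?ltr0n// h1.
Qed.

Lemma grid_le i j : (i <= j)%N -> grid i <= grid j.
Proof. by move=> ij; rewrite ler_wsqrtr// ler_nat. Qed.

Lemma grid_step i : grid i.+1 <= grid i + 1.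
Proof.
have -> : grid i + 1 = Num.sqrt ((grid i + 1) ^+ 2).
  by rewrite sqrtr_sqr ger0_norm// addr_ge0// sqrtr_ge0.
rewrite ler_wsqrtr// sqrrD sqr_sqrtr// expr1n mulr1 -natr1 lerD2r lerDl.
by rewrite mulrn_wge0// sqrtr_ge0.
Qed.

Lemma grid_gt0 n : (0 < n)%N -> 0 < grid n.
Proof. by move=> n0; rewrite sqrtr_gt0 ltr0n. Qed.

Variable n0 : nat.
Hypothesis n0_gt0 : (0 < n0)%N.
Hypothesis hosc : forall n, (n0 <= n)%N -> forall s, grid n <= s <= grid n.+1 ->
  `|beta s - beta (grid n)| <= 1.

(** The discrete stochastic integral of the WKB function over the grid of the
    square roots of the integers: their spacing, about 1 / (2 sqrt n), is small
    enough for the oscillation of a Brownian path over a late cell to be bounded. *)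
Definition noise_sum u v n : R :=
  \sum_(i < n) wkb m u v (grid i) * (beta (grid i.+1) - beta (grid i)).

Lemma cell_osc n s t : (n0 <= n)%N -> grid n <= s <= grid n.+1 ->
  grid n <= t <= s -> `|beta s - beta t| <= 2.
Proof.
move=> nn /[dup] hs /andP[gs sg] /andP[gt ts].
have h1 := hosc nn hs; have h2 := hosc nn (s := t).
have /h2 {}h2 : grid n <= t <= grid n.+1 by rewrite gt (le_trans ts).
apply: le_trans (ler_distD (beta (grid n)) _ _) _.
by rewrite [X in _ + X]distrC; lra.
Qed.

(** Summing [adjoint_cell] over consecutive cells; the comparison function [psi]
    telescopes. *)
Lemma adjoint_chain u v M n s psi psi' : (n0 <= M)%N -> (M <= n)%N ->
  grid n <= s <= grid n.+1 ->
  (forall t, grid M <= t <= s -> is_derive t 1 psi (psi' t)) ->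
  (forall t, grid M <= t <= s -> sigma * 2 * `|dwkb m u v t| +
     3 / 16 * `|wkb m u v t| * `|Y t| / root4 t ^+ 8 <= psi' t) ->
  `|adjoint u v s - adjoint u v (grid M) -
     sigma * (noise_sum u v n - noise_sum u v M) -
     sigma * (wkb m u v (grid n) * (beta s - beta (grid n)))|
    <= psi s - psi (grid M).
Proof.
move=> nM /subnKC <-; elim: (n - M)%N s => {n} [|p IH] s hs dpsi hpsi.
  rewrite addn0 in hs *; rewrite subrr mulr0 subr0.
  case/andP: (hs) => gs sg.
  have gM : 0 < grid M by rewrite grid_gt0// (leq_trans n0_gt0).
  apply: (adjoint_cell gM gs dpsi) => t ts; apply: le_trans (hpsi t ts).
  rewrite lerD2r ler_wpM2r// ler_pM2l//.
  by apply: cell_osc hs ts.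
set n := (M + p)%N in IH *.
have nM' : (n0 <= n)%N by rewrite (leq_trans nM)// leq_addr.
rewrite addnS -/n in hs *; case/andP: (hs) => gs sg.
have gM : 0 < grid M by rewrite grid_gt0// (leq_trans n0_gt0).
have Mg : grid M <= grid n.+1 by rewrite grid_le// leqW// leq_addr.
have ng : grid n <= grid n.+1 by rewrite grid_le.
have h1 := IH (grid n.+1).
have /h1 {}h1 : grid n <= grid n.+1 <= grid n.+1 by rewrite ng lexx.
have h1' : `|adjoint u v (grid n.+1) - adjoint u v (grid M) -
    sigma * (noise_sum u v n.+1 - noise_sum u v M)| <=
    psi (grid n.+1) - psi (grid M).
  have -> : adjoint u v (grid n.+1) - adjoint u v (grid M) -
      sigma * (noise_sum u v n.+1 - noise_sum u v M) =
      adjoint u v (grid n.+1) - adjoint u v (grid M) -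
      sigma * (noise_sum u v n - noise_sum u v M) -
      sigma * (wkb m u v (grid n) * (beta (grid n.+1) - beta (grid n))).
    by rewrite /noise_sum big_ord_recr /=; ring.
  apply: h1 => t /andP[t1 t2]; [apply: dpsi|apply: hpsi];
    by rewrite t1 (le_trans t2).
have h2 : `|adjoint u v s - adjoint u v (grid n.+1) -
    sigma * (wkb m u v (grid n.+1) * (beta s - beta (grid n.+1)))| <=
    psi s - psi (grid n.+1).
  have dpsi' t : grid n.+1 <= t <= s -> is_derive t 1 psi (psi' t).
    by move=> /andP[t1 t2]; apply: dpsi; rewrite (le_trans Mg t1).
  apply: (adjoint_cell (grid_gt0 (ltn0Sn n)) gs dpsi').
  move=> t /andP[t1 t2]; apply: le_trans (hpsi t _); last first.
    by rewrite (le_trans Mg t1).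
  rewrite lerD2r ler_wpM2r// ler_pM2l//.
  apply: cell_osc hs _; first exact: leqW.
  by rewrite t1.
have -> : adjoint u v s - adjoint u v (grid M) -
    sigma * (noise_sum u v n.+1 - noise_sum u v M) -
    sigma * (wkb m u v (grid n.+1) * (beta s - beta (grid n.+1))) =
  (adjoint u v (grid n.+1) - adjoint u v (grid M) -
    sigma * (noise_sum u v n.+1 - noise_sum u v M)) +
  (adjoint u v s - adjoint u v (grid n.+1) -
    sigma * (wkb m u v (grid n.+1) * (beta s - beta (grid n.+1)))) by ring.
rewrite (le_trans (ler_normD _ _))// (le_trans (lerD h1' h2))//.
by rewrite addrC addrA subrK.
Qed.

Let d0 := 1 / 4 + m / 2.
Let c1 := 2 * sigma * d0.
Let c2 := 3 / (8 * m).

Let d0_gt0 : 0 < d0. Proof. by rewrite addr_gt0// divr_gt0. Qed.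
Let c1_gt0 : 0 < c1. Proof. by rewrite !mulr_gt0. Qed.
Let c2_gt0 : 0 < c2. Proof. by rewrite divr_gt0// mulr_gt0. Qed.

Let rate_le u v t G : `|u| + `|v| = 1 -> 0 <= t ->
  `|Y t| <= 2 * root4 t / m * G ->
  sigma * 2 * `|dwkb m u v t| + 3 / 16 * `|wkb m u v t| * `|Y t| / root4 t ^+ 8
    <= c1 / root4 t + c2 * G / root4 t ^+ 6.
Proof.
move=> uv t0 YG; have y1 := root4_ge1 t0.
have y0 : 0 < root4 t by exact: lt_le_trans y1.
apply: lerD.
  have -> : c1 / root4 t = sigma * 2 * (1 * d0 / root4 t).
    by rewrite /c1; field; rewrite gt_eqF.
  by rewrite ler_wpM2l ?mulr_ge0 ?(ltW s0)// -uv dwkb_le// ltW.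
have -> : c2 * G / root4 t ^+ 6 =
    3 / 16 * (1 * root4 t) * (2 * root4 t / m * G) / root4 t ^+ 8.
  by rewrite /c2; field; rewrite !gt_eqF.
rewrite ler_wpM2r ?invr_ge0 ?exprn_ge0 ?(ltW y0)// ler_pM ?mulr_ge0//.
by rewrite ler_wpM2l// -uv wkb_le.
Qed.

Let comparison (G a b : R) t := 4 / 3 * a * root4 t ^+ 3 - 2 * b * G / root4 t ^+ 2.

Let is_derive_comparison G a b t : 0 <= t ->
  is_derive t 1 (comparison G a b) (a / root4 t + b * G / root4 t ^+ 6).
Proof.
move=> t0; have t1 : -1 < t by rewrite (lt_le_trans _ t0).
have y0 : root4 t != 0 by rewrite gt_eqF// root4_gt0.
have dy := is_derive_root4 t1.
have y2 : root4 t ^+ 2 != 0 by rewrite expf_neq0.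
apply: (is_derive_eq (is_derive_sub
  (is_derive_scal (4 / 3 * a) (is_derive_pow 2 dy))
  (is_derive_scal (2 * b * G) (@is_derive_inv _ (fun s => root4 s ^+ 2) t _ y2
    (is_derive_pow 1 dy))))).
by field.
Qed.

Let basis (e : bool) : R * R := if e then (1, 0) else (0, 1).

Let basis_norm e : `|(basis e).1| + `|(basis e).2| = 1.
Proof. by case: e => /=; rewrite normr0 normr1 ?addr0 ?add0r. Qed.

Let chain_bound e M n s G A : (n0 <= M)%N -> (M <= n)%N ->
  grid n <= s <= grid n.+1 ->
  (forall k, (M <= k)%N -> `|noise_sum (basis e).1 (basis e).2 k| <= A * root4 (grid k) ^+ 4) ->
  (forall t, grid M <= t <= s -> `|Y t| <= 2 * root4 t / m * G) ->
  `|adjoint (basis e).1 (basis e).2 s| <=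
    `|adjoint (basis e).1 (basis e).2 (grid M)| +
    (2 * sigma * A + sigma + 4 / 3 * c1) * root4 s ^+ 4 +
    2 * c2 * G / root4 (grid M) ^+ 2.
Proof.
move=> nM Mn hs hS hY; case/andP: (hs) => ns sn.
have gM : 0 < grid M by rewrite grid_gt0// (leq_trans n0_gt0).
have Ms : grid M <= s := le_trans (grid_le Mn) ns.
have sp : 0 < s := lt_le_trans gM Ms.
have y1 := root4_ge1 (ltW sp).
have y0 : 0 < root4 s by exact: lt_le_trans y1.
have yM : 0 < root4 (grid M) by rewrite root4_gt0// (lt_trans _ gM).
have G0 : 0 <= G.
  have := hY s; rewrite Ms lexx => /(_ isT) /(le_trans (normr_ge0 _)).
  by rewrite pmulr_rge0// divr_gt0// mulr_gt0.
have := adjoint_chain (psi := comparison G c1 c2) nM Mn hs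
  (fun t tMs => is_derive_comparison G c1 c2 (le_trans (ltW gM) (proj1 (andP tMs))))
  (fun t tMs => rate_le (basis_norm e) (le_trans (ltW gM) (proj1 (andP tMs)))
     (hY t tMs)).
set W := adjoint _ _; set S := noise_sum _ _; set p := wkb _ _ _ _.
move=> h.
have yle k : grid k <= s -> root4 (grid k) ^+ 4 <= root4 s ^+ 4.
  by move=> ks; rewrite lerXn2r ?nnegrE ?sqrtr_ge0// root4_le.
have A0 : 0 <= A.
  have := hS M (leqnn _) => /(le_trans (normr_ge0 _)).
  by rewrite pmulr_lge0// exprn_gt0.
have hSn : `|S n| <= A * root4 s ^+ 4.
  by rewrite (le_trans (hS n Mn))// ler_wpM2l// yle.
have hSM : `|S M| <= A * root4 s ^+ 4.
  by rewrite (le_trans (hS M (leqnn _)))// ler_wpM2l// yle.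
have hp : `|p * (beta s - beta (grid n))| <= root4 s ^+ 4.
  rewrite normrM -[leRHS]mulr1 ler_pM//; last first.
    by apply: hosc => //; exact: leq_trans Mn.
  rewrite (le_trans (wkb_le _ _ _ (sqrtr_ge0 _)))// basis_norm mul1r.
  by rewrite (le_trans (root4_le ns))// exprS ler_peMr ?exprn_ege1// ltW.
have hpsi : comparison G c1 c2 s - comparison G c1 c2 (grid M) <=
    4 / 3 * c1 * root4 s ^+ 4 + 2 * c2 * G / root4 (grid M) ^+ 2.
  have h3 : 4 / 3 * c1 * root4 s ^+ 3 <= 4 / 3 * c1 * root4 s ^+ 4.
    have c43 : 0 <= 4 / 3 * c1 by rewrite mulr_ge0// ltW.
    rewrite (ler_wpM2l c43)//.
    have -> : root4 s ^+ 4 = root4 s ^+ 3 * root4 s by rewrite exprSr.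
    by rewrite ler_peMr// exprn_ge0// ltW.
  have h4 : 0 <= 2 * c2 * G / root4 s ^+ 2.
    apply: divr_ge0; last by rewrite exprn_ge0// ltW.
    by rewrite mulr_ge0// mulr_ge0// ltW.
  have h5 : 0 <= 4 / 3 * c1 * root4 (grid M) ^+ 3.
    apply: mulr_ge0; last by rewrite exprn_ge0// ltW.
    by rewrite mulr_ge0// ltW.
  by rewrite /comparison; lra.
have -> : W s = (W s - W (grid M) - sigma * (S n - S M) -
    sigma * (p * (beta s - beta (grid n)))) + (W (grid M) + sigma * (S n - S M) +
    sigma * (p * (beta s - beta (grid n)))) by ring.
rewrite (le_trans (ler_normD _ _))//.
have h6 : `|W (grid M) + sigma * (S n - S M) + sigma * (p * (beta s - beta (grid n)))|
   <= `|W (grid M)| + sigma * (`|S n| + `|S M|) + sigma * root4 s ^+ 4.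
  rewrite (le_trans (ler_normD _ _))// lerD//; last first.
    by rewrite normrM (ger0_norm (ltW s0)) ler_wpM2l// ltW.
  rewrite (le_trans (ler_normD _ _))// lerD//.
  by rewrite normrM (ger0_norm (ltW s0)) ler_wpM2l ?(ltW s0)// ler_normB.
have h7 : sigma * (`|S n| + `|S M|) <= 2 * sigma * A * root4 s ^+ 4.
  have -> : 2 * sigma * A * root4 s ^+ 4 =
    sigma * (A * root4 s ^+ 4 + A * root4 s ^+ 4) by ring.
  by rewrite ler_wpM2l ?(ltW s0)// lerD.
apply: (le_trans (lerD (le_trans h hpsi) h6)).
rewrite -/W; move: h7; move: (sigma * (_ + _)) (2 * c2 * G / _) => x1 x2.
move: (W (grid M)) => x3; move: (root4 s ^+ 4) => x4.
have -> : (2 * sigma * A + sigma + 4 / 3 * c1) * x4 =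
  2 * sigma * A * x4 + sigma * x4 + 4 / 3 * c1 * x4 by ring.
move: `|x3| (2 * sigma * A * x4) (sigma * x4) (4 / 3 * c1 * x4) => *; lra.
Qed.

(** On [grid M', t] the sum of the two pairings attains
    its maximum G at some c; up to c one has |Y| <= (2 y / m) G, so the WKB error adds at
    most a multiple of G / y(grid M')^2, which is absorbed into the left-hand
    side once M' is large. *)
Lemma adjoint_growth M A :
  (n0 <= M)%N -> 0 <= A ->
  (forall n, (M <= n)%N -> `|noise_sum 1 0 n| <= A * root4 (grid n) ^+ 4) ->
  (forall n, (M <= n)%N -> `|noise_sum 0 1 n| <= A * root4 (grid n) ^+ 4) ->
  exists A' M', [/\ (M <= M')%N, 0 <= A' & forall t, grid M' <= t ->
    `|adjoint 1 0 t| + `|adjoint 0 1 t| <= A' * root4 t ^+ 4].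
Proof.
move=> nM A0 S10 S01.
(* M' makes the WKB error at most a quarter of G c in each direction. *)
pose X := (8 * c2) ^+ 2.
pose M' := maxn M (Num.truncn (X ^+ 2)).+1.
have MM : (M <= M')%N by rewrite leq_maxl.
have nM' : (n0 <= M')%N := leq_trans nM MM.
have M'0 : (0 < M')%N := leq_trans n0_gt0 nM'.
have gX : X <= grid M'.
  have -> : X = Num.sqrt (X ^+ 2) by rewrite sqrtr_sqr ger0_norm// sqr_ge0.
  by rewrite ler_wsqrtr// (le_trans (ltW (truncnS_gt _)))// ler_nat leq_maxr.
have yM : 8 * c2 <= root4 (grid M') ^+ 2.
  rewrite root4X2; have -> : 8 * c2 = Num.sqrt X.
    by rewrite sqrtr_sqr ger0_norm// mulr_ge0// ltW.
  by rewrite ler_wsqrtr// (le_trans gX)// lerDr.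
have g0 : 0 < grid M' := grid_gt0 M'0.
pose G t := `|adjoint 1 0 t| + `|adjoint 0 1 t|.
pose K := 2 * sigma * A + sigma + 4 / 3 * c1.
have K0 : 0 <= K.
  have c1p := ltW c1_gt0; have sp := ltW s0.
  have sA : 0 <= sigma * A by rewrite mulr_ge0.
  by rewrite /K; move: c1p sp sA; move: c1 => z; rewrite -mulrA; lra.
have GM0 z : 0 <= G z by rewrite addr_ge0.
have L0 : 0 <= 2 * (G (grid M') + 2 * K).
  by rewrite mulr_ge0// addr_ge0 ?GM0// mulr_ge0.
exists (2 * (G (grid M') + 2 * K)), M'; split => //.
move=> t gt; rewrite -/(G t).
have cG : {within `[grid M', t], continuous G}.
  apply: continuous_in_subspaceT => z; rewrite inE /= in_itv /= => /andP[gz _].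
  have z0 : 0 < z := lt_le_trans g0 gz.
  by apply: cvgD; apply: cvg_norm; exact: continuous_adjoint.
have [c] := EVT_max gt cG; rewrite in_itv /= => /andP[gc ct] cmax.
have c0 : 0 <= c := le_trans (ltW g0) gc.
have [n /andP[nc cn]] := grid_cell c0.
have M'n : (M' <= n)%N.
  rewrite -ltnS -(ltr_nat R) -ltr_sqrt ?ltr0n//; exact: le_lt_trans cn.
have hY z : grid M' <= z <= c -> `|Y z| <= 2 * root4 z / m * G c.
  move=> /andP[gz zc]; have z0 : 0 < z := lt_le_trans g0 gz.
  have z1 : -1 < z by rewrite (lt_trans _ z0).
  rewrite (le_trans (integral_le_adjoint z1))// ler_wpM2l//.
    by rewrite divr_ge0 ?mulr_ge0 ?(ltW m0)// sqrtr_ge0.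
  by apply: cmax; rewrite in_itv/= gz (le_trans zc).
have hc : grid n <= c <= grid n.+1 by rewrite nc ltW.
have b1 := @chain_bound true M' n c (G c) A nM' M'n hc
  (fun k Mk => S10 k (leq_trans MM Mk)) hY.
have b2 := @chain_bound false M' n c (G c) A nM' M'n hc
  (fun k Mk => S01 k (leq_trans MM Mk)) hY.
have yc : 1 <= root4 c ^+ 4 by rewrite exprn_ege1// root4_ge1.
have q1 : 2 * c2 * G c / root4 (grid M') ^+ 2 <= G c / 4.
  have y2 : 0 < root4 (grid M') ^+ 2.
    by rewrite exprn_gt0// root4_gt0// (lt_trans _ g0).
  rewrite ler_pdivrMr//.
  have := ler_wpM2l (_ : 0 <= G c / 4) yM; rewrite divr_ge0 ?addr_ge0//.
  move=> /(_ isT); apply: le_trans; rewrite le_eqVlt; apply/orP; left.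
  by apply/eqP; field.
have hG : G c <= G (grid M') + 2 * K * root4 c ^+ 4 + G c / 2.
  apply: (le_trans (lerD b1 b2)); rewrite /= -/K /G.
  move: q1; rewrite /G; move: (2 * c2 * _ / _) => w q1.
  move: (root4 c ^+ 4) => z.
  move: `|adjoint 1 0 c| `|adjoint 0 1 c| q1 => x1 x2.
  move: `|adjoint 1 0 _| `|adjoint 0 1 _| => x3 x4.
  lra.
have hG2 : G c <= 2 * (G (grid M') + 2 * K) * root4 c ^+ 4.
  have : G (grid M') <= G (grid M') * root4 c ^+ 4.
    by rewrite ler_peMr// addr_ge0.
  move: hG; move: (G c) (G (grid M')) (root4 c ^+ 4) => x1 x2 x3.
  move=> h1 h2; have -> : 2 * (x2 + 2 * K) * x3 = 2 * (x2 * x3) + 2 * (2 * K * x3).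
    ring.
  move: h1 h2; move: (x2 * x3) (2 * K * x3) => x4 x5; lra.
apply: (@le_trans _ _ (G c)).
  by apply: cmax; rewrite in_itv/= gt lexx.
apply: (le_trans hG2); rewrite ler_wpM2l ?L0//.
by rewrite lerXn2r ?nnegrE ?sqrtr_ge0// root4_le.
Qed.

(** With |Y| = O(y^5) from [adjoint_growth], the drift of the pairing is O(1 / y)
    per unit time, and the integral of 1 / y is (4/3) y^3. *)
Lemma adjoint_noise_sum M A :
  (n0 <= M)%N -> 0 <= A ->
  (forall n, (M <= n)%N -> `|noise_sum 1 0 n| <= A * root4 (grid n) ^+ 4) ->
  (forall n, (M <= n)%N -> `|noise_sum 0 1 n| <= A * root4 (grid n) ^+ 4) ->
  exists C M', [/\ (M <= M')%N, 0 <= C &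
    forall n, (M' <= n)%N -> forall s, grid n <= s <= grid n.+1 -> forall u v,
    `|adjoint u v s - sigma * noise_sum u v n| <=
      (`|u| + `|v|) * C * root4 s ^+ 3 ].
Proof.
move=> nM A0 S10 S01.
have [A' [M' [MM A'0 hA']]] := adjoint_growth nM A0 S10 S01.
have nM' : (n0 <= M')%N := leq_trans nM MM.
have M'0 : (0 < M')%N := leq_trans n0_gt0 nM'.
have gM : 0 < grid M' := grid_gt0 M'0.
pose c3 := c1 + c2 * A'.
have c30 : 0 <= c3.
  by apply: addr_ge0; [exact: ltW|rewrite mulr_ge0// ltW].
pose W (e : bool) := adjoint (basis e).1 (basis e).2.
pose S (e : bool) := noise_sum (basis e).1 (basis e).2.
pose D e := `|W e (grid M')| + sigma * `|S e M'| + sigma + 4 / 3 * c3.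
have D0 e : 0 <= D e.
  apply: addr_ge0; last by rewrite mulr_ge0.
  by apply: addr_ge0; [rewrite addr_ge0// mulr_ge0// ltW|exact: ltW].
have main e n s : (M' <= n)%N -> grid n <= s <= grid n.+1 ->
    `|W e s - sigma * S e n| <= D e * root4 s ^+ 3.
  move=> Mn hs; case/andP: (hs) => ns sn.
  have Ms : grid M' <= s := le_trans (grid_le Mn) ns.
  have sp : 0 < s := lt_le_trans gM Ms.
  have y1 := root4_ge1 (ltW sp).
  have y0 : 0 < root4 s by exact: lt_le_trans y1.
  pose psi t := 4 / 3 * c3 * root4 t ^+ 3.
  have dpsi t : grid M' <= t <= s -> is_derive t 1 psi (c3 / root4 t).
    move=> /andP[Mt _]; have t0 : 0 < t := lt_le_trans gM Mt.
    have t1 : -1 < t by rewrite (lt_trans _ t0).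
    apply: (is_derive_eq (is_derive_scal (4 / 3 * c3)
      (is_derive_pow 2 (is_derive_root4 t1)))).
    by field; rewrite gt_eqF// root4_gt0.
  have hrate t : grid M' <= t <= s -> sigma * 2 * `|dwkb m (basis e).1 (basis e).2 t| +
     3 / 16 * `|wkb m (basis e).1 (basis e).2 t| * `|Y t| / root4 t ^+ 8 <= c3 / root4 t.
    move=> /andP[Mt _]; have t0 : 0 < t := lt_le_trans gM Mt.
    have t1 : -1 < t by rewrite (lt_trans _ t0).
    have z1 := root4_ge1 (ltW t0); have z0 : 0 < root4 t by exact: lt_le_trans z1.
    have YG : `|Y t| <= 2 * root4 t / m * (A' * root4 t ^+ 4).
      rewrite (le_trans (integral_le_adjoint t1))// ler_wpM2l ?hA'//.
      by rewrite divr_ge0 ?mulr_ge0 ?(ltW m0) ?(ltW z0).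
    apply: (le_trans (rate_le (basis_norm e) (ltW t0) YG)).
    rewrite /c3 mulrDl lerD2l.
    have -> : c2 * (A' * root4 t ^+ 4) / root4 t ^+ 6 = c2 * A' / root4 t / root4 t.
      by field; rewrite gt_eqF.
    have cA : 0 <= c2 * A' / root4 t.
      by apply: divr_ge0; [rewrite mulr_ge0// ltW|exact: ltW].
    by rewrite ler_pdivrMr// ler_peMr.
  have h := adjoint_chain nM' Mn hs dpsi hrate.
  rewrite -/(W e) -/(S e) in h.
  set p := wkb _ _ _ _ in h.
  have y3 : 1 <= root4 s ^+ 3 by rewrite exprn_ege1.
  have hp : `|p * (beta s - beta (grid n))| <= root4 s ^+ 3.
    rewrite normrM -[leRHS]mulr1 ler_pM//; last first.
      by apply: hosc => //; exact: leq_trans Mn.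
    rewrite (le_trans (wkb_le _ _ _ (sqrtr_ge0 _)))// basis_norm mul1r.
    by rewrite (le_trans (root4_le ns))// exprS ler_peMr ?exprn_ege1// ltW.
  have hpsi : psi s - psi (grid M') <= 4 / 3 * c3 * root4 s ^+ 3.
    rewrite lerBlDr lerDl /psi; apply: mulr_ge0; first exact: mulr_ge0.
    by rewrite exprn_ge0// sqrtr_ge0.
  have -> : W e s - sigma * S e n =
      (W e s - W e (grid M') - sigma * (S e n - S e M') -
       sigma * (p * (beta s - beta (grid n)))) +
      (W e (grid M') - sigma * S e M' + sigma * (p * (beta s - beta (grid n)))).
    by ring.
  rewrite (le_trans (ler_normD _ _))//.
  have h6 : `|W e (grid M') - sigma * S e M' + sigma * (p * (beta s - beta (grid n)))|
     <= (`|W e (grid M')| + sigma * `|S e M'|) + sigma * root4 s ^+ 3.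
    rewrite (le_trans (ler_normD _ _))// lerD//; last first.
      by rewrite normrM (ger0_norm (ltW s0)) ler_wpM2l// ltW.
    by rewrite (le_trans (ler_normB _ _))// normrM (ger0_norm (ltW s0)).
  apply: (le_trans (lerD (le_trans h hpsi) h6)).
  rewrite /D; have h8 : (`|W e (grid M')| + sigma * `|S e M'|) <=
     (`|W e (grid M')| + sigma * `|S e M'|) * root4 s ^+ 3.
    by rewrite ler_peMr// addr_ge0// mulr_ge0// ltW.
  rewrite -[X in _ <= X]/(_ * _) !mulrDl.
  move: h8; rewrite !mulrDl.
  move: (`|W e (grid M')|) (sigma * `|S e M'|) (root4 s ^+ 3) => x1 x2 x3.
  move: (x1 * x3) (x2 * x3) (sigma * x3) (4 / 3 * c3 * x3) => *; lra.
exists (D true + D false), M'; split => //; first by rewrite addr_ge0.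
move=> n Mn s hs u v.
have y3 : 0 <= root4 s ^+ 3 by rewrite exprn_ge0// sqrtr_ge0.
have SE : noise_sum u v n = u * S true n + v * S false n.
  rewrite /S /noise_sum !mulr_sumr -big_split /=; apply: eq_bigr => i _.
  by rewrite /wkb /osc; ring.
have -> : adjoint u v s - sigma * noise_sum u v n =
    u * (W true s - sigma * S true n) + v * (W false s - sigma * S false n).
  by rewrite SE adjointE /W /=; ring.
rewrite (le_trans (ler_normD _ _))// !normrM !mulrDl.
rewrite -[X in _ <= X]/(_ + _) lerD// -mulrA ler_wpM2l//.
  rewrite (le_trans (main true n s Mn hs))// ler_wpM2r//.
  by rewrite lerDl.
by rewrite (le_trans (main false n s Mn hs))// ler_wpM2r// lerDr.
Qed.

End pathwise.

(** * Variance of the WKB noise sums *)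

Section variance.
Context (R : realType).
Implicit Types (t u v a s : R).
Variable m : R.
Hypothesis m0 : 0 < m.

Local Notation grid n := (Num.sqrt n%:R : R).

(** The variance is a Riemann sum of wkb^2, and F below is an antiderivative of
    wkb^2 up to a bounded term: its leading part carries the mean of the squared
    trigonometric factor, the second part cancels the oscillation. *)
Lemma wkb_variance u v : exists2 C, 0 <= C & forall n,
  `|wvar (fun i => grid i.+1 - grid i) (fun i => wkb m u v (grid i)) n -
    (u ^+ 2 + v ^+ 2) / 3 * root4 (grid n) ^+ 6| <= C * root4 (grid n) ^+ 4.
Proof.
pose N := `|u| + `|v|.
have N0 : 0 <= N by rewrite addr_ge0.
have oN t : `|osc m u v t| <= N by exact: osc_le.
have oN' t : `|osc m v (- u) t| <= N.
  by rewrite (le_trans (osc_le _ _ _ _))// normrN addrC.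
pose Q t := osc m u v t * osc m v (- u) t.
have QN t : `|Q t| <= N ^+ 2 by rewrite normrM expr2 ler_pM.
pose F t := (u ^+ 2 + v ^+ 2) / 3 * root4 t ^+ 6 - m^-1 * (root4 t ^+ 4 * Q t).
have dF t : 0 <= t -> is_derive t 1 F (wkb m u v t ^+ 2 - m^-1 * Q t).
  move=> t0; have t1 : -1 < t by rewrite (lt_le_trans _ t0).
  have y0 : root4 t != 0 by rewrite gt_eqF// root4_gt0.
  have dy := is_derive_root4 t1.
  have dQ := is_derive_mul (is_derive_osc m u v t1) (is_derive_osc m v (- u) t1).
  apply: (is_derive_eq (is_derive_sub
    (is_derive_scal ((u ^+ 2 + v ^+ 2) / 3) (is_derive_pow 5 dy))
    (is_derive_scal m^-1 (is_derive_mul (is_derive_pow 3 dy) dQ)))).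
  rewrite /Q /wkb.
  have m1 : m != 0 by rewrite gt_eqF.
  have := cos2Dsin2 (m * root4 t ^+ 2).
  rewrite /osc; set C := cos _; set S := sin _ => CS.
  transitivity ((u ^+ 2 + v ^+ 2) * (C ^+ 2 + S ^+ 2) / 2 * root4 t ^+ 2 -
    m^-1 * ((u * C + v * S) * (v * C + - u * S) +
     root4 t ^+ 2 * (m / 2 * ((v * C + - u * S) ^+ 2 - (u * C + v * S) ^+ 2)))).
    by rewrite CS; field; rewrite y0 m1.
  by field.
pose d0 := 1 / 4 + m / 2.
have d00 : 0 <= d0 by rewrite addr_ge0// divr_ge0// ltW.
pose K := 2 * N ^+ 2 * d0.
have K0 : 0 <= K by rewrite !mulr_ge0// exprn_ge0.
have lip a t : 0 <= a -> a <= t -> `|wkb m u v t ^+ 2 - wkb m u v a ^+ 2| <= K * (t - a).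
  move=> a0 at_.
  have := @derive_comparison R (fun t => wkb m u v t ^+ 2) (fun t => K * t)
    (fun t => 2%:R * wkb m u v t ^+ 1 * dwkb m u v t) (fun t => K * 1) a t at_.
  rewrite -mulrBr; apply => z /andP[az _]; have z0 := le_trans a0 az.
  - have z1 : -1 < z by rewrite (lt_le_trans _ z0).
    exact: (is_derive_pow 1 (is_derive_wkb m u v z1)).
  - have y0 : 0 < root4 z by rewrite root4_gt0// (lt_le_trans _ z0).
    rewrite mulr1 expr1 normrM normrM ger0_norm//.
    have -> : K = 2 * (N * root4 z) * (N * d0 / root4 z).
      by rewrite /K; field; rewrite gt_eqF.
    apply: ler_pM => //.
      by rewrite ler_wpM2l// wkb_le.
    by rewrite dwkb_le// ltW.
pose L := N ^+ 2 / m + K.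
have L0 : 0 <= L by rewrite addr_ge0// divr_ge0 ?exprn_ge0// ltW.
have cell a b : 0 <= a -> a <= b -> b <= a + 1 ->
    `|F b - F a - wkb m u v a ^+ 2 * (b - a)| <= L * (b - a).
  move=> a0 ab ba.
  have := @derive_comparison R (fun t => F t - wkb m u v a ^+ 2 * t) (fun t => L * t)
    (fun t => wkb m u v t ^+ 2 - m^-1 * Q t - wkb m u v a ^+ 2 * 1)
    (fun t => L * 1) a b ab.
  have -> : F b - wkb m u v a ^+ 2 * b - (F a - wkb m u v a ^+ 2 * a) =
    F b - F a - wkb m u v a ^+ 2 * (b - a) by ring.
  rewrite -mulrBr; apply => z /andP[az zb]; have z0 := le_trans a0 az.
  - exact: (is_derive_sub (dF z z0) (is_derive_scal (wkb m u v a ^+ 2) (is_derive_id z (1 : R)))).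
  - rewrite !mulr1 addrAC (le_trans (ler_normB _ _))// /L [leRHS]addrC lerD//.
      by rewrite (le_trans (lip a z a0 az))// ler_piMr//; lra.
    by rewrite normrM (gtr0_norm (_ : 0 < m^-1)) ?invr_gt0// mulrC ler_wpM2r// invr_ge0 ltW.
have sumF n : `|wvar (fun i => grid i.+1 - grid i) (fun i => wkb m u v (grid i)) n -
    (F (grid n) - F (grid 0))| <= L * grid n.
  elim: n => [|n IH].
    by rewrite /wvar big_ord0 subrr subr0 normr0 mulr_ge0// sqrtr_ge0.
  rewrite wvar_recr.
  have := cell (grid n) (grid n.+1) (sqrtr_ge0 _) (grid_le R (leqnSn n)) (grid_step R n).
  move: (wvar _ _ n) IH => w IH h.
  have -> : w + wkb m u v (grid n) ^+ 2 * (grid n.+1 - grid n) -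
     (F (grid n.+1) - F (grid 0)) = (w - (F (grid n) - F (grid 0))) -
     (F (grid n.+1) - F (grid n) - wkb m u v (grid n) ^+ 2 * (grid n.+1 - grid n)).
    ring.
  rewrite (le_trans (ler_normB _ _))// (le_trans (lerD IH h))//.
  by rewrite mulrBr addrC subrK.
exists (L + N ^+ 2 / m + `|F (grid 0)|).
  by rewrite addr_ge0// addr_ge0// divr_ge0 ?exprn_ge0// ltW.
move=> n; have y1 := root4_ge1 (sqrtr_ge0 n%:R).
have y4 : 1 <= root4 (grid n) ^+ 4 by rewrite exprn_ege1.
have g4 : grid n <= root4 (grid n) ^+ 4.
  by rewrite root4X4 ?lerDr// (le_trans _ (sqrtr_ge0 _))// lerN10.
move: (wvar _ _ n) (sumF n) => w hw.
have -> : w - (u ^+ 2 + v ^+ 2) / 3 * root4 (grid n) ^+ 6 =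
  (w - (F (grid n) - F (grid 0))) - m^-1 * (root4 (grid n) ^+ 4 * Q (grid n)) -
  F (grid 0) by rewrite /F; ring.
rewrite (le_trans (ler_normB _ _))// mulrDl lerD//; last by rewrite ler_peMr.
rewrite mulrDl.
rewrite (le_trans (ler_normB _ _))// lerD//.
  by rewrite (le_trans hw)// ler_wpM2l.
have y40 : 0 <= root4 (grid n) ^+ 4 by rewrite exprn_ge0// sqrtr_ge0.
rewrite mulrCA normrM (ger0_norm y40) mulrC ler_wpM2r//.
by rewrite normrM (gtr0_norm (_ : 0 < m^-1)) ?invr_gt0// mulrC ler_wpM2r// invr_ge0 ltW.
Qed.

End variance.

(** * From the integral equation to a differential system *)

Section integral_equation.
Context (R : realType).
Local Notation mu := (@lebesgue_measure R).

Lemma is_derive_Rintegral (f : R -> R) (a x : R) :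
  {within `[a, +oo[, continuous f} -> a < x ->
  is_derive x 1 (fun t => \int[mu]_(s in `[a, t]) f s) (f x).
Proof.
move=> cf ax.
have xx : x < x + 1 by rewrite ltrDl.
have int : mu.-integrable `[a, x + 1] (EFin \o f).
  apply: continuous_compact_integrable; first exact: segment_compact.
  apply: continuous_subspaceW cf => z /=; rewrite !in_itv/= => /andP[->].
  by rewrite andbT.
have cx : {for x, continuous f}.
  apply/cvgrPdist_lt => e e0.
  have [r r0 hr] := within_continuous_dist cf (ltW ax) e0.
  apply/nbhs_ballP; exists (Num.min r (x - a)) => /=.
    by rewrite lt_min r0 subr_gt0.
  move=> w; rewrite /ball /= lt_min => /andP[wr wt]; rewrite distrC.
  apply: hr; last by rewrite distrC.
  by move: wt; rewrite ltr_norml; lra.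
have [dF F'] := continuous_FTC1_closed xx int ax cx.
by apply: DeriveDef => //; rewrite -derive1E.
Qed.

Variables (b sigma x0 : R) (X beta : R -> R).
Hypothesis cX : {within `[-1, +oo[, continuous X}.
Hypothesis eqX : forall t : R, 0 <= t -> X t = x0
  + \int[mu]_(s in `[0, t]) (b / (1 + s) * \int[mu]_(u in `[-1, s]) X u)
  + sigma * beta t.

Let Y (t : R) := \int[mu]_(u in `[-1, t]) X u.
Let Z (t : R) := x0 + \int[mu]_(s in `[0, t]) (b / (1 + s) * Y s).

Lemma is_derive_average (t : R) : 0 < t -> is_derive t 1 Y (Z t + sigma * beta t).
Proof.
move=> t0; rewrite /Z -eqX ?ltW//; apply: is_derive_Rintegral => //.
by rewrite (lt_trans _ t0).
Qed.

Lemma is_derive_drift (t : R) : 0 < t -> is_derive t 1 Z (b / (1 + t) * Y t).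
Proof.
move=> t0.
have := @is_derive_Rintegral (fun s => b / (1 + s) * Y s) 0 t.
have cf : {within `[0, +oo[, continuous (fun s => b / (1 + s) * Y s)}.
  apply: continuous_in_subspaceT => z; rewrite inE /= in_itv /= andbT => z0.
  have z1 : -1 < z by rewrite (lt_le_trans _ z0).
  have z2 : 1 + z != 0 by rewrite gt_eqF// -ltrBlDl sub0r.
  have dY : is_derive z 1 Y (X z) by exact: is_derive_Rintegral.
  have cY : {for z, continuous Y}.
    by case: dY => dY _; apply/differentiable_continuous/derivable1_diffP.
  apply: cvgM => //; apply: cvgM; first exact: cvg_cst.
  by apply: cvgV => //; apply: cvgD; [exact: cvg_cst|exact: cvg_id].
move=> /(_ cf t0) h.
have := is_derive_add (is_derive_cst x0 t (1 : R)) h.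
by rewrite add0r.
Qed.

End integral_equation.

(** * Comparison of iterated logarithms *)

Section iterated_log.
Context (R : realType).
Implicit Types (t a b C M : R).

Lemma ln_le_id a : 0 < a -> ln a <= a.
Proof.
move=> a0; have := @le_ln1Dx R (a - 1).
rewrite (_ : 1 + (a - 1) = a); last by ring.
by move=> h; apply: (le_trans (h _)); lra.
Qed.

Lemma lnln_ge M : exists2 T0, 1 <= T0 & forall t, T0 <= t ->
  1 <= ln t /\ M <= ln (ln t).
Proof.
exists (expR (expR `|M|)).
  by rewrite (le_trans _ (expR_ge1Dx _))// lerDl expR_ge0.
move=> t ht; have t0 : 0 < t := lt_le_trans (expR_gt0 _) ht.
have h : expR `|M| <= ln t by rewrite -(expRK (expR `|M|)) ler_ln ?posrE ?expR_gt0.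
have l0 : 0 < ln t := lt_le_trans (expR_gt0 _) h.
split; first by rewrite (le_trans _ h)// (le_trans _ (expR_ge1Dx _))// lerDl.
apply: (le_trans (ler_norm M)).
by rewrite -(expRK `|M|) ler_ln ?posrE ?expR_gt0.
Qed.

(** The iterated-logarithm factor at the scale y^6 of the variance of the noise
    sums, without the factor y^3. *)
Definition lnlnr t : R := Num.sqrt (2 * ln (ln (root4 t ^+ 6))).

Lemma ln_root4X6 t : 0 <= t -> ln (root4 t ^+ 6) = 3 / 2 * ln (1 + t).
Proof.
move=> t0; have y0 : 0 < root4 t by rewrite root4_gt0// (lt_le_trans _ t0).
rewrite -root4X4 ?(le_trans _ t0)// ?lerN10// !lnXn//.
by rewrite -[LHS]mulr_natl -[X in _ = _ * X]mulr_natl; field.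
Qed.

(** Both y^2 ~ sqrt t and ln ln y^6 ~ ln ln t, so that any constant larger than
    [a] absorbs the errors and the additive term [C]. *)
Lemma lnlnr_upper a b C : 0 <= a -> a < b -> exists T0, forall t, T0 <= t ->
  root4 t ^+ 2 * (a * lnlnr t + C) <= b * Num.sqrt (2 * t * ln (ln t)).
Proof.
move=> a0 ab; pose e := Num.min 1 ((b - a) / (3 * a + 2)).
have a2 : 0 < 3 * a + 2 by lra.
have e0 : 0 < e by rewrite lt_min ltr01 divr_gt0// subr_gt0.
have e1 : e <= 1 by rewrite ge_min lexx.
have eb : e * (3 * a + 2) <= b - a.
  by rewrite -ler_pdivlMr// ge_min lexx orbT.
have [T0 T01 hT0] := lnln_ge (Num.max 1 (Num.max ((C / e) ^+ 2) (ln 3 / e))).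
exists (Num.max T0 (Num.max 1 e^-1)) => t; rewrite !ge_max => /and3P[tT t1 te].
have [l1 ll] := hT0 t tT; move: ll; rewrite !ge_max => /and3P[ll1 ll2 ll3].
have t0 : 0 < t := lt_le_trans ltr01 t1.
set q := ln (ln t) in ll1 ll2 ll3 *.
have q0 : 0 < q := lt_le_trans ltr01 ll1.
have sq0 : 0 <= Num.sqrt (2 * q) by rewrite sqrtr_ge0.
have h1 : root4 t ^+ 2 <= (1 + e) * Num.sqrt t.
  rewrite root4X2; have -> : 1 + e = Num.sqrt ((1 + e) ^+ 2).
    by rewrite sqrtr_sqr ger0_norm// addr_ge0// ltW.
  rewrite -sqrtrM ?sqr_ge0// ler_wsqrtr//.
  have : 1 <= e * t by rewrite mulrC -ler_pdivrMr// div1r.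
  have : 0 <= e ^+ 2 * t by rewrite mulr_ge0 ?sqr_ge0// ltW.
  by rewrite sqrrD expr1n mul1r mulr2n; lra.
have h2 : lnlnr t <= (1 + e) * Num.sqrt (2 * q).
  have -> : 1 + e = Num.sqrt ((1 + e) ^+ 2).
    by rewrite sqrtr_sqr ger0_norm// addr_ge0// ltW.
  rewrite -sqrtrM ?sqr_ge0// ler_wsqrtr//.
  rewrite mulrCA ler_pM2l// ln_root4X6 ?(ltW t0)//.
  have lt2 : ln (1 + t) <= 2 * ln t.
    have t2 : 2 <= t.
      rewrite -[t]lnK ?posrE// (le_trans _ (expR_ge1Dx _))//; lra.
    rewrite mulr_natl -lnXn// ler_ln ?posrE ?exprn_gt0 ?addr_gt0//; nra.
  apply: (@le_trans _ _ (ln (3 * ln t))).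
    rewrite ler_ln ?posrE; [lra| |]; last by rewrite mulr_gt0// (lt_le_trans _ l1).
    by rewrite mulr_gt0// ln_gt0// ltrDl.
  rewrite lnM ?posrE// ?(lt_le_trans _ l1)// -/q.
  have : ln 3 <= e * q by rewrite mulrC -ler_pdivrMr.
  have : 0 <= e ^+ 2 * q by rewrite mulr_ge0 ?sqr_ge0// ltW.
  have : 0 <= e * q by rewrite mulr_ge0// ltW.
  rewrite sqrrD expr1n mul1r mulr2n; lra.
have h3 : C <= e * Num.sqrt (2 * q).
  rewrite -ler_pdivrMl// mulrC (le_trans (ler_norm _))// -sqrtr_sqr ler_wsqrtr//.
  by apply: (le_trans ll2); lra.
have -> : b * Num.sqrt (2 * t * q) = b * (Num.sqrt t * Num.sqrt (2 * q)).
  by rewrite -sqrtrM ?(ltW t0)//; congr (_ * Num.sqrt _); ring.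
apply: (@le_trans _ _ (root4 t ^+ 2 * ((a * (1 + e) + e) * Num.sqrt (2 * q)))).
  rewrite ler_wpM2l ?sqr_ge0// mulrDl -mulrA lerD//.
  by rewrite ler_wpM2l.
apply: (@le_trans _ _ ((1 + e) * Num.sqrt t * ((a * (1 + e) + e) * Num.sqrt (2 * q)))).
  by rewrite ler_wpM2r// mulr_ge0// addr_ge0 ?mulr_ge0 ?addr_ge0 ?(ltW e0).
have -> : (1 + e) * Num.sqrt t * ((a * (1 + e) + e) * Num.sqrt (2 * q)) =
  ((1 + e) * (a * (1 + e) + e)) * (Num.sqrt t * Num.sqrt (2 * q)) by ring.
rewrite ler_wpM2r ?mulr_ge0 ?sqrtr_ge0//.
have ee : e * e <= e by rewrite ler_piMl// ltW.
have : a * (e * e) <= a * e by rewrite ler_wpM2l.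
lra.
Qed.

End iterated_log.

(** * Paths driven by a regular noise *)

Section noise_lil.
Context (R : realType).
Implicit Types (t u v r : R).
Variable m : R.
Hypothesis m0 : 0 < m.
Local Notation grid n := (Num.sqrt n%:R : R).

(** The normalisation by y^6 makes sqrt ((u^2 + v^2) / 3) the critical value of
    [r] for Brownian paths. *)
Definition lil_bound (beta : R -> R) u v r : Prop :=
  exists n0, forall n, (n0 <= n)%N -> noise_sum m beta u v n <=
    r * Num.sqrt (2 * root4 (grid n) ^+ 6 * ln (ln (root4 (grid n) ^+ 6))).

Lemma root4_grid_unbounded r : exists n0, forall n, (n0 <= n)%N -> r <= root4 (grid n).
Proof.
exists (Num.truncn (`|r| ^+ 8)).+1 => n nn; apply: (le_trans (ler_norm r)).
have nr : `|r| ^+ 8 <= n%:R by rewrite ltW// (lt_le_trans (truncnS_gt _))// ler_nat.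
have y0 : 0 <= root4 (grid n) by exact: sqrtr_ge0.
rewrite -(@ler_pXn2r R 4)// ?nnegrE//.
have g : `|r| ^+ 4 <= grid n.
  rewrite -[leLHS]ger0_norm ?exprn_ge0// -sqrtr_sqr ler_wsqrtr//.
  by rewrite -exprM.
rewrite root4X4; first by rewrite (le_trans g)// lerDr.
by rewrite (le_trans _ (sqrtr_ge0 _))// lerN10.
Qed.

Lemma wvar_grid_le u v C : (u ^+ 2 + v ^+ 2) / 3 < C -> exists2 C', 0 <= C' &
  forall n, wvar (fun i => grid i.+1 - grid i) (fun i => wkb m u v (grid i)) n <=
    C * root4 (grid n) ^+ 6 + C'.
Proof.
move=> uC; have [K K0 hK] := wkb_variance m0 u v.
pose e := C - (u ^+ 2 + v ^+ 2) / 3; have e0 : 0 < e by rewrite subr_gt0.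
exists (K * (K / e) ^+ 2); first by rewrite mulr_ge0// sqr_ge0.
move=> n; have := hK n; rewrite ler_norml => /andP[_].
set y := root4 (grid n); rewrite lerBlDl => h; apply: (le_trans h).
have -> : C * y ^+ 6 = (u ^+ 2 + v ^+ 2) / 3 * y ^+ 6 + e * y ^+ 6 by rewrite /e; ring.
rewrite -addrA lerD2l.
have y0 : 0 <= y by exact: sqrtr_ge0.
have KK : 0 <= K * (K / e) ^+ 2 by rewrite mulr_ge0// sqr_ge0.
have ey : 0 <= e * y ^+ 6 by rewrite mulr_ge0 ?exprn_ge0// ltW.
have [yK|Ky] := leP (K / e) (y ^+ 2).
  rewrite -[leLHS]addr0 lerD//.
  have -> : e * y ^+ 6 = (y ^+ 2 * e) * y ^+ 4 by ring.
  by rewrite ler_wpM2r ?exprn_ge0// -ler_pdivrMr.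
rewrite -[leLHS]add0r lerD//.
rewrite ler_wpM2l// (exprM y 2 2) lerXn2r ?nnegrE ?sqr_ge0 ?(ltW Ky)//.
by rewrite divr_ge0// ltW.
Qed.

Context (d : measure_display) (T : measurableType d) (P : probability T R).
Variable (B : R -> T -> R).
Hypothesis hnoise : gaussian_noise P
  (fun i w => B (grid i.+1) w - B (grid i) w) (fun i => grid i.+1 - grid i).

Lemma grid_lil_upper u v r : 0 < r -> (u ^+ 2 + v ^+ 2) / 3 < r ^+ 2 ->
  {ae P, forall w, lil_bound (B ^~ w) u v r}.
Proof.
move=> r0 uvr; pose C := ((u ^+ 2 + v ^+ 2) / 3 + r ^+ 2) / 2.
have uC : (u ^+ 2 + v ^+ 2) / 3 < C by rewrite /C; lra.
have C0 : 0 < C.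
  by apply: le_lt_trans uC; rewrite divr_ge0// addr_ge0// sqr_ge0.
have Cr : C < r ^+ 2 by rewrite /C; lra.
have [C' C'0 hC'] := wvar_grid_le uC.
have v0 i : 0 <= grid i.+1 - grid i by rewrite subr_ge0 grid_le.
have y1 n : 1 <= root4 (grid n) by rewrite root4_ge1// sqrtr_ge0.
apply: (noise_lil_upper hnoise v0 (s := fun n => root4 (grid n) ^+ 6) C0 C'0 r0 Cr _ _ _ hC').
- by move=> n; rewrite exprn_ege1.
- move=> i j ij; rewrite lerXn2r ?nnegrE ?sqrtr_ge0//.
  by apply: root4_le; exact: grid_le.
- move=> z; have [n0 h] := root4_grid_unbounded z.
  exists n0; apply: (le_trans (h n0 (leqnn _))).
  by rewrite exprS ler_peMr ?exprn_ege1// sqrtr_ge0.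
Qed.

End noise_lil.

Section upper_path.
Context (R : realType).
Implicit Types (t u v r s : R).
Local Notation grid n := (Num.sqrt n%:R : R).

(** The deterministic properties of a sample path that the estimates rely on;
    they are stable under change of sign, which gives the lower limit. *)
Record averaged_path (m sigma : R) (Y Z beta : R -> R) : Prop := {
  path_average : forall t, 0 < t -> is_derive t 1 Y (Z t + sigma * beta t) ;
  path_drift : forall t, 0 < t -> is_derive t 1 Z (- (m ^+ 2 / 4 / (1 + t) * Y t)) ;
  path_noise_continuous : {within `[0, +oo[, continuous beta} ;
  path_noise_oscillation : exists n0 : nat, forall n, (n0 <= n)%N ->
    forall s, grid n <= s <= grid n.+1 -> `|beta s - beta (grid n)| <= 1 }.

Variables (m sigma : R) (Y Z beta : R -> R).
Hypotheses (lil10 : lil_bound m beta 1 0 1) (lilN10 : lil_bound m beta (-1) 0 1).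
Hypotheses (lil01 : lil_bound m beta 0 1 1) (lil0N1 : lil_bound m beta 0 (-1) 1).

Local Notation S := (noise_sum m beta).
Local Notation W := (adjoint m sigma Y Z beta).

Lemma noise_sumN u v n : S (- u) (- v) n = - S u v n.
Proof.
rewrite /noise_sum -sumrN; apply: eq_bigr => i _; rewrite /wkb /osc; ring.
Qed.

Lemma lnlnr_mono : exists n0, forall n, (n0 <= n)%N -> forall s, grid n <= s ->
  Num.sqrt (2 * root4 (grid n) ^+ 6 * ln (ln (root4 (grid n) ^+ 6))) <=
  root4 s ^+ 3 * lnlnr s.
Proof.
have [n0 hn0] := @root4_grid_unbounded R (expR 1).
exists n0 => n nn s ns; have y3 := hn0 n nn.
set y := root4 (grid n) in y3 *.
have y0 : 0 < y := lt_le_trans (expR_gt0 _) y3.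
have ys : y <= root4 s := root4_le ns.
have z0 : 0 < root4 s := lt_le_trans y0 ys.
have -> : root4 s ^+ 3 = Num.sqrt ((root4 s ^+ 3) ^+ 2).
  by rewrite sqrtr_sqr ger0_norm// exprn_ge0// ltW.
rewrite -sqrtrM ?sqr_ge0// ler_wsqrtr// -exprM.
have -> : root4 s ^+ (3 * 2) * (2 * ln (ln (root4 s ^+ 6))) =
   2 * root4 s ^+ 6 * ln (ln (root4 s ^+ 6)) by ring.
have y6 : y ^+ 6 <= root4 s ^+ 6 by rewrite lerXn2r ?nnegrE ?(ltW y0) ?(ltW z0).
have ly : 1 <= ln (y ^+ 6).
  rewrite -[leLHS](expRK (1 : R)) ler_ln ?posrE ?expR_gt0 ?exprn_gt0//.
  apply: (le_trans y3); rewrite exprS ler_peMr ?(ltW y0)// exprn_ege1//.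
  by rewrite (le_trans _ y3)// (le_trans _ (expR_ge1Dx _))// lerDl.
have lly : ln (y ^+ 6) <= ln (root4 s ^+ 6) by rewrite ler_ln ?posrE ?exprn_gt0.
rewrite ler_pM ?mulr_ge0 ?exprn_ge0 ?(ltW y0)//; first exact: ln_ge0.
  by rewrite ler_pM2l.
have l0 : 0 < ln (y ^+ 6) := lt_le_trans ltr01 ly.
by rewrite ler_ln ?posrE// (lt_le_trans l0).
Qed.

(** The noise sums are odd in (u, v), so the bounds in the four directions of
    the axes control absolute values. *)
Lemma noise_sum_le : exists n0, forall n, (n0 <= n)%N ->
  forall s, grid n <= s ->
  `|S 1 0 n| <= root4 s ^+ 3 * lnlnr s /\ `|S 0 1 n| <= root4 s ^+ 3 * lnlnr s.
Proof.
case: lil10 lilN10 lil01 lil0N1 => n1 h1 [n2 h2] [n3 h3] [n4 h4].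
have [n5 h5] := lnlnr_mono.
exists (n1 + n2 + n3 + n4 + n5)%N => n nn s ns; have h := h5 n _ s ns.
have {}h : Num.sqrt (2 * root4 (grid n) ^+ 6 * ln (ln (root4 (grid n) ^+ 6))) <=
  root4 s ^+ 3 * lnlnr s by apply: h; lia.
have N10 : S (-1) 0 n = - S 1 0 n by rewrite -noise_sumN oppr0.
have N01 : S 0 (-1) n = - S 0 1 n by rewrite -noise_sumN oppr0.
split; rewrite ler_norml lerNl; apply/andP; split; apply: le_trans h.
- by rewrite -N10 -[leRHS]mul1r; apply: h2; lia.
- by rewrite -[leRHS]mul1r; apply: h1; lia.
- by rewrite -N01 -[leRHS]mul1r; apply: h4; lia.
- by rewrite -[leRHS]mul1r; apply: h3; lia.
Qed.

Lemma lnlnr_le s : 0 <= s -> lnlnr s <= 4 * root4 s.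
Proof.
move=> sp; have y1 := root4_ge1 sp; have y0 := lt_le_trans ltr01 y1.
have -> : 4 * root4 s = Num.sqrt ((4 * root4 s) ^+ 2).
  by rewrite sqrtr_sqr ger0_norm// mulr_ge0// ltW.
rewrite ler_wsqrtr// exprMn.
have l6 : ln (root4 s ^+ 6) <= 6 * root4 s.
  by rewrite lnXn// -[leLHS]mulr_natl ler_wpM2l// ln_le_id.
have l0 : 0 <= ln (root4 s ^+ 6) by rewrite ln_ge0// exprn_ege1.
have y2 : root4 s <= root4 s ^+ 2 by rewrite expr2 ler_peMr// ltW.
have [e|l1] := eqVneq (ln (root4 s ^+ 6)) 0.
  by rewrite e ln0// mulr0 mulr_ge0// sqr_ge0.
have := ln_le_id (_ : 0 < ln (root4 s ^+ 6)); rewrite lt0r l1 l0 => /(_ isT).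
lra.
Qed.

Hypotheses (m0 : 0 < m) (s0 : 0 < sigma).
Hypothesis hpath : averaged_path m sigma Y Z beta.

(** The noise sums are O(y^3 sqrt (ln ln y)) = O(y^4), which starts the bootstrap
    of [adjoint_growth] and [adjoint_noise_sum]. *)
Lemma adjoint_close : exists C n0, [/\ 0 <= C, (0 < n0)%N &
  forall n, (n0 <= n)%N -> forall s, grid n <= s <= grid n.+1 ->
    [/\ (forall u v, `|W u v s - sigma * S u v n| <= (`|u| + `|v|) * C * root4 s ^+ 3),
        `|Y s| <= C * root4 s ^+ 5,
        `|S 1 0 n| <= root4 s ^+ 3 * lnlnr s & `|S 0 1 n| <= root4 s ^+ 3 * lnlnr s]].
Proof.
have [dY dZ cb [n1 hosc1]] := hpath.
have hosc : forall n, (n1.+1 <= n)%N -> forall s, grid n <= s <= grid n.+1 ->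
    `|beta s - beta (grid n)| <= 1 by move=> n nn; apply: hosc1; exact: ltnW.
have [n2 hS] := noise_sum_le.
pose M := maxn n1.+1 n2.
have nM : (n1.+1 <= M)%N by rewrite leq_maxl.
have hS4 n : (M <= n)%N -> `|S 1 0 n| <= 4 * root4 (grid n) ^+ 4 /\
    `|S 0 1 n| <= 4 * root4 (grid n) ^+ 4.
  rewrite geq_max => /andP[_ nn]; have [h1 h2] := hS n nn (grid n) (lexx _).
  have l4 := lnlnr_le (sqrtr_ge0 n%:R).
  have h : root4 (grid n) ^+ 3 * lnlnr (grid n) <= 4 * root4 (grid n) ^+ 4.
    have -> : 4 * root4 (grid n) ^+ 4 = root4 (grid n) ^+ 3 * (4 * root4 (grid n)).
      by ring.
    by rewrite ler_wpM2l// exprn_ge0// sqrtr_ge0.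
  by split; [exact: le_trans h1 h|exact: le_trans h2 h].
have S10 n (Mn : (M <= n)%N) := proj1 (hS4 n Mn).
have S01 n (Mn : (M <= n)%N) := proj2 (hS4 n Mn).
have [C1 [M1 [MM1 C10 hC1]]] :=
  adjoint_noise_sum m0 s0 dY dZ cb (ltn0Sn n1) hosc nM (ler0n R 4) S10 S01.
have [A [M2 [MM2 A0 hA]]] :=
  adjoint_growth m0 s0 dY dZ cb (ltn0Sn n1) hosc nM (ler0n R 4) S10 S01.
exists (Num.max C1 (2 / m * A)), (maxn M1 M2); split.
- by rewrite le_max C10.
- by rewrite leq_max (leq_trans _ MM1)// (leq_trans _ nM).
move=> n; rewrite geq_max => /andP[n1n n2n] s hs; case/andP: (hs) => ns sn.
have sp : 0 <= s := le_trans (sqrtr_ge0 _) ns.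
have y0 : 0 <= root4 s by exact: sqrtr_ge0.
have nn2 : (n2 <= n)%N.
  by rewrite (leq_trans _ n1n)// (leq_trans _ MM1)// leq_maxr.
have [h1 h2] := hS n nn2 s ns.
split => // [u v|].
  rewrite (le_trans (hC1 n n1n s hs u v))// ler_wpM2r ?exprn_ge0//.
  by rewrite ler_wpM2l ?addr_ge0// le_max lexx.
have s1 : -1 < s by rewrite (lt_le_trans _ sp).
rewrite (le_trans (integral_le_adjoint sigma Y Z beta m0 s1))//.
have gs : grid M2 <= s by apply: le_trans ns; exact: grid_le.
apply: (@le_trans _ _ (2 * root4 s / m * (A * root4 s ^+ 4))).
  by rewrite ler_wpM2l ?hA// divr_ge0 ?mulr_ge0// ltW.
have -> : 2 * root4 s / m * (A * root4 s ^+ 4) = 2 / m * A * root4 s ^+ 5.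
  by field; rewrite gt_eqF.
by rewrite ler_wpM2r ?exprn_ge0// le_max lexx orbT.
Qed.

End upper_path.

(** * Upper bound along a path *)

Section upper.
Context (R : realType).
Implicit Types (t u v r s c : R).
Local Notation grid n := (Num.sqrt n%:R : R).

Lemma unit_net (N : nat) c : (0 < N)%N -> -1 <= c <= 1 ->
  exists2 i, (i < (2 * N).+1)%N &
    `|c - (i%:R / N%:R - 1)| <= N%:R^-1 /\ `|i%:R / N%:R - 1| <= 1 :> R.
Proof.
move=> N0 /andP[c1 c2]; have Np : 0 < N%:R :> R by rewrite ltr0n.
have c0 : 0 <= N%:R * (c + 1) by rewrite mulr_ge0 ?(ltW Np)//; lra.
have /andP[h1 h2] := truncn_itv c0; set i := Num.truncn _ in h1 h2.
exists i.
  rewrite ltnS -(ler_nat R) (le_trans h1)// natrM mulrC ler_wpM2r ?(ltW Np)//; lra.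
have i1 : i%:R / N%:R <= c + 1 by rewrite ler_pdivrMr// mulrC.
have i2 : c + 1 < i%:R / N%:R + N%:R^-1.
  rewrite (_ : i%:R / N%:R + N%:R^-1 = i.+1%:R / N%:R).
    by rewrite ltr_pdivlMr// mulrC.
  by rewrite -natr1 mulrDl mul1r.
have i0 : 0 <= i%:R / N%:R :> R by rewrite divr_ge0.
by split; rewrite ler_norml; apply/andP; split; lra.
Qed.

Variables (m sigma : R) (Y Z beta : R -> R).
Hypotheses (m0 : 0 < m) (s0 : 0 < sigma).
Hypothesis hpath : averaged_path m sigma Y Z beta.
Hypotheses (lil10 : lil_bound m beta 1 0 1) (lilN10 : lil_bound m beta (-1) 0 1).
Hypotheses (lil01 : lil_bound m beta 0 1 1) (lil0N1 : lil_bound m beta 0 (-1) 1).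

Local Notation S := (noise_sum m beta).
Local Notation W := (adjoint m sigma Y Z beta).

(** Replace the unit direction (cos, sin) of the current phase by a nearby point
    (u, v) of a net of mesh 1 / N.  The bound in direction (u, v) gives r, and
    the two coordinates of the error cost 1 / N each. *)
Lemma path_upper (N : nat) r : (0 < N)%N -> 0 < r ->
  (forall i j : nat, let u := i%:R / N%:R - 1 in let v := j%:R / N%:R - 1 in
    u ^+ 2 + v ^+ 2 <= 1 + 6 / N%:R -> lil_bound m beta u v r) ->
  exists C T0, forall t, T0 <= t ->
    Z t + sigma * beta t <=
    root4 t ^+ 2 * (sigma * (r + 2 / N%:R) * lnlnr t + C).
Proof.
move=> N0 r0 hlil; have Np : 0 < N%:R :> R by rewrite ltr0n.
have Np' : 0 <= N%:R^-1 :> R by rewrite invr_ge0 ltW.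
have N1 : N%:R^-1 <= 1 :> R by rewrite invf_le1// ler1n.
have hlil' (ij : nat * nat) : exists n0, forall n, (n0 <= n)%N ->
    let u := ij.1%:R / N%:R - 1 in let v := ij.2%:R / N%:R - 1 in
    u ^+ 2 + v ^+ 2 <= 1 + 6 / N%:R -> S u v n <=
    r * Num.sqrt (2 * root4 (grid n) ^+ 6 * ln (ln (root4 (grid n) ^+ 6))).
  have [h|h] := pselect ((ij.1%:R / N%:R - 1) ^+ 2 + (ij.2%:R / N%:R - 1) ^+ 2
    <= 1 + 6 / N%:R :> R); last by exists 0%N.
  by have [n0 hn0] := hlil ij.1 ij.2 h; exists n0 => n nn u v _; exact: hn0.
have [f hf] := choice hlil'.
pose F := (\max_(i < (2 * N).+1) \max_(j < (2 * N).+1) f (i : nat, j : nat))%N.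
have fF i j : (i < (2 * N).+1)%N -> (j < (2 * N).+1)%N -> (f (i, j) <= F)%N.
  move=> hi hj; apply: leq_trans (leq_bigmax (Ordinal hi)).
  exact: (leq_bigmax (F := fun j : 'I__ => f (i, j : nat)) (Ordinal hj)).
have [C [n1 [C0 n1_gt0 close]]] :=
  adjoint_close lil10 lilN10 lil01 lil0N1 m0 s0 hpath.
have [n2 mono] := lnlnr_mono R.
pose n0 := (n1 + n2 + F)%N.
exists (6 * C), (grid n0) => t t0.
have tp : 0 <= t := le_trans (sqrtr_ge0 _) t0.
have t1 : -1 < t by rewrite (lt_le_trans _ tp).
have [n /andP[nt tn]] := grid_cell tp.
have n0n : (n0 <= n)%N.
  rewrite -ltnS -(ltr_nat R) -ltr_sqrt ?ltr0n//; exact: le_lt_trans tn.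
have n1n : (n1 <= n)%N by rewrite (leq_trans _ n0n)// /n0 -addnA leq_addr.
have n2n : (n2 <= n)%N by rewrite (leq_trans _ n0n)// /n0 addnAC leq_addl.
have Fn : (F <= n)%N by rewrite (leq_trans _ n0n)// /n0 leq_addl.
have hcell : grid n <= t <= grid n.+1 by rewrite nt ltW.
have [hW hY hS1 hS2] := close n n1n t hcell.
have y1 := root4_ge1 tp; have y0 := lt_le_trans ltr01 y1.
set y := root4 t in y1 y0 hW hY hS1 hS2 *.
pose th := m * y ^+ 2.
have hc : -1 <= cos th <= 1 by rewrite cos_geN1 cos_le1.
have hs : -1 <= sin th <= 1 by rewrite sin_geN1 sin_le1.
have [i hi [ci ui]] := unit_net N0 hc.
have [j hj [cj vj]] := unit_net N0 hs.
set u := i%:R / N%:R - 1 in ci ui; set v := j%:R / N%:R - 1 in cj vj.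
have uv : u ^+ 2 + v ^+ 2 <= 1 + 6 / N%:R.
  have sq (x z : R) : `|x| <= 1 -> `|x - z| <= N%:R^-1 -> z ^+ 2 <= x ^+ 2 + 3 / N%:R.
    move=> x1 xz; have -> : z ^+ 2 = x ^+ 2 + ((x - z) ^+ 2 - 2 * (x * (x - z))) by ring.
    rewrite lerD2l (le_trans (ler_norm _))// (le_trans (ler_normB _ _))//.
    have -> : 3 / N%:R = N%:R^-1 + 2 * N%:R^-1 :> R by ring.
    apply: lerD.
      rewrite normrX -[leRHS]mulr1 expr2 ler_pM// (le_trans xz)//.
    rewrite normrM ger0_norm// ler_wpM2l// normrM -[leRHS]mul1r ler_pM//.
  have c1 : `|cos th| <= 1 by rewrite ler_norml.
  have c2 : `|sin th| <= 1 by rewrite ler_norml.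
  have := sq _ _ c1 ci; have := sq _ _ c2 cj; have := cos2Dsin2 th.
  by move: (N%:R^-1) => z; lra.
have nf : (f (i, j) <= n)%N := leq_trans (fF i j hi hj) Fn.
have hS := hf (i, j) n nf uv; rewrite -/u -/v in hS.
have l0 : 0 <= lnlnr t by exact: sqrtr_ge0.
have hSuv : S u v n <= r * (y ^+ 3 * lnlnr t).
  by rewrite (le_trans hS)// ler_wpM2l ?(ltW r0)// mono.
have y3 : 0 <= y ^+ 3 by rewrite exprn_ge0// ltW.
have CY : 0 <= C * y ^+ 3 by rewrite mulr_ge0.
have hWuv : W u v t <= sigma * r * (y ^+ 3 * lnlnr t) + 2 * (C * y ^+ 3).
  have := hW u v; rewrite ler_norml => /andP[_]; rewrite lerBlDl => h.
  apply: (le_trans h); apply: lerD.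
    by rewrite -mulrA ler_wpM2l// ltW.
  rewrite -mulrA ler_wpM2r//; lra.
have hWb (e : bool) : `|if e then W 1 0 t else W 0 1 t| <=
    sigma * (y ^+ 3 * lnlnr t) + C * y ^+ 3.
  have tri (w s' : R) : `|w - sigma * s'| <= C * y ^+ 3 ->
      `|s'| <= y ^+ 3 * lnlnr t -> `|w| <= sigma * (y ^+ 3 * lnlnr t) + C * y ^+ 3.
    move=> h1 h2; rewrite -[w](subrK (sigma * s')) addrC.
    rewrite (le_trans (ler_normD _ _))// lerD//.
    by rewrite normrM (ger0_norm (ltW s0)) ler_wpM2l// ltW.
  case: e; [apply: (tri _ (S 1 0 n))|apply: (tri _ (S 0 1 n))] => //.
    by have := hW 1 0; rewrite normr1 normr0 addr0 mul1r.
  by have := hW 0 1; rewrite normr1 normr0 add0r mul1r.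
have key := adjoint_cos m sigma Y Z beta t1; rewrite -/y -/th in key.
have expand : cos th * W 1 0 t + sin th * W 0 1 t =
    W u v t + (cos th - u) * W 1 0 t + (sin th - v) * W 0 1 t.
  by rewrite (adjointE m sigma Y Z beta u v t); ring.
have hY' : `|Y t / (4 * y ^+ 3)| <= C * y ^+ 3.
  have y30 : 0 < 4 * y ^+ 3 by rewrite mulr_gt0// exprn_gt0.
  rewrite normrM [X in _ * X]ger0_norm ?invr_ge0 ?(ltW y30)//.
  rewrite ler_pdivrMr// (le_trans hY)//.
  have -> : C * y ^+ 3 * (4 * y ^+ 3) = C * y ^+ 5 * (4 * y) by ring.
  rewrite ler_peMr//; last lra.
  by rewrite mulr_ge0// exprn_ge0// ltW.
have small (x w K : R) : `|x| <= N%:R^-1 -> `|w| <= K -> x * w <= N%:R^-1 * K.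
  move=> h1 h2; rewrite (le_trans (ler_norm _))// normrM ler_pM//.
have b1 := small _ _ _ ci (hWb true).
have b2 := small _ _ _ cj (hWb false).
have b3 : N%:R^-1 * (C * y ^+ 3) <= C * y ^+ 3 by rewrite ler_piMl.
have final : y * (Z t + sigma * beta t) <=
    y ^+ 3 * (sigma * (r + 2 / N%:R) * lnlnr t + 6 * C).
  have -> : y * (Z t + sigma * beta t) = W u v t + (cos th - u) * W 1 0 t +
     (sin th - v) * W 0 1 t + Y t / (4 * y ^+ 3).
    by rewrite -expand key subrK.
  move: hY'; rewrite ler_norml => /andP[_ hY'].
  have -> : y ^+ 3 * (sigma * (r + 2 / N%:R) * lnlnr t + 6 * C) =
    sigma * r * (y ^+ 3 * lnlnr t) + 2 * (C * y ^+ 3) +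
    2 * (N%:R^-1 * (sigma * (y ^+ 3 * lnlnr t)) + C * y ^+ 3) + 2 * (C * y ^+ 3) by ring.
  rewrite [leRHS]mulrDr in b1; rewrite [leRHS]mulrDr in b2.
  rewrite /= in b1 b2.
  clear -b1 b2 b3 hWuv hY' CY; lra.
have -> : y ^+ 2 * (sigma * (r + 2 / N%:R) * lnlnr t + 6 * C) =
   y^-1 * (y ^+ 3 * (sigma * (r + 2 / N%:R) * lnlnr t + 6 * C)).
  by field; rewrite gt_eqF// gt_eqF.
by rewrite ler_pdivlMl.
Qed.

End upper.

(** * Resonant times *)

Section resonant_times.
Context (R : realType).
Implicit Types (t u v r s c : R).
Local Notation grid n := (Num.sqrt n%:R : R).
Variables (m : R) (N : nat).
Hypotheses (m0 : 0 < m) (N2 : (2 <= N)%N).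

(** The value of y^2 at the k-th resonant time, where the phase m y^2 is a
    multiple of 2 pi. *)
Definition resonant2 k : R := 2 * pi * N%:R ^+ k / m.
Definition resonant k : R := resonant2 k ^+ 2 - 1.
(** The index of the grid cell that contains the k-th resonant time. *)
Definition block k : nat := Num.truncn (resonant k ^+ 2).

Lemma resonant2_gt0 k : 0 < resonant2 k.
Proof.
by rewrite divr_gt0// mulr_gt0 ?mulr_gt0 ?pi_gt0// exprn_gt0// ltr0n (leq_trans _ N2).
Qed.

Lemma resonant2S k : resonant2 k.+1 = N%:R * resonant2 k.
Proof. by rewrite /resonant2 exprS; ring. Qed.

Lemma resonant2_nd j k : (j <= k)%N -> resonant2 j <= resonant2 k.
Proof.
move/subnKC <-; elim: (k - j)%N => [|p IH]; first by rewrite addn0.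
rewrite addnS resonant2S (le_trans IH)// ler_peMl ?(ltW (resonant2_gt0 _))//.
by rewrite ler1n (leq_trans _ N2).
Qed.

Lemma resonant2_unbounded c : exists k0, forall k, (k0 <= k)%N -> c <= resonant2 k.
Proof.
have p0 : 0 < 2 * pi / m by rewrite divr_gt0// mulr_gt0// pi_gt0.
exists (Num.truncn (`|c| / (2 * pi / m))).+1 => k kk; apply: (le_trans (ler_norm c)).
have -> : resonant2 k = N%:R ^+ k * (2 * pi / m) by rewrite /resonant2; ring.
rewrite -ler_pdivrMr// ltW// (lt_le_trans (truncnS_gt _))// -natrX ler_nat.
by rewrite (leq_trans kk)// ltnW// ltn_expl.
Qed.

Lemma root4_resonant k : root4 (resonant k) ^+ 2 = resonant2 k.
Proof.
rewrite root4X2 /resonant addrC subrK sqrtr_sqr ger0_norm//.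
exact/ltW/resonant2_gt0.
Qed.

Lemma cos_resonant k : cos (m * root4 (resonant k) ^+ 2) = 1.
Proof.
rewrite root4_resonant /resonant2.
have -> : m * (2 * pi * N%:R ^+ k / m) = 0 + (pi *+ 2) *+ (N ^ k).
  by rewrite add0r -[RHS]mulr_natl -[pi *+ 2]mulr_natl natrX; field; rewrite gt_eqF.
by rewrite (periodicn (@cosD2pi R)) cos0.
Qed.

Lemma sin_resonant k : sin (m * root4 (resonant k) ^+ 2) = 0.
Proof.
apply/eqP; rewrite -sqrf_eq0; apply/eqP.
by have := cos2Dsin2 (m * root4 (resonant k) ^+ 2); rewrite cos_resonant; lra.
Qed.

Lemma block_cell k : 0 <= resonant k ->
  grid (block k) <= resonant k <= grid (block k).+1.
Proof.
move=> t0; have /andP[h1 h2] := truncn_itv (sqr_ge0 (resonant k)).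
have tE : resonant k = Num.sqrt (resonant k ^+ 2) by rewrite sqrtr_sqr ger0_norm.
by rewrite [X in _ <= X <= _]tE !ler_wsqrtr// ltW.
Qed.

Lemma block_nd k : 0 <= resonant k -> (block k <= block k.+1)%N.
Proof.
move=> t0; rewrite le_truncn// lerXn2r ?nnegrE//.
  apply: (le_trans t0); rewrite lerD2r lerXn2r ?nnegrE ?(ltW (resonant2_gt0 _))//.
  exact: resonant2_nd.
by rewrite lerD2r lerXn2r ?nnegrE ?(ltW (resonant2_gt0 _))// resonant2_nd.
Qed.

(** The previous resonant time has y smaller by the factor sqrt N, so the
    variance accumulated before it is a fraction N^-3 of the total. *)
Lemma block_variance c : c < 1 / 3 -> (1 / 3 - c)^-1 <= N%:R ->
  exists k0, forall k, (k0 <= k)%N -> 0 < resonant k /\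
    c * root4 (resonant k.+1) ^+ 6 <=
    wvar (fun i => grid i.+1 - grid i) (fun i => wkb m 1 0 (grid i)) (block k.+1) -
    wvar (fun i => grid i.+1 - grid i) (fun i => wkb m 1 0 (grid i)) (block k).
Proof.
move=> c3 Ne; have [K K0 hK] := wkb_variance m0 1 0.
pose e := 1 / 3 - c; have e0 : 0 < e by rewrite subr_gt0.
have [k0 hk0] := resonant2_unbounded (Num.max 2 ((2 * K + 1) * 2 / e)).
exists k0 => k kk; have := hk0 k kk; rewrite ge_max => /andP[z2 zK].
have := hk0 k.+1 (leqW kk); rewrite ge_max => /andP[z2' zK'].
have T0 : 0 < resonant k.
  by rewrite subr_gt0 expr_gt1 ?(le_trans _ z2)//; lra.
have T0' : 0 < resonant k.+1.
  by rewrite subr_gt0 expr_gt1 ?(le_trans _ z2')//; lra.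
split => //.
have /andP[g1 _] := block_cell (ltW T0).
have /andP[g2 g3] := block_cell (ltW T0').
have := hK (block k.+1); have := hK (block k).
set V' := wvar _ _ (block k.+1); set V := wvar _ _ (block k).
rewrite !ler_norml expr1n expr0n addr0 => /andP[_ hV] /andP[hV' _].
set x := resonant2 k in z2 zK *.
have x6 : root4 (resonant k) ^+ 6 = x ^+ 3 by rewrite (exprM _ 2 3) root4_resonant.
have x4 : root4 (resonant k) ^+ 4 = x ^+ 2 by rewrite (exprM _ 2 2) root4_resonant.
set z := resonant2 k.+1 in z2' zK' *.
have z6 : root4 (resonant k.+1) ^+ 6 = z ^+ 3 by rewrite (exprM _ 2 3) root4_resonant.
have z4 : root4 (resonant k.+1) ^+ 4 = z ^+ 2 by rewrite (exprM _ 2 2) root4_resonant.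
have zx : z = N%:R * x by rewrite /z resonant2S.
have Np : 0 < N%:R :> R by rewrite ltr0n (leq_trans _ N2).
have N1 : 1 <= N%:R :> R by rewrite ler1n (leq_trans _ N2).
have x0 : 0 < x by exact: resonant2_gt0.
have z0 : 0 < z by exact: resonant2_gt0.
pose y := root4 (grid (block k)); pose y' := root4 (grid (block k.+1)).
have y0 : 0 <= y by exact: sqrtr_ge0.
have y0' : 0 <= y' by exact: sqrtr_ge0.
have yx6 : y ^+ 6 <= x ^+ 3.
  by rewrite -x6 lerXn2r ?nnegrE ?sqrtr_ge0// root4_le.
have yx4 : y ^+ 4 <= x ^+ 2.
  by rewrite -x4 lerXn2r ?nnegrE ?sqrtr_ge0// root4_le.
have yz4 : y' ^+ 4 <= z ^+ 2.
  by rewrite -z4 lerXn2r ?nnegrE ?sqrtr_ge0// root4_le.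
have y4z : z ^+ 2 - 1 <= y' ^+ 4.
  have -> : z ^+ 2 - 1 = resonant k.+1 by [].
  rewrite /y' root4X4; last by rewrite (le_trans _ (sqrtr_ge0 _))// lerN10.
  rewrite (le_trans g3)// addrC.
  exact: grid_step.
have y2z : z - 1 <= y' ^+ 2.
  rewrite -(@ler_pXn2r R 2)// ?nnegrE ?sqr_ge0//; last by lra.
  rewrite -exprM (le_trans _ y4z)//; nra.
have y6z : z ^+ 3 - 2 * z ^+ 2 <= y' ^+ 6.
  have -> : y' ^+ 6 = y' ^+ 4 * y' ^+ 2 by ring.
  apply: (@le_trans _ _ ((z ^+ 2 - 1) * (z - 1))); first nra.
  rewrite ler_pM//; [nra|lra].
rewrite z6.
have x3z : x ^+ 3 <= e * z ^+ 3.
  have -> : e * z ^+ 3 = e * N%:R ^+ 3 * x ^+ 3 by rewrite zx; ring.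
  have x30 : 0 <= x ^+ 3 by rewrite exprn_ge0// ltW.
  rewrite ler_peMl//.
  have Ne1 : 1 <= e * N%:R.
    by move: Ne; rewrite -/e -[_^-1]div1r ler_pdivrMr// mulrC.
  apply: (le_trans Ne1); rewrite ler_wpM2l ?(ltW e0)//.
  by rewrite exprS ler_peMr ?(ltW Np)// exprn_ege1.
have xz : x ^+ 2 <= z ^+ 2.
  by rewrite lerXn2r ?nnegrE ?(ltW x0) ?(ltW z0)// zx ler_peMl// ltW.
have Kz : (2 * K + 1) * z ^+ 2 <= e / 2 * z ^+ 3.
  have -> : e / 2 * z ^+ 3 = (e / 2 * z) * z ^+ 2 by ring.
  rewrite ler_wpM2r ?sqr_ge0//.
  move: zK'; rewrite ler_pdivrMr//; lra.
have h1 : V <= 1 / 3 * x ^+ 3 + K * z ^+ 2.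
  have : K * y ^+ 4 <= K * z ^+ 2 by rewrite ler_wpM2l// (le_trans yx4).
  move: hV yx6; rewrite -/y; lra.
have h2 : 1 / 3 * z ^+ 3 - 2 / 3 * z ^+ 2 - K * z ^+ 2 <= V'.
  have : K * y' ^+ 4 <= K * z ^+ 2 by rewrite ler_wpM2l.
  move: hV' y6z; rewrite -/y'; lra.
have ce : c = 1 / 3 - e by rewrite /e; ring.
rewrite ce; have : 0 <= e * z ^+ 3 by rewrite mulr_ge0 ?exprn_ge0// ltW.
have : 0 <= z ^+ 2 by rewrite sqr_ge0.
lra.
Qed.

End resonant_times.

(** * Lower bound along a path *)

Section lower.
Context (R : realType).
Implicit Types (t u v r s c : R).
Local Notation grid n := (Num.sqrt n%:R : R).
Variables (m : R) (N : nat).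
Hypotheses (m0 : 0 < m) (N2 : (2 <= N)%N).

Lemma resonant_unbounded c : exists k0, forall k, (k0 <= k)%N -> c <= resonant m N k.
Proof.
have [k0 h] := resonant2_unbounded m0 N2 (Num.max 2 c).
exists k0 => k kk; have := h k kk; rewrite ge_max => /andP[z2 zc].
rewrite (le_trans zc)// /resonant; nra.
Qed.

Lemma block_unbounded n : exists k0, forall k, (k0 <= k)%N -> (n <= block m N k)%N.
Proof.
have [k0 h] := resonant_unbounded (Num.max 1 n%:R).
exists k0 => k kk; have := h k kk; rewrite ge_max => /andP[z1 zn].
rewrite truncn_ge_nat ?sqr_ge0// (le_trans zn)// expr2 ler_peMr//.
exact: le_trans z1.
Qed.

(** ln y^6 grows linearly in k along the resonant times, so that ln ln y^6 is
    ln k up to an additive constant. *)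
Lemma lnlnr_resonant k0 (e : R) : 0 < e -> exists k1, forall k, (k1 <= k)%N ->
  lnlnr (resonant m N (k + k0).+1) <= (1 + e) * Num.sqrt (2 * ln k%:R).
Proof.
move=> e0; pose a := `|ln (2 * pi / m)|.
have Np : 0 < N%:R :> R by rewrite ltr0n (leq_trans _ N2).
have lN : 0 <= ln N%:R :> R by rewrite ln_ge0// ler1n (leq_trans _ N2).
pose D := 3 * (k0.+2%:R * ln N%:R + a) + 1.
have D0 : 0 < D.
  have : 0 <= 3 * (k0.+2%:R * ln N%:R + a).
    by rewrite mulr_ge0// addr_ge0// ?normr_ge0// mulr_ge0.
  by rewrite /D; lra.
have [k1 hk1] := ln_natr_ge (Num.max 1 (ln D / e)).
have [k2 hk2] := resonant_unbounded 1.
exists (maxn (maxn k1 k2) 1) => k; rewrite !geq_max => /andP[/andP[kk1 kk2] k_gt0].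
have := hk1 k kk1; rewrite ge_max => /andP[l1 lD].
have T1 : 1 <= resonant m N (k + k0).+1.
  by apply: hk2; rewrite (leq_trans kk2)// leqW// leq_addr.
have T0 : 0 <= resonant m N (k + k0).+1 by rewrite (le_trans _ T1).
have kp : 0 < k%:R :> R by rewrite ltr0n.
have k1' : 1 <= k%:R :> R by rewrite ler1n.
set T := resonant m N _ in T0 T1 *.
have y1 : 1 < root4 T.
  rewrite -(@ltr_pXn2r R 4)// ?nnegrE ?sqrtr_ge0// expr1n root4X4; first by lra.
  by lra.
have ly : 0 < ln (root4 T ^+ 6) by rewrite ln_gt0// exprn_egt1.
have lD' : ln (root4 T ^+ 6) <= D * k%:R.
  rewrite (exprM _ 2 3) root4_resonant// lnXn ?resonant2_gt0//.
  have -> : resonant2 m N (k + k0).+1 = N%:R ^+ (k + k0).+1 * (2 * pi / m).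
    by rewrite /resonant2; ring.
  have p0 : 0 < 2 * pi / m by rewrite divr_gt0// mulr_gt0// pi_gt0.
  rewrite lnM ?posrE ?exprn_gt0// lnXn//.
  have h1 : (ln N%:R : R) *+ (k + k0).+1 <= (k0.+2%:R : R) * ln N%:R * k%:R.
    rewrite -[leLHS]mulr_natl [leRHS]mulrAC; apply: ler_wpM2r => //.
    rewrite -natrM ler_nat.
    by move: k_gt0; clear; nia.
  have h2 : ln (2 * pi / m) <= a * k%:R.
    by rewrite (le_trans (ler_norm _))// ler_peMr.
  rewrite -[leLHS]mulr_natl /D; move: h1 h2.
  move: (ln N%:R *+ _) (ln (2 * pi / m)) => x1 x2 h1 h2.
  have : 0 <= k%:R :> R by rewrite ltW.
  lra.
have ll : ln (ln (root4 T ^+ 6)) <= (1 + e) * ln k%:R.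
  apply: (@le_trans _ _ (ln (D * k%:R))); first by rewrite ler_ln ?posrE ?mulr_gt0.
  rewrite lnM ?posrE//; move: lD; rewrite ler_pdivrMr//; lra.
rewrite /lnlnr; have -> : 1 + e = Num.sqrt ((1 + e) ^+ 2).
  by rewrite sqrtr_sqr ger0_norm// addr_ge0// ltW.
rewrite -sqrtrM ?sqr_ge0// ler_wsqrtr//.
have : 0 <= (1 + e) * e * ln k%:R.
  by rewrite !mulr_ge0 ?addr_ge0 ?(ltW e0)// (le_trans _ l1).
move: ll l1; rewrite expr2; lra.
Qed.

Variables (sigma : R) (Y Z beta : R -> R).
Hypothesis s0 : 0 < sigma.
Hypothesis hpath : averaged_path m sigma Y Z beta.
Hypotheses (lil10 : lil_bound m beta 1 0 1) (lilN10 : lil_bound m beta (-1) 0 1).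
Hypotheses (lil01 : lil_bound m beta 0 1 1) (lil0N1 : lil_bound m beta 0 (-1) 1).

Local Notation S := (noise_sum m beta).
Local Notation W := (adjoint m sigma Y Z beta).
Local Notation V := (wvar (fun i => grid i.+1 - grid i) (fun i => wkb m 1 0 (grid i))).

(** At the end of a block on which the increment of S_10 is large, the noise sum
    at the beginning of the block is at most 1 / N of the typical size, by the
    upper bound, and at a resonant time the solution is W_10 / y up to
    negligible terms. *)
Lemma path_lower (b r e kappa : R) k0 : 0 <= b -> 0 < r -> 0 < e -> 0 <= kappa ->
  (1 + e) * (kappa + N%:R^-1) < r * b ->
  (forall k, (k0 <= k)%N ->
    b ^+ 2 * root4 (resonant m N k.+1) ^+ 6 <= V (block m N k.+1) - V (block m N k)) ->
  (forall k1, exists2 k, (k1 <= k)%N &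
    r * Num.sqrt (2 * (V (block m N (k + k0).+1) - V (block m N (k + k0))) * ln k%:R) <=
    S 1 0 (block m N (k + k0).+1) - S 1 0 (block m N (k + k0))) ->
  forall t0, exists2 t, t0 <= t &
    kappa * sigma * Num.sqrt (2 * t * ln (ln t)) <= Z t + sigma * beta t.
Proof.
move=> b0 r0 e0 kap0 gap hV freq t0.
have Np : 0 < N%:R :> R by rewrite ltr0n (leq_trans _ N2).
have [C [n1 [C0 n1_gt0 close]]] :=
  adjoint_close lil10 lilN10 lil01 lil0N1 m0 s0 hpath.
have [n2 hS] := noise_sum_le lil10 lilN10 lil01 lil0N1.
have [k1 hk1] := lnlnr_resonant k0 e0.
have [k2 hk2] := block_unbounded (maxn n1 n2).
have [k3 hk3] := resonant_unbounded (Num.max t0 (expR 1)).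
pose g := sigma * (r * b - (1 + e) * (kappa + N%:R^-1)).
have g0 : 0 < g by rewrite mulr_gt0// subr_gt0.
have [k4 hk4] := ln_natr_ge (Num.max 1 ((2 * C / g) ^+ 2)).
have [k kk hk] := freq (k1 + k2 + k3 + k4)%N.
have kk1 : (k1 <= k)%N by move: kk; clear; lia.
have kk2 : (k2 <= k + k0)%N by move: kk; clear; lia.
have kk2' : (k2 <= (k + k0).+1)%N by move: kk; clear; lia.
have kk3 : (k3 <= k + k0)%N by move: kk; clear; lia.
have kk3' : (k3 <= (k + k0).+1)%N by move: kk; clear; lia.
have kk4 : (k4 <= k)%N by move: kk; clear; lia.
have := hk4 k kk4; rewrite ge_max => /andP[l1 lC].
have := hk3 _ kk3'; rewrite ge_max => /andP[Tt0 Te].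
have := hk3 _ kk3; rewrite ge_max => /andP[_ Te'].
have := hk2 _ kk2; rewrite geq_max => /andP[_ bn2].
have := hk2 _ kk2'; rewrite geq_max => /andP[bn1 _].
have lnT := hk1 k kk1.
have hVk := hV (k + k0)%N (leq_addl _ _).
have cosT := cos_resonant m0 N2 (k + k0).+1.
have sinT := sin_resonant m0 N2 (k + k0).+1.
have zT := root4_resonant m0 N2 (k + k0).+1.
have zT' := root4_resonant m0 N2 (k + k0).
have zS := resonant2S m N (k + k0).
set T := resonant m N (k + k0).+1 in Tt0 Te lnT hVk cosT sinT zT.
set T' := resonant m N (k + k0) in Te' zT'.
have e2 : 2 <= expR 1 :> R by rewrite (le_trans _ (expR_ge1Dx _))//; lra.
have e1 : 1 < expR 1 :> R by apply: lt_le_trans e2; rewrite ltr1n.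
have Tp : 0 <= T by rewrite (le_trans _ Te)// (le_trans _ (ltW e1)).
have Tp' : 0 <= T' by rewrite (le_trans _ Te')// (le_trans _ (ltW e1)).
have T1 : -1 < T by rewrite (lt_le_trans _ Tp)// ltrN10.
have cellT := block_cell (m:=m) (N:=N) (k:=(k + k0).+1) Tp.
have cellT' := block_cell (m:=m) (N:=N) (k:=(k + k0)%N) Tp'.
have [hW hY _ _] := close _ bn1 T cellT.
have [hS10 _] := hS _ bn2 T' (proj1 (andP cellT')).
exists T => //.
pose q : R := Num.sqrt (2 * ln k%:R).
have y1 := root4_ge1 Tp; have y0 := lt_le_trans ltr01 y1.
have x1 := root4_ge1 Tp'; have x0 := lt_le_trans ltr01 x1.
have key := adjoint_cos m sigma Y Z beta T1.
rewrite cosT sinT mul1r mul0r addr0 in key.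
set y := root4 T in hVk zT y1 y0 hW hY key.
set x := root4 T' in zT' x1 x0 hS10.
have x2 : x ^+ 2 = N%:R^-1 * y ^+ 2.
  by rewrite zT zT' zS mulKf// gt_eqF.
have xy : x <= y.
  rewrite -(@ler_pXn2r R 2)// ?nnegrE ?(ltW x0) ?(ltW y0)// x2.
  by rewrite ler_piMl ?sqr_ge0// invf_le1// ler1n (leq_trans _ N2).
have x3 : x ^+ 3 <= N%:R^-1 * y ^+ 3.
  have -> : x ^+ 3 = x ^+ 2 * x by ring.
  have -> : N%:R^-1 * y ^+ 3 = (N%:R^-1 * y ^+ 2) * y by ring.
  by rewrite x2 ler_wpM2l// mulr_ge0 ?sqr_ge0// invr_ge0 ltW.
have x41 : 1 < x.
  rewrite -(@ltr_pXn2r R 4)// ?nnegrE ?(ltW x0)// expr1n root4X4; last first.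
    by rewrite (le_trans _ Tp')// lerN10.
  by rewrite ltrDl (lt_le_trans _ Te')// (lt_trans _ e1).
have lx : 0 < ln (x ^+ 6) by rewrite ln_gt0// exprn_egt1.
have xy6 : ln (x ^+ 6) <= ln (y ^+ 6).
  by rewrite ler_ln ?posrE ?exprn_gt0// lerXn2r ?nnegrE ?(ltW x0) ?(ltW y0).
have lnle : lnlnr T' <= lnlnr T.
  by rewrite ler_wsqrtr// ler_pM2l// ler_ln ?posrE// (lt_le_trans lx).
have lT1 : 1 <= ln T.
  rewrite -[leLHS](expRK (1 : R)) ler_ln ?posrE ?expR_gt0//.
  by rewrite (lt_le_trans (expR_gt0 _) Te).
have Ty : T <= y ^+ 4 by rewrite root4X4 ?(ltW T1)// lerDr.
have lTy : ln T <= ln (y ^+ 6).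
  rewrite ler_ln ?posrE ?exprn_gt0//; last exact: lt_le_trans (expR_gt0 _) Te.
  by apply: (le_trans Ty); rewrite ler_weXn2l.
have lTp : 0 < ln T := lt_le_trans ltr01 lT1.
have lyp : 0 < ln (y ^+ 6) := lt_le_trans lx xy6.
have lnT2 : Num.sqrt (2 * T * ln (ln T)) <= y ^+ 2 * lnlnr T.
  have -> : y ^+ 2 = Num.sqrt ((y ^+ 2) ^+ 2) by rewrite sqrtr_sqr ger0_norm ?sqr_ge0.
  rewrite -sqrtrM ?sqr_ge0// ler_wsqrtr// -exprM.
  have -> : y ^+ (2 * 2) * (2 * ln (ln (y ^+ 6))) = 2 * y ^+ 4 * ln (ln (y ^+ 6)) by ring.
  rewrite ler_pM ?mulr_ge0 ?ln_ge0//; first by rewrite ler_pM2l.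
  by rewrite ler_ln ?posrE.
have q0 : 0 <= q by exact: sqrtr_ge0.
have y30 : 0 <= y ^+ 3 by rewrite exprn_ge0// ltW.
have hSn : r * b * q * y ^+ 3 - N%:R^-1 * y ^+ 3 * ((1 + e) * q) <=
    S 1 0 (block m N (k + k0).+1).
  have h1 : - S 1 0 (block m N (k + k0)) <= N%:R^-1 * y ^+ 3 * ((1 + e) * q).
    rewrite (le_trans (ler_norm _))// normrN (le_trans hS10)//.
    have x30 : 0 <= x ^+ 3 by rewrite exprn_ge0// ltW.
    exact: ler_pM x30 (sqrtr_ge0 _) x3 (le_trans lnle lnT).
  have h2 : b * q * y ^+ 3 <=
      Num.sqrt (2 * (V (block m N (k + k0).+1) - V (block m N (k + k0))) * ln k%:R).
    have -> : b * q * y ^+ 3 = Num.sqrt ((b * y ^+ 3) ^+ 2 * (2 * ln k%:R)).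
      rewrite sqrtrM ?sqr_ge0// sqrtr_sqr ger0_norm ?(mulr_ge0 b0 y30)// -/q.
      exact: mulrAC.
    rewrite ler_wsqrtr// mulrCA -[leRHS]mulrA ler_pM2l// ler_wpM2r ?(le_trans _ l1)//.
    by apply: le_trans hVk; rewrite exprMn -exprM.
  have h3 : r * (b * q * y ^+ 3) <= r * Num.sqrt (2 *
      (V (block m N (k + k0).+1) - V (block m N (k + k0))) * ln k%:R) by rewrite ler_wpM2l// ltW.
  have -> : r * b * q * y ^+ 3 = r * (b * q * y ^+ 3) by ring.
  by rewrite lerBlDr (le_trans h3)// (le_trans hk)// lerD2l.
have hYy : `|Y T / (4 * y ^+ 3)| <= C * y ^+ 3.
  have y3p : 0 < 4 * y ^+ 3 by rewrite mulr_gt0// exprn_gt0.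
  rewrite normrM [X in _ * X]ger0_norm ?invr_ge0 ?(ltW y3p)//.
  rewrite ler_pdivrMr// (le_trans hY)//.
  have -> : C * y ^+ 3 * (4 * y ^+ 3) = C * y ^+ 5 * (4 * y) by ring.
  rewrite ler_peMr//; last by apply: mulr_ege1 => //; rewrite ler1n.
  by rewrite mulr_ge0// exprn_ge0// ltW.
have hW10 : sigma * S 1 0 (block m N (k + k0).+1) - C * y ^+ 3 <= W 1 0 T.
  have := hW 1 0; rewrite normr1 normr0 addr0 mul1r ler_norml => /andP[h _].
  by rewrite addrC -lerBrDr.
have gq : 2 * C <= g * q.
  have h : 2 * C / g <= q.
    rewrite -[leLHS]ger0_norm; last by rewrite divr_ge0 ?(ltW g0)// mulr_ge0.
    rewrite -sqrtr_sqr ler_wsqrtr// (le_trans lC)//.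
    by rewrite ler_peMl ?ler1n// (le_trans ler01).
  by move: h; rewrite ler_pdivrMr// [leRHS]mulrC.
have kq : kappa * lnlnr T <= kappa * ((1 + e) * q) by rewrite ler_wpM2l.
have final : y ^+ 3 * (kappa * sigma * lnlnr T) <= y * (Z T + sigma * beta T).
  have h1 : y ^+ 3 * (2 * C) <= y ^+ 3 * (g * q) by rewrite ler_wpM2l.
  have h2 : y ^+ 3 * sigma * (kappa * lnlnr T) <=
      y ^+ 3 * sigma * (kappa * ((1 + e) * q)).
    by rewrite ler_wpM2l// mulr_ge0// ltW.
  have h3 : sigma * (r * b * q * y ^+ 3 - N%:R^-1 * y ^+ 3 * ((1 + e) * q)) <=
    sigma * S 1 0 (block m N (k + k0).+1) by rewrite ler_wpM2l// ltW.
  move: hYy; rewrite ler_norml => /andP[hYy _].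
  have -> : y * (Z T + sigma * beta T) = W 1 0 T + Y T / (4 * y ^+ 3).
    by rewrite key subrK.
  have gE : y ^+ 3 * (g * q) + y ^+ 3 * sigma * (kappa * ((1 + e) * q)) =
     sigma * (r * b * q * y ^+ 3 - N%:R^-1 * y ^+ 3 * ((1 + e) * q)).
    by rewrite /g; ring.
  have -> : y ^+ 3 * (kappa * sigma * lnlnr T) =
     y ^+ 3 * sigma * (kappa * lnlnr T) by ring.
  move: h1 h2 h3 hYy hW10 gE; clear -s0; move: (sigma * S 1 0 _) => s1.
  move: (sigma * _) (y ^+ 3 * sigma * _) (_ * (g * q)) => s2 s3 s4; lra.
apply: (@le_trans _ _ (kappa * sigma * (y ^+ 2 * lnlnr T))).
  by rewrite ler_wpM2l// mulr_ge0// ltW.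
rewrite -(ler_pM2l y0); apply: le_trans final.
by rewrite le_eqVlt; apply/orP; left; apply/eqP; ring.
Qed.

End lower.

(** * Almost sure bounds *)

(** Centred Gaussian laws are symmetric. *)
Lemma gaussian_noiseN (d : measure_display) (T : measurableType d) (R : realType)
    (P : probability T R) (xi : nat -> T -> R) (v : nat -> R) :
  gaussian_noise P xi v -> gaussian_noise P (fun i w => - xi i w) v.
Proof.
move=> [mxi ixi exi]; split.
- by move=> i; exact: measurable_funN.
- move=> n A mA.
  have mA' i : measurable (-%R @^-1` A i : set R).
    by rewrite -[X in measurable X]setTI; apply: measurable_funN.
  exact: (ixi n _ mA').
- move=> i l; have := exi i (- l); rewrite sqrrN => <-.
  by apply: eq_integral => w _; rewrite mulrN mulNr.
Qed.

Section process.
Context (d : measure_display) (T : measurableType d) (R : realType)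
  (P : probability T R).
Local Notation grid n := (Num.sqrt n%:R : R).
Local Notation s3 := (1 / Num.sqrt 3 : R).
Variables (m sigma : R) (B : R -> T -> R) (Y Z : T -> R -> R).
Hypotheses (m0 : 0 < m) (s0 : 0 < sigma).
Hypothesis hnoise : gaussian_noise P
  (fun i w => B (grid i.+1) w - B (grid i) w) (fun i => grid i.+1 - grid i).
Hypothesis hpath : {ae P, forall w, averaged_path m sigma (Y w) (Z w) (B ^~ w)}.

Lemma inv_sqrt3X2 : s3 ^+ 2 = 1 / 3.
Proof. by rewrite expr_div_n sqr_sqrtr// expr1n. Qed.

Lemma inv_sqrt3_itv : 1 / 2 < s3 < 1.
Proof.
have := inv_sqrt3X2; have : 0 < s3 by rewrite divr_gt0// sqrtr_gt0.
by set s := s3 => ? ?; apply/andP; split; nra.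
Qed.

Lemma axis_lil : {ae P, forall w, [/\ lil_bound m (B ^~ w) 1 0 1,
  lil_bound m (B ^~ w) (-1) 0 1, lil_bound m (B ^~ w) 0 1 1 &
  lil_bound m (B ^~ w) 0 (-1) 1]}.
Proof.
have h (u v : R) : u ^+ 2 + v ^+ 2 = 1 -> {ae P, forall w, lil_bound m (B ^~ w) u v 1}.
  by move=> uv; apply: grid_lil_upper => //; rewrite uv; lra.
have h10 := h 1 0 ltac:(ring); have hN10 := h (-1) 0 ltac:(ring).
have h01 := h 0 1 ltac:(ring); have h0N1 := h 0 (-1) ltac:(ring).
apply: filterS2 (filterI h10 hN10) (filterI h01 h0N1) => w [? ?] [? ?].
by split.
Qed.

(** The net has mesh 1 / N with 2 / N <= e / 3, and r = 1 / sqrt 3 + e / 3 leaves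
    room for the squared radius 1 + 6 / N of the net. *)
Lemma process_upper (e : R) : 0 < e -> {ae P, forall w, exists T0, forall t, T0 <= t ->
  Z w t + sigma * B t w <= (s3 + e) * sigma * Num.sqrt (2 * t * ln (ln t))}.
Proof.
move=> e0; have /andP[s3l s3u] := inv_sqrt3_itv; have s32 := inv_sqrt3X2.
set s := s3 in s3l s3u s32 *.
pose N := (Num.truncn (6 / e)).+1; pose r := s + e / 3.
have Np : 0 < N%:R :> R by rewrite ltr0n.
have hN : 2 / N%:R <= e / 3.
  have : 6 / e <= N%:R by rewrite ltW// truncnS_gt.
  by rewrite ler_pdivrMr// => h; rewrite ler_pdivrMr//; lra.
have r0 : 0 < r by rewrite /r; lra.
have hr : (1 + 6 / N%:R) / 3 < r ^+ 2.
  have -> : (1 + 6 / N%:R) / 3 = 1 / 3 + 2 / N%:R :> R by field; rewrite gt_eqF.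
  by rewrite /r; nra.
have net : {ae P, forall w, forall i j : nat,
    let u := i%:R / N%:R - 1 in let v := j%:R / N%:R - 1 in
    u ^+ 2 + v ^+ 2 <= 1 + 6 / N%:R -> lil_bound m (B ^~ w) u v r}.
  apply/ae_foralln => i; apply/ae_foralln => j /=.
  set u := i%:R / N%:R - 1; set v := j%:R / N%:R - 1.
  have [uv|uv] := pselect (u ^+ 2 + v ^+ 2 <= 1 + 6 / N%:R).
    have : {ae P, forall w, lil_bound m (B ^~ w) u v r}.
      by apply: grid_lil_upper => //; lra.
    by apply: filterS => w h _.
  by apply: nearW => w.
move: net axis_lil hpath; apply: filterS3 => w net [l1 l2 l3 l4] hp.
have [C [T0 hT0]] := path_upper m0 s0 hp l1 l2 l3 l4 (isT : (0 < N)%N) r0 net.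
have a0 : 0 <= sigma * (r + 2 / N%:R).
  apply: mulr_ge0; first exact: ltW.
  by apply: addr_ge0; rewrite ?(ltW r0)// divr_ge0.
have ab : sigma * (r + 2 / N%:R) < (s + e) * sigma.
  by rewrite mulrC ltr_pM2r// /r; lra.
have [T1 hT1] := lnlnr_upper C a0 ab.
exists (Num.max T0 T1) => t; rewrite ge_max => /andP[t0 t1].
exact: le_trans (hT0 t t0) (hT1 t t1).
Qed.

(** Every loss is a fraction of e: the factor b = 1 / sqrt 3 - e / 4 in the
    standard deviation b y^3 of a block, the level r = 1 - e / 8 of the iterated
    logarithm, and the share 1 / N <= e / 8 of the time before the block. *)
Lemma process_lower (e : R) : 0 < e -> e <= 1 / 2 ->
  {ae P, forall w, forall t0, exists2 t, t0 <= t &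
    (s3 - e) * sigma * Num.sqrt (2 * t * ln (ln t)) <= Z w t + sigma * B t w}.
Proof.
move=> e0 e1; have /andP[s3l s3u] := inv_sqrt3_itv; have s32 := inv_sqrt3X2.
set s := s3 in s3l s3u s32 *.
pose b := s - e / 4; pose r := 1 - e / 8.
have b3 : b ^+ 2 < 1 / 3 by rewrite /b -s32; nra.
pose M := Num.max (8 / e) (1 / 3 - b ^+ 2)^-1.
pose N := (Num.truncn M).+2.
have Np : 0 < N%:R :> R by rewrite ltr0n.
have : M <= N%:R by rewrite ltW// (lt_trans (truncnS_gt _))// ltr_nat.
rewrite ge_max => /andP[hN1 hN2].
have hN : N%:R^-1 <= e / 8.
  by move: hN1; rewrite ler_pdivrMr// => h; rewrite -div1r ler_pdivrMr//; lra.
have [k0 hk0] := block_variance m0 (isT : (1 < N)%N) b3 hN2.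
have tS k : (block m N (k + k0) <= block m N (k.+1 + k0))%N.
  by apply: block_nd => //; exact: ltW (proj1 (hk0 _ (leq_addl _ _))).
have r01 : 0 < r < 1 by rewrite /r; apply/andP; split; lra.
have y0 k : 0 < root4 (resonant m N (k + k0).+1).
  rewrite (lt_le_trans ltr01)// root4_ge1// ltW//.
  exact: (proj1 (hk0 _ (leqW (leq_addl _ _)))).
have b0 : 0 < b by rewrite /b; lra.
have V0 k : 0 <
  wvar (fun i => grid i.+1 - grid i) (fun i => wkb m 1 0 (grid i)) (block m N (k.+1 + k0)) -
  wvar (fun i => grid i.+1 - grid i) (fun i => wkb m 1 0 (grid i)) (block m N (k + k0)).
  apply: lt_le_trans (proj2 (hk0 _ (leq_addl _ _))).
  by rewrite mulr_gt0 ?exprn_gt0.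
have := noise_lil_lower hnoise tS r01 V0.
move: axis_lil hpath; apply: filterS3 => w [l1 l2 l3 l4] hp freq.
apply: (@path_lower _ m N m0 isT sigma _ _ _ s0 hp l1 l2 l3 l4 b r (e / 8) (s - e) k0).
- exact: ltW.
- by case/andP: r01.
- by rewrite divr_gt0.
- lra.
- have : (1 + e / 8) * (s - e + N%:R^-1) <= (1 + e / 8) * (s - e + e / 8).
    by rewrite ler_pM2l ?lerD2l//; lra.
  move=> h; apply: le_lt_trans h _; rewrite /b /r; nra.
- by move=> k kk; exact: (proj2 (hk0 k kk)).
- exact: freq.
Qed.

End process.

(** * The upper and lower limits *)

Lemma limf_esup_pinfty (R : realType) (f : R -> R) (l : R) :
  (forall e, 0 < e -> exists T0, forall t, T0 <= t -> f t <= l + e) ->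
  (forall e, 0 < e -> forall t0, exists2 t, t0 <= t & l - e <= f t) ->
  limf_esup (fun t => (f t)%:E) (pinfty_nbhs R) = l%:E.
Proof.
move=> hu hl; rewrite limf_esupE; apply/eqP; rewrite eq_le; apply/andP; split.
  apply/lee_addgt0Pr => e e0; have [T0 hT0] := hu e e0.
  apply: (@le_trans _ _ (ereal_sup [set (f t)%:E | t in [set t | T0 < t]])).
    apply: ereal_inf_lbound; exists [set t | T0 < t] => //.
    by exists T0; split; first exact: num_real.
  apply: ge_ereal_sup => _ [t /= tT <-]; rewrite -EFinD lee_fin.
  exact/hT0/ltW.
apply: le_ereal_inf_tmp => _ [V [M [_ hM]] <-].
apply/lee_addgt0Pr => e e0; have [t tM ft] := hl e e0 (M + 1).
apply: (@le_trans _ _ ((f t)%:E + e%:E)%E).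
  by rewrite -EFinD lee_fin -lerBlDr.
rewrite leeD2r//; apply: ereal_sup_ubound; exists t => //.
by apply: hM; rewrite (lt_le_trans _ tM)// ltrDl.
Qed.

Lemma averaged_pathN (R : realType) (m sigma : R) (Y Z beta : R -> R) :
  averaged_path m sigma Y Z beta ->
  averaged_path m sigma (fun t => - Y t) (fun t => - Z t) (fun t => - beta t).
Proof.
move=> [hY hZ cb ob]; split.
- move=> t t0; have := is_deriveN (hY t t0).
  by rewrite opprD -mulrN.
- move=> t t0; have := is_deriveN (hZ t t0).
  by rewrite mulrN.
- by move=> t; apply: cvgN; exact: cb.
- have [n0 h] := ob; exists n0 => n nn s hs.
  by rewrite -opprD normrN; exact: h.
Qed.

Section limsup.
Context (d : measure_display) (T : measurableType d) (R : realType)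
  (P : probability T R).
Local Notation grid n := (Num.sqrt n%:R : R).
Variables (m sigma : R) (X B : R -> T -> R) (Y Z : T -> R -> R).
Hypotheses (m0 : 0 < m) (s0 : 0 < sigma).
Hypothesis hnoise : gaussian_noise P
  (fun i w => B (grid i.+1) w - B (grid i) w) (fun i => grid i.+1 - grid i).
Hypothesis hpath : {ae P, forall w, averaged_path m sigma (Y w) (Z w) (B ^~ w)}.
Hypothesis hX : {ae P, forall w, forall t, 0 <= t -> X t w = Z w t + sigma * B t w}.

Lemma process_limsup : {ae P, forall w,
  limf_esup (fun t : R => (X t w / Num.sqrt (2 * t * ln (ln t)))%:E)
    (pinfty_nbhs R) = (1 / Num.sqrt 3 * sigma)%:E}.
Proof.
pose e n : R := n.+2%:R^-1.
have e0 n : 0 < e n by rewrite invr_gt0.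
have e12 n : e n <= 1 / 2 by rewrite div1r lef_pV2 ?posrE// ler_nat.
have en (c : R) : 0 < c -> exists n, e n * sigma <= c.
  move=> c0; exists (Num.truncn (sigma / c)).
  have : sigma / c <= (Num.truncn (sigma / c)).+2%:R.
    by rewrite ltW// (lt_trans (truncnS_gt _))// ltr_nat.
  by rewrite ler_pdivrMr// => h; rewrite mulrC ler_pdivrMr// mulrC.
have [T1 T11 hT1] := @lnln_ge R 1.
have L0 t : T1 <= t -> 0 < Num.sqrt (2 * t * ln (ln t)).
  move=> tT; have [_ l1] := hT1 t tT.
  rewrite sqrtr_gt0 mulr_gt0 ?(lt_le_trans ltr01 l1)// mulr_gt0//.
  by rewrite (lt_le_trans ltr01)// (le_trans T11).
have hu : {ae P, forall w n, exists T0, forall t, T0 <= t -> Z w t + sigma * B t w <=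
    (1 / Num.sqrt 3 + e n) * sigma * Num.sqrt (2 * t * ln (ln t))}.
  by apply/ae_foralln => n; exact: (process_upper m0 s0 hnoise hpath (e0 n)).
have hl : {ae P, forall w n t0, exists2 t, t0 <= t &
    (1 / Num.sqrt 3 - e n) * sigma * Num.sqrt (2 * t * ln (ln t)) <=
    Z w t + sigma * B t w}.
  by apply/ae_foralln => n; exact: (process_lower m0 s0 hnoise hpath (e0 n) (e12 n)).
move: hu hl hX; apply: filterS3 => w hu hl hXw.
apply: limf_esup_pinfty => c c0; have [n hn] := en c c0.
  have [T0 hT0] := hu n; exists (Num.max T0 T1) => t; rewrite ge_max => /andP[t0 t1].
  have tp : 0 <= t by rewrite (le_trans _ t1)// (le_trans _ T11).
  rewrite ler_pdivrMr ?L0// hXw// (le_trans (hT0 t t0))//.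
  by rewrite ler_wpM2r ?sqrtr_ge0// mulrDl lerD2l.
move=> t0; have [t] := hl n (Num.max t0 T1); rewrite ge_max => /andP[tt0 t1] ht.
have tp : 0 <= t by rewrite (le_trans _ t1)// (le_trans _ T11).
exists t => //; rewrite ler_pdivlMr ?L0// hXw//; apply: le_trans ht.
by rewrite ler_wpM2r ?sqrtr_ge0// mulrBl lerD2l lerN2.
Qed.

End limsup.

Theorem theorem3p6 (R : realType) (d : measure_display) (T : measurableType d)
    (P : probability T R) (hP : measure_is_complete P)
    (F : R -> set (set T)) (hF : usual_filtration P F)
    (B : R -> T -> R) (hB : brownian_motion P B) (hBF : adapted F B)
    (b sigma : R) (hb : b < 0) (hsigma : 0 < sigma)
    (psi : R -> R) (hpsi : {within `[-1, 0], continuous psi})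
    (X : R -> T -> R) (hX : averaged_delay_solution P F B b sigma psi X) :
  {ae P, forall w,
    limf_esup (fun t : R => (X t w / Num.sqrt (2 * t * ln (ln t)))%:E)
      (pinfty_nbhs R) = (1 / Num.sqrt 3 * sigma)%:E
    /\
    limf_einf (fun t : R => (X t w / Num.sqrt (2 * t * ln (ln t)))%:E)
      (pinfty_nbhs R) = (- (1 / Num.sqrt 3 * sigma))%:E}.
Proof.
pose m := 2 * Num.sqrt (- b).
have b0 : 0 < - b by rewrite oppr_gt0.
have m0 : 0 < m by rewrite mulr_gt0// sqrtr_gt0.
have mE : m ^+ 2 / 4 = - b by rewrite /m exprMn sqr_sqrtr ?(ltW b0)//; field.
pose Y w (t : R) := \int[lebesgue_measure]_(u in `[-1, t]) X u w.
pose Z w (t : R) := psi 0 + \int[lebesgue_measure]_(s in `[0, t]) (b / (1 + s) * Y w s).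
have XE : {ae P, forall w, forall t, 0 <= t -> X t w = Z w t + sigma * B t w}.
  exact: solution_equation hX.
have hpath : {ae P, forall w, averaged_path m sigma (Y w) (Z w) (B ^~ w)}.
  have hB2 : {ae P, forall w, {within `[0, +oo[, continuous (B ^~ w)} /\
      exists n0 : nat, forall n, (n0 <= n)%N -> forall s : R,
      Num.sqrt n%:R <= s <= Num.sqrt n.+1%:R -> `|B s w - B (Num.sqrt n%:R) w| <= 1}.
    move: (brownian_continuous hB) (brownian_grid_oscillation hB).
    by apply: filterS2.
  move: hB2 (solution_continuous hX) XE; apply: filterS3 => w [cB oB] cX eX.
  split => //.
  - by move=> t t0; exact: (@is_derive_average R b sigma (psi 0) (X ^~ w) (B ^~ w) cX eX t t0).
  - move=> t t0; have := is_derive_drift b (psi 0) cX t0.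
    by rewrite mE mulNr mulNr opprK.
have hnoise := brownian_noise hB (t := fun n => Num.sqrt n%:R)
  (sqrtr_ge0 _) (fun i => grid_le R (leqnSn i)).
have hS := process_limsup m0 hsigma hnoise hpath XE.
have hI : {ae P, forall w,
    limf_esup (fun t : R => (- X t w / Num.sqrt (2 * t * ln (ln t)))%:E)
      (pinfty_nbhs R) = (1 / Num.sqrt 3 * sigma)%:E}.
  apply: (@process_limsup _ _ _ P m sigma (fun t w => - X t w) (fun t w => - B t w)
    (fun w t => - Y w t) (fun w t => - Z w t)) => //.
  - have := gaussian_noiseN hnoise; congr gaussian_noise; apply/funext => i.
    by apply/funext => w; rewrite opprB addrC opprK.
  - by apply: filterS hpath => w; exact: averaged_pathN.
  - by apply: filterS XE => w h t t0; rewrite h// opprD mulrN.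
move: hS hI; apply: filterS2 => w hS hI; split => //.
rewrite /limf_einf EFinN -hI; congr (- limf_esup _ _)%E.
by apply/funext => t /=; rewrite mulNr.
Qed.
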